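(* Let $\mathfrak g$ be a simple complex Lie algebra of simply laced type, $m\ge1$ an integer and $\lambda$ a dominant integral weight. Then the Demazure module $D(m,\lambda)$ of level $m$ can be equipped with the structure of a cyclic $U(\mathfrak g\otimes\mathbb C[t,t^{-1}])$-module such that its $\mathfrak g$-module structure (restriction to $\mathfrak g=\mathfrak g\otimes1$) coincides with the natural $\mathfrak g$-module structure coming from the Demazure module construction.
   Context: Setting. $\mathfrak g$ is a simply laced simple complex Lie algebra with triangular decomposition $\mathfrak g=\mathfrak n^-\oplus\mathfrak h\oplus\mathfrak n^+$, $\mathfrak b=\mathfrak h\oplus\mathfrak n^+$, Weyl group $W$ with longest element $w_0$, highest root $\Theta$. The invariant form is normalized so that the induced isomorphism $\nu:\mathfrak h\to\mathfrak h^*$ sends $\Theta^\vee$ to $\Theta$; in the simply laced case $\nu$ identifies the coweight lattice with the weight lattice, and $D(m,\lambda)$ means $D(m,\lambda^\vee)$ for the dominant coweight $\lambda^\vee$ with $\nu(\lambda^\vee)=\lambda$. Demazure modules. $\widehat{\mathfrak g}=\mathfrak g\otimes\mathbb C[t,t^{-1}]\oplus\mathbb CK\oplus\mathbb Cd$ is the affine Kac-Moody algebra, $\widehat{\mathfrak b}=\mathfrak b\oplus\mathbb CK\oplus\mathbb Cd\oplus\mathfrak g\otimes t\mathbb C[t]$, $\Lambda_0$ the fundamental weight which is $1$ on $K$ and $0$ on $\mathfrak h\oplus\mathbb Cd$, $\delta$ the basic imaginary root, $V(\Lambda)$ the irreducible $\widehat{\mathfrak g}$-module of dominant integral highest weight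 $\Lambda$, $W^{\rm aff}$ the affine Weyl group. For $w\in W^{\rm aff}$, $V_w(\Lambda)=U(\widehat{\mathfrak b})v_{w(\Lambda)}\subset V(\Lambda)$, with $v_{w(\Lambda)}$ spanning the weight space of weight $w(\Lambda)$. The extended affine Weyl group $W\ltimes t_L$, $L=\nu(\text{coweight lattice})$, acts on weights modulo $\delta$ with $t_\mu(\Lambda)=\Lambda+\langle\Lambda,K\rangle\mu$, and equals $\Sigma\ltimes W^{\rm aff}$, $\Sigma$ the stabilizer of the dominant affine chamber; $V_{w\sigma}(\Lambda)=V_w(\sigma(\Lambda))$ for $w\in W^{\rm aff},\sigma\in\Sigma$. For a dominant coweight $\lambda^\vee$ set $D(m,\lambda^\vee)=V_{t_{-\nu(\lambda_*^\vee)}}(m\Lambda_0)$ with $\lambda_*^\vee=-w_0(\lambda^\vee)$. It is finite dimensional and stable under $\mathfrak g\otimes\mathbb C[t]$, in particular under $\mathfrak g$. *)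

(* Defs.v *)
From HB Require Import structures.
From mathcomp Require Import all_boot all_order all_algebra finmap.
From mathcomp Require Import boolp classical_sets reals.
From mathcomp Require Import complex monalg.
From mathcomp Require Import ring.

Set Implicit Arguments.
Unset Strict Implicit.
Unset Printing Implicit Defensive.

Import Order.TTheory GRing.Theory Num.Theory.
Local Open Scope ring_scope.

HB.mixin Record Lmodule_isLie (F : fieldType) L of GRing.Lmodule F L := {
  lie : L -> L -> L;
  lieDZl : forall (c : F) x y z, lie (c *: x + y) z = c *: lie x z + lie y z;
  liexx : forall x, lie x x = 0;
  liexDZ : forall (c : F) x y z, lie z (c *: x + y) = c *: lie z x + lie z y;
  lieJ : forall x y z, lie x (lie y z) + lie y (lie z x) + lie z (lie x y) = 0
}.

#[short(type="lieAlgType")]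
HB.structure Definition LieAlgebra (F : fieldType) :=
  {L of Lmodule_isLie F L & GRing.Lmodule F L}.

#[short(type="fdLieAlgType")]
HB.structure Definition FdLieAlgebra (F : fieldType) :=
  {L of Lmodule_isLie F L & Vector F L}.

Section LieTheory.
Variables (F : fieldType) (L : lieAlgType F).
Implicit Types x y z : L.

Lemma lieDl x y z : lie (x + y) z = lie x z + lie y z.
Proof. by rewrite -[x]scale1r lieDZl !scale1r. Qed.
Lemma lie0l z : lie 0 z = 0.
Proof. by apply: (addIr (lie 0 z)); rewrite -lieDl !add0r. Qed.
Lemma lieZl (c : F) x z : lie (c *: x) z = c *: lie x z.
Proof. by rewrite -[c *: x]addr0 lieDZl lie0l addr0. Qed.
Lemma lieDr x y z : lie z (x + y) = lie z x + lie z y.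
Proof. by rewrite -[x]scale1r liexDZ !scale1r. Qed.
Lemma lie0r z : lie z 0 = 0.
Proof. by apply: (addIr (lie z 0)); rewrite -lieDr !add0r. Qed.
Lemma lieZr (c : F) x z : lie z (c *: x) = c *: lie z x.
Proof. by rewrite -[c *: x]addr0 liexDZ lie0r addr0. Qed.
Lemma lieC x y : lie x y = - lie y x.
Proof.
have := liexx (x + y); rewrite lieDl !lieDr !liexx add0r addr0.
by move/eqP; rewrite addr_eq0 => /eqP.
Qed.
Lemma lieNl x y : lie (- x) y = - lie x y.
Proof. by rewrite -scaleN1r lieZl scaleN1r. Qed.
Lemma lieNr x y : lie y (- x) = - lie y x.
Proof. by rewrite -scaleN1r lieZr scaleN1r. Qed.
Lemma lie_suml I (s : seq I) (f : I -> L) z :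
  lie (\sum_(i <- s) f i) z = \sum_(i <- s) lie (f i) z.
Proof. by elim/big_rec2: _ => [|i a b _ <-]; rewrite ?lie0l ?lieDl. Qed.
Lemma lie_sumr I (s : seq I) (f : I -> L) z :
  lie z (\sum_(i <- s) f i) = \sum_(i <- s) lie z (f i).
Proof. by elim/big_rec2: _ => [|i a b _ <-]; rewrite ?lie0r ?lieDr. Qed.

End LieTheory.

Section Representations.
Variables (F : fieldType) (L : lieAlgType F).

Record lieRep (V : lmodType F) := LieRep {
  rep_act :> L -> V -> V;
  rep_linl : forall (c : F) x y v,
    rep_act (c *: x + y) v = c *: rep_act x v + rep_act y v;
  rep_linr : forall (c : F) x v w,
    rep_act x (c *: v + w) = c *: rep_act x v + rep_act x w;
  rep_lie : forall x y v,
    rep_act (lie x y) v = rep_act x (rep_act y v) - rep_act y (rep_act x v)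
}.

Variables (V : lmodType F) (rho : lieRep V).

(* U(A) v for a Lie subalgebra A of L: U(A) is spanned by the monomials
   a_1 ... a_k with a_j in A, and foldr rho v [:: a_1; ...; a_k] is
   a_1 ... a_k v. *)
Definition Uspan (A : L -> Prop) (v : V) : {pred V} := fun x =>
  `[< exists2 s : seq (F * seq L),
        (forall p, p \in s -> forall a, a \in p.2 -> A a)
      & x = \sum_(p <- s) p.1 *: foldr rho v p.2 >].

Lemma Uspan_submod A v : submod_closed (Uspan A v).
Proof.
split=> [|c x y /asboolP[s As ->] /asboolP[s' As' ->]]; apply/asboolP.
  by exists [::] => //; rewrite big_nil.
exists ([seq (c * p.1, p.2) | p <- s] ++ s').
  move=> p; rewrite mem_cat => /orP[/mapP[q qs ->]|/As'//] /=; exact: As.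
rewrite big_cat /= big_map scaler_sumr; congr (_ + _).
by apply: eq_bigr => p _; rewrite scalerA.
Qed.

HB.instance Definition _ A v :=
  GRing.isSubmodClosed.Build F V (Uspan A v) (Uspan_submod A v).

Record Usubmod (A : L -> Prop) (v : V) :=
  USubmod { usub_val : V; usub_mem : usub_val \in Uspan A v }.

HB.instance Definition _ A v := [isSub for @usub_val A v].
HB.instance Definition _ A v := [Choice of Usubmod A v by <:].
HB.instance Definition _ A v := [SubChoice_isSubLmodule of Usubmod A v by <:].

Definition cyclic_rep :=
  exists v, forall x, x \in Uspan (fun=> True) v.

Definition irreducible_rep :=
  (exists v : V, v != 0) /\
  (forall S : {pred V}, submod_closed S ->
     (forall a v, v \in S -> rho a v \in S) ->
     (forall v, v \in S -> v = 0) \/ (forall v, v \in S)).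

End Representations.

Section Loop.
Variables (F : numFieldType) (g : lieAlgType F).

(* g (x) C[t, t^-1]: finitely supported functions int -> g, where
   << x *g n >> is x (x) t^n and f@_n is the coefficient of t^n. *)
Definition loop := {malg g[int]}.

HB.instance Definition _ := GRing.Zmodule.copy loop {malg g[int]}.

Definition tmon (x : g) (n : int) : loop := << x *g n >>.

Definition loop_scale (c : F) (f : loop) : loop :=
  \sum_(n <- msupp f) tmon (c *: f@_n) n.

Definition loop_lie (x y : loop) : loop :=
  \sum_(i <- msupp x) \sum_(j <- msupp y) tmon (lie (x@_i) (y@_j)) (i + j).

(* the derivation t d/dt *)
Definition loop_deriv (x : loop) : loop :=
  \sum_(i <- msupp x) tmon (i%:~R *: x@_i) i.

Lemma loopP (x y : loop) : (forall n, x@_n = y@_n) -> x = y.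
Proof. by move=> h; apply/malgP. Qed.

Lemma loop_coefD n (x y : loop) : (x + y)@_n = x@_n + y@_n.
Proof. exact: (@mcoeffD _ _ n (x : {malg g[int]}) y). Qed.

Lemma coef_tmon x n k : (tmon x n)@_k = x *+ (n == k).
Proof. exact: mcoeffU. Qed.

Lemma tmonD n : {morph tmon^~ n : x y / x + y}.
Proof. exact: (@monalgUD _ _ n). Qed.

Lemma tmon0 n : tmon 0 n = 0.
Proof. exact: (@monalgU0 _ _ n). Qed.

Lemma loopEw (x : loop) (d : {fset int}) : (msupp x `<=` d)%fset ->
  x = \sum_(n <- d) tmon (x@_n) n.
Proof. by move=> xd; exact: (@monalgEw _ _ x d xd). Qed.

Lemma loopE (x : loop) : x = \sum_(n <- msupp x) tmon (x@_n) n.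
Proof. exact: loopEw. Qed.

Lemma big_loopw (V : zmodType) (x : loop) (d : {fset int})
    (G : g -> int -> V) : (forall n, G 0 n = 0) -> (msupp x `<=` d)%fset ->
  \sum_(n <- msupp x) G x@_n n = \sum_(n <- d) G x@_n n.
Proof.
move=> G0 xd; apply: big_fset_incl => // n _ nx.
by rewrite mcoeff_outdom.
Qed.

Lemma coef_loop_scale c (x : loop) n : (loop_scale c x)@_n = c *: x@_n.
Proof.
rewrite /loop_scale raddf_sum /=.
under eq_bigr => i _ do rewrite coef_tmon.
case: (boolP (n \in msupp x)) => nx; last first.
  rewrite (mcoeff_outdom nx) scaler0 big_seq big1 // => i ix.
  by case: eqP => // ein; rewrite ein (negPf nx) in ix.
rewrite (big_fsetD1 n) //= eqxx mulr1n big_seq big1 ?addr0 // => i.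
by rewrite !inE => /andP[/negPf->].
Qed.

Lemma loop_scaleA a b x : loop_scale a (loop_scale b x) = loop_scale (a * b) x.
Proof. by apply: loopP => n; rewrite !coef_loop_scale scalerA. Qed.
Lemma loop_scale1 : left_id 1 loop_scale.
Proof. by move=> x; apply: loopP => n; rewrite coef_loop_scale scale1r. Qed.
Lemma loop_scaleDr : right_distributive loop_scale +%R.
Proof.
move=> c x y; apply: loopP => n.
by rewrite loop_coefD !coef_loop_scale loop_coefD scalerDr.
Qed.
Lemma loop_scaleDl x : {morph loop_scale^~ x : a b / a + b}.
Proof.
move=> a b; apply: loopP => n.
by rewrite loop_coefD !coef_loop_scale scalerDl.
Qed.

HB.instance Definition _ := GRing.Zmodule_isLmodule.Build F loop
  loop_scaleA loop_scale1 loop_scaleDr loop_scaleDl.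

Lemma loop_coefZ c (x : loop) n : (c *: x)@_n = c *: x@_n.
Proof. exact: coef_loop_scale. Qed.

Lemma tmonZ c x n : tmon (c *: x) n = c *: tmon x n.
Proof.
apply: loopP => k; rewrite loop_coefZ !coef_tmon.
by case: eqP; rewrite ?mulr1n ?mulr0n ?scaler0.
Qed.

Lemma big_loopDZ (V : lmodType F) (G : g -> int -> V) :
  (forall n c u v, G (c *: u + v) n = c *: G u n + G v n) ->
  forall c (x y : loop),
  \sum_(n <- msupp (c *: x + y)) G (c *: x + y)@_n n =
  c *: (\sum_(n <- msupp x) G x@_n n) + \sum_(n <- msupp y) G y@_n n.
Proof.
move=> GL c x y.
have G0 n : G 0 n = 0.
  have := GL n 1 0 0; rewrite !scale1r addr0 => /eqP.
  by rewrite eq_sym -subr_eq0 addrK => /eqP.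
pose d := (msupp (c *: x + y) `|` msupp x `|` msupp y)%fset.
rewrite !(@big_loopw V _ d) ?fsubsetUr //.
- rewrite scaler_sumr -big_split /=; apply: eq_bigr => n _.
  by rewrite loop_coefD loop_coefZ GL.
- by apply: fsubset_trans (fsubsetUl _ _); apply: fsubsetUr.
- by apply: fsubset_trans (fsubsetUl _ _); apply: fsubsetUl.
Qed.

Lemma big_tmon (V : zmodType) (G : g -> int -> V) u k :
  (forall n, G 0 n = 0) -> \sum_(n <- msupp (tmon u k)) G (tmon u k)@_n n = G u k.
Proof.
move=> G0; rewrite (@big_loopw V _ [fset k]%fset) //; last exact: msuppU_le.
by rewrite big_seq_fset1 coef_tmon eqxx.
Qed.

Lemma loop_ind (P : loop -> Prop) :
  P 0 -> (forall x y, P x -> P y -> P (x + y)) -> (forall u n, P (tmon u n)) ->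
  forall x, P x.
Proof.
move=> P0 PD Pt x; rewrite (loopE x); elim: (enum_fset _) => [|n s ih].
  by rewrite big_nil.
by rewrite big_cons; apply: PD.
Qed.

Lemma loop_lieDZl c x y z :
  loop_lie (c *: x + y) z = c *: loop_lie x z + loop_lie y z.
Proof.
apply: (@big_loopDZ _ (fun u i => \sum_(j <- msupp z) tmon (lie u z@_j) (i + j))).
move=> n a u v; rewrite scaler_sumr -big_split /=; apply: eq_bigr => j _.
by rewrite lieDZl tmonD tmonZ.
Qed.

Lemma loop_liexDZ c x y z :
  loop_lie z (c *: x + y) = c *: loop_lie z x + loop_lie z y.
Proof.
rewrite /loop_lie scaler_sumr -big_split /=; apply: eq_bigr => i _.
apply: (@big_loopDZ _ (fun u j => tmon (lie z@_i u) (i + j))).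
by move=> n a u v; rewrite liexDZ tmonD tmonZ.
Qed.

Lemma loop_lie_tmon x y m n : loop_lie (tmon x m) (tmon y n) = tmon (lie x y) (m + n).
Proof.
rewrite /loop_lie.
rewrite (@big_tmon _ (fun u i => \sum_(j <- msupp (tmon y n))
   tmon (lie u (tmon y n)@_j) (i + j))); last first.
  by move=> k; rewrite big1 // => j _; rewrite lie0l tmon0.
by rewrite (@big_tmon _ (fun u j => tmon (lie x u) (m + j))) // => k;
  rewrite lie0r tmon0.
Qed.

Let lDl x y z : loop_lie (x + y) z = loop_lie x z + loop_lie y z.
Proof. by rewrite -[x]scale1r loop_lieDZl !scale1r. Qed.
Let lDr x y z : loop_lie z (x + y) = loop_lie z x + loop_lie z y.
Proof. by rewrite -[x]scale1r loop_liexDZ !scale1r. Qed.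
Let l0l z : loop_lie 0 z = 0.
Proof. by apply: (addIr (loop_lie 0 z)); rewrite -lDl !add0r. Qed.
Let l0r z : loop_lie z 0 = 0.
Proof. by apply: (addIr (loop_lie z 0)); rewrite -lDr !add0r. Qed.

Lemma loop_lieC x y : loop_lie x y = - loop_lie y x.
Proof.
elim/loop_ind: x => [|x x' hx hx'|u m]; rewrite ?l0l ?l0r ?oppr0 //.
  by rewrite lDl lDr hx hx' opprD.
elim/loop_ind: y => [|y y' hy hy'|v n]; rewrite ?l0l ?l0r ?oppr0 //.
  by rewrite lDl lDr hy hy' opprD.
by rewrite !loop_lie_tmon lieC addrC /tmon (@monalgUN _ _ (n + m)).
Qed.

Lemma loop_liexx x : loop_lie x x = 0.
Proof.
have /eqP := loop_lieC x x; rewrite -addr_eq0 -mulr2n -scaler_nat.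
by rewrite scaler_eq0 pnatr_eq0 /= => /eqP.
Qed.

Lemma loop_lieJ x y z :
  loop_lie x (loop_lie y z) + loop_lie y (loop_lie z x)
    + loop_lie z (loop_lie x y) = 0.
Proof.
elim/loop_ind: x => [|x x' hx hx'|u m]; first by rewrite !(l0l, l0r) !addr0.
  rewrite !(lDl, lDr) -[0]addr0 -{1}hx -hx'.
  by rewrite [X in X + _ = _]addrACA [LHS]addrACA.
elim/loop_ind: y => [|y y' hy hy'|v n]; first by rewrite !(l0l, l0r) !addr0.
  rewrite !(lDl, lDr) -[0]addr0 -{1}hy -hy'.
  by rewrite [X in X + _ = _]addrACA [LHS]addrACA.
elim/loop_ind: z => [|z z' hz hz'|w k]; first by rewrite !(l0l, l0r) !addr0.
  rewrite !(lDl, lDr) -[0]addr0 -{1}hz -hz'.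
  by rewrite [X in X + _ = _]addrACA [LHS]addrACA.
rewrite !loop_lie_tmon (_ : n + (k + m) = m + (n + k)); last first.
  by rewrite addrA addrC.
rewrite (_ : k + (m + n) = m + (n + k)); last by rewrite addrC addrA.
by rewrite -!tmonD lieJ tmon0.
Qed.

HB.instance Definition _ := Lmodule_isLie.Build F loop
  loop_lieDZl loop_liexx loop_liexDZ loop_lieJ.

Lemma lie_tmon x y m n : lie (tmon x m) (tmon y n) = tmon (lie x y) (m + n).
Proof. exact: loop_lie_tmon. Qed.

Lemma loop_derivDZ c x y :
  loop_deriv (c *: x + y) = c *: loop_deriv x + loop_deriv y.
Proof.
apply: (@big_loopDZ _ (fun u i => tmon (i%:~R *: u) i)) => n a u v.
by rewrite scalerDr scalerA mulrC -scalerA tmonD tmonZ.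
Qed.

Lemma loop_deriv_tmon x n : loop_deriv (tmon x n) = n%:~R *: tmon x n.
Proof.
rewrite /loop_deriv (@big_tmon _ (fun u i => tmon (i%:~R *: u) i)) ?tmonZ // => k.
by rewrite scaler0 tmon0.
Qed.

Lemma loop_derivD x y : loop_deriv (x + y) = loop_deriv x + loop_deriv y.
Proof. by rewrite -[x]scale1r loop_derivDZ !scale1r. Qed.
Lemma loop_deriv0 : loop_deriv 0 = 0.
Proof. by apply: (addIr (loop_deriv 0)); rewrite -loop_derivD !add0r. Qed.
Lemma loop_derivN x : loop_deriv (- x) = - loop_deriv x.
Proof. by rewrite -scaleN1r -[X in loop_deriv X]addr0 loop_derivDZ loop_deriv0 addr0 scaleN1r. Qed.

Lemma loop_deriv_lie x y :
  loop_deriv (lie x y) = lie (loop_deriv x) y + lie x (loop_deriv y).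
Proof.
elim/loop_ind: x => [|x x' hx hx'|u m].
- by rewrite !(lie0l, loop_deriv0) addr0.
- by rewrite !(lieDl, loop_derivD) hx hx' addrACA.
elim/loop_ind: y => [|y y' hy hy'|v n].
- by rewrite !(lie0r, loop_deriv0) addr0.
- by rewrite !(lieDr, loop_derivD) hy hy' addrACA.
rewrite lie_tmon !loop_deriv_tmon lieZl lieZr lie_tmon -scalerDl.
by rewrite -intrD.
Qed.

End Loop.

Record inv_form (F : fieldType) (g : lieAlgType F) := InvForm {
  form :> g -> g -> F;
  formDZl : forall (c : F) x y z, form (c *: x + y) z = c * form x z + form y z;
  formC : forall x y, form x y = form y x;
  form_inv : forall x y z, form (lie x y) z = form x (lie y z)
}.

Section Semidirect.
Variables (F : fieldType) (L : lieAlgType F) (D : L -> L).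
Hypothesis DDZ : forall c x y, D (c *: x + y) = c *: D x + D y.
Hypothesis Dlie : forall x y, D (lie x y) = lie (D x) y + lie x (D y).

Let br (x : L) (a : F) (y : L) (b : F) : L := lie x y + a *: D y - b *: D x.
Let dbl (x y z : L) (a b : F) :=
  b *: lie x (D z) + a *: lie y (D z) + (a * b) *: D (D z).

Let br2 (x y z : L) (a b c : F) :
  br x a (br y b z c) 0 = lie x (lie y z) + (dbl x y z a b - dbl z x y c a).
Proof.
rewrite /br /dbl scale0r subr0 !lieDr lieNr !lieZr.
have DD u v : D (u + v) = D u + D v by rewrite -[u]scale1r DDZ !scale1r.
have D0 : D 0 = 0 by apply: (addIr (D 0)); rewrite -DD !add0r.
have DZ k u : D (k *: u) = k *: D u by rewrite -[k *: u]addr0 DDZ D0 addr0.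
have DN u : D (- u) = - D u by rewrite -scaleN1r DZ scaleN1r.
rewrite !DD DN !DZ Dlie !scalerDr !scalerN !scalerA (lieC (D y) z) scalerN.
rewrite (mulrC c a) !opprD !addrA.
by rewrite [RHS](ACl (1*2*6*5*3*4*7)).
Qed.

Lemma semidirect_lieJ x y z a b c :
  br x a (br y b z c) 0 + br y b (br z c x a) 0 + br z c (br x a y b) 0 = 0.
Proof.
rewrite !br2 -[RHS](lieJ x y z).
move: (lie x _) (lie y _) (lie z _) (dbl _ _ _ _ _) (dbl _ _ _ _ _)
  (dbl _ _ _ _ _) => j1 j2 j3 p r q.
rewrite !addrA [LHS](ACl (1*4*7*(2*6)*(3*8)*(5*9))) /=.
by rewrite !(subrr, addNr) !addr0.
Qed.

End Semidirect.

Section Affine.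
Variables (F : numFieldType) (g : lieAlgType F) (B : inv_form g).

(* the Kac-Moody cocycle (x (x) t^m, y (x) t^n) |-> m delta_{m+n,0} (x|y) *)
Definition cocycle (x y : loop g) : F :=
  \sum_(i <- msupp x) i%:~R * B x@_i y@_(- i).

(* the triple (x, a, b) stands for x + a K + b d *)
Definition affine (b : inv_form g) := (loop g * F^o * F^o)%type.
HB.instance Definition _ := GRing.Lmodule.copy (affine B) (loop g * F^o * F^o)%type.

Definition affine_lie (x y : affine B) : affine B :=
  (lie x.1.1 y.1.1 + x.2 *: loop_deriv y.1.1 - y.2 *: loop_deriv x.1.1,
   cocycle x.1.1 y.1.1, 0).

Let BDl x y z : B (x + y) z = B x z + B y z.
Proof. by rewrite -[x]scale1r formDZl mul1r scale1r. Qed.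
Let B0l z : B 0 z = 0.
Proof. by apply: (addIr (B 0 z)); rewrite -BDl !add0r. Qed.
Let BDr x y z : B z (x + y) = B z x + B z y.
Proof. by rewrite !(formC B z) BDl. Qed.
Let B0r z : B z 0 = 0. Proof. by rewrite formC. Qed.
Let BZl (c : F) x z : B (c *: x) z = c * B x z.
Proof. by rewrite -[c *: x]addr0 formDZl B0l addr0. Qed.
Let BZr (c : F) x z : B z (c *: x) = c * B z x.
Proof. by rewrite !(formC B z) BZl. Qed.

Lemma cocycleDZl c x y z :
  cocycle (c *: x + y) z = c * cocycle x z + cocycle y z.
Proof.
apply: (@big_loopDZ _ _ F^o (fun u i => i%:~R * B u z@_(- i))) => n a u v.
by rewrite formDZl mulrDr mulrCA.
Qed.
Lemma cocycleDZr c x y z :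
  cocycle z (c *: x + y) = c * cocycle z x + cocycle z y.
Proof.
rewrite /cocycle mulr_sumr -big_split /=; apply: eq_bigr => i _.
by rewrite loop_coefD loop_coefZ BDr BZr mulrDr mulrCA.
Qed.
Let cDl x y z : cocycle (x + y) z = cocycle x z + cocycle y z.
Proof. by rewrite -[x]scale1r cocycleDZl mul1r !scale1r. Qed.
Let cDr x y z : cocycle z (x + y) = cocycle z x + cocycle z y.
Proof. by rewrite -[x]scale1r cocycleDZr mul1r !scale1r. Qed.
Let c0l z : cocycle 0 z = 0.
Proof. by apply: (addIr (cocycle 0 z)); rewrite -cDl !add0r. Qed.
Let c0r z : cocycle z 0 = 0.
Proof. by apply: (addIr (cocycle z 0)); rewrite -cDr !add0r. Qed.
Let cZl c x z : cocycle (c *: x) z = c * cocycle x z.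
Proof. by rewrite -[c *: x]addr0 cocycleDZl c0l addr0. Qed.
Let cZr c x z : cocycle z (c *: x) = c * cocycle z x.
Proof. by rewrite -[c *: x]addr0 cocycleDZr c0r addr0. Qed.

Lemma cocycle_tmon x y m n :
  cocycle (tmon x m) (tmon y n) = if m + n == 0 then m%:~R * B x y else 0.
Proof.
rewrite /cocycle (@big_tmon _ _ F (fun u i => i%:~R * B u (tmon y n)@_(- i))).
  by rewrite coef_tmon -addr_eq0 addrC; case: eqP; rewrite ?B0r ?mulr0.
by move=> k; rewrite B0l mulr0.
Qed.

Lemma cocycleC x y : cocycle x y = - cocycle y x.
Proof.
elim/loop_ind: x => [|x x' hx hx'|u m]; rewrite ?c0l ?c0r ?oppr0 //.
  by rewrite cDl cDr hx hx' opprD.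
elim/loop_ind: y => [|y y' hy hy'|v n]; rewrite ?c0l ?c0r ?oppr0 //.
  by rewrite cDl cDr hy hy' opprD.
rewrite !cocycle_tmon addrC; case: eqP => [|_]; last by rewrite oppr0.
by move/eqP; rewrite addr_eq0 => /eqP ->; rewrite formC rmorphN mulNr opprK.
Qed.

Lemma cocyclexx x : cocycle x x = 0.
Proof.
have /eqP := cocycleC x x; rewrite -addr_eq0 -mulr2n mulrn_eq0 /=.
by move/eqP.
Qed.

Lemma cocycle_deriv x y :
  cocycle (loop_deriv x) y + cocycle x (loop_deriv y) = 0.
Proof.
elim/loop_ind: x => [|x x' hx hx'|u m].
- by rewrite !(loop_deriv0, c0l) addr0.
- by rewrite !(loop_derivD, cDl) addrACA hx hx' addr0.
elim/loop_ind: y => [|y y' hy hy'|v n].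
- by rewrite !(loop_deriv0, c0r) addr0.
- by rewrite !(loop_derivD, cDr) addrACA hy hy' addr0.
rewrite !loop_deriv_tmon cZl cZr cocycle_tmon -mulrDl -intrD.
by case: eqP => [->|_]; rewrite ?mul0r ?mulr0.
Qed.

Lemma cocycleJ x y z :
  cocycle x (lie y z) + cocycle y (lie z x) + cocycle z (lie x y) = 0.
Proof.
elim/loop_ind: x => [|x x' hx hx'|u m].
- by rewrite !(lie0l, lie0r, c0l, c0r) !addr0.
- rewrite !(lieDl, lieDr, cDl, cDr) -[0]addr0 -{1}hx -hx'.
  by rewrite [X in X + _ = _]addrACA [LHS]addrACA.
elim/loop_ind: y => [|y y' hy hy'|v n].
- by rewrite !(lie0l, lie0r, c0l, c0r) !addr0.
- rewrite !(lieDl, lieDr, cDl, cDr) -[0]addr0 -{1}hy -hy'.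
  by rewrite [X in X + _ = _]addrACA [LHS]addrACA.
elim/loop_ind: z => [|z z' hz hz'|w k].
- by rewrite !(lie0l, lie0r, c0l, c0r) !addr0.
- rewrite !(lieDl, lieDr, cDl, cDr) -[0]addr0 -{1}hz -hz'.
  by rewrite [X in X + _ = _]addrACA [LHS]addrACA.
rewrite !lie_tmon !cocycle_tmon.
have e1 : n + (k + m) = m + (n + k) by rewrite addrA addrC.
have e2 : k + (m + n) = m + (n + k) by rewrite addrC addrA.
rewrite e1 e2; case: eqP => [h|_]; last by rewrite !addr0.
have -> : B v (lie w u) = B u (lie v w) by rewrite -form_inv formC.
have -> : B w (lie u v) = B u (lie v w) by rewrite formC form_inv.
by rewrite -!mulrDl -!intrD -addrA h mul0r.
Qed.

Lemma affineP (x y : affine B) :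
  x.1.1 = y.1.1 -> x.1.2 = y.1.2 -> x.2 = y.2 -> x = y.
Proof. by case: x y => [[x xc] xd] [[y yc] yd] /= -> -> ->. Qed.

Lemma affine_lieDZl c (x y z : affine B) :
  affine_lie (c *: x + y) z = c *: affine_lie x z + affine_lie y z.
Proof.
case: x y z => [[x xc] xd] [[y yc] yd] [[z zc] zd].
apply: affineP => /=; last by rewrite scaler0 addr0.
  rewrite lieDZl loop_derivDZ.
  rewrite !scalerDl !scalerDr !scalerN !scalerA (mulrC zd c) opprD !addrA.
  by rewrite [LHS](ACl (1*3*5*2*4*6)).
exact: cocycleDZl.
Qed.

Lemma affine_lieC (x y : affine B) : affine_lie x y = - affine_lie y x.
Proof.
case: x y => [[x xc] xd] [[y yc] yd].
apply: affineP => /=; last by rewrite oppr0.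
  by rewrite lieC !opprD opprK -!addrA [X in _ + X]addrC.
exact: cocycleC.
Qed.

Lemma affine_liexx (x : affine B) : affine_lie x x = 0.
Proof. by rewrite /affine_lie liexx add0r subrr cocyclexx. Qed.

Lemma affine_liexDZ c (x y z : affine B) :
  affine_lie z (c *: x + y) = c *: affine_lie z x + affine_lie z y.
Proof.
by rewrite affine_lieC affine_lieDZl opprD -scalerN -!affine_lieC.
Qed.

Lemma affine_lieJ (x y z : affine B) :
  affine_lie x (affine_lie y z) + affine_lie y (affine_lie z x)
    + affine_lie z (affine_lie x y) = 0.
Proof.
apply: affineP; last by rewrite /= !addr0.
  exact: (semidirect_lieJ (@loop_derivDZ F g) (@loop_deriv_lie F g)).
have h := cocycleJ x.1.1 y.1.1 z.1.1.
rewrite /= -[RHS]h.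
have eN u v : cocycle u (- v) = - cocycle u v.
  by rewrite -scaleN1r cZr mulN1r.
rewrite !cDr !eN !cZr.
have eD u v : cocycle u (loop_deriv v) = cocycle v (loop_deriv u).
  by apply/eqP; rewrite [X in _ == X]cocycleC -addr_eq0 addrC cocycle_deriv.
rewrite (eD y.1.1 x.1.1) (eD z.1.1 x.1.1) (eD z.1.1 y.1.1).
ring.
Qed.

HB.instance Definition _ := Lmodule_isLie.Build F (affine B)
  affine_lieDZl affine_liexx affine_liexDZ affine_lieJ.

End Affine.

Section SimpleLie.
Variables (F : numFieldType) (g : fdLieAlgType F).

Definition simple_lie :=
  (exists x y : g, lie x y != 0) /\
  (forall I : {vspace g}, (forall x y, y \in I -> lie x y \in I) ->
     I = 0%VS \/ I = fullv).

Definition ad_diagonalizable (x : g) :=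
  exists2 e : seq g, basis_of fullv e
    & forall y, y \in e -> exists c : F, lie x y = c *: y.

Definition cartan_subalgebra (h : {vspace g}) :=
  [/\ forall x y, x \in h -> y \in h -> lie x y = 0,
      forall x, (forall y, y \in h -> lie y x = 0) -> x \in h
    & forall x, x \in h -> ad_diagonalizable x].

Definition root_space (h : {vspace g}) (a : 'Hom(subvs_of h, F^o)) (x : g) :=
  forall y : subvs_of h, lie (vsval y) x = a y *: x.

Definition is_root (h : {vspace g}) (a : 'Hom(subvs_of h, F^o)) :=
  a != 0 /\ exists2 x : g, x != 0 & root_space a x.

Definition in_Qplus (h : {vspace g}) l (s : l.-tuple 'Hom(subvs_of h, F^o))
    (b : 'Hom(subvs_of h, F^o)) :=
  exists n : 'I_l -> nat, b = \sum_i tnth s i *+ n i.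

Definition is_base (h : {vspace g}) l (s : l.-tuple 'Hom(subvs_of h, F^o)) :=
  [/\ forall i, is_root (tnth s i), free s
    & forall b, is_root b -> in_Qplus s b \/ in_Qplus s (- b)].

(* A triangular decomposition g = n^- + h + n^+ is given by a Cartan subalgebra
   and a base of the root system. *)
Record triangular := Triangular {
  cartan : {vspace g};
  cartanP : cartan_subalgebra cartan;
  rank : nat;
  simple_roots : rank.-tuple 'Hom(subvs_of cartan, F^o);
  simple_rootsP : is_base simple_roots
}.

Variable T : triangular.
Local Notation H := (subvs_of (cartan T)).
Local Notation dual := 'Hom(H, F^o).
Local Notation alpha := (tnth (simple_roots T)).
Implicit Types (a b lam mu : dual) (c : H).

(* the element c of [g_a, g_{-a}] with a(c) = 2 *)
Definition is_coroot a c :=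
  a c = 2 /\
  exists2 s : seq (g * g),
    forall p, p \in s -> root_space a p.1 /\ root_space (- a) p.2
    & vsval c = \sum_(p <- s) lie p.1 p.2.

Definition coroot a : H := xget 0 [set c | is_coroot a c]%classic.

Definition highest_root : dual :=
  xget 0 [set a | is_root a /\
                  forall b, is_root b -> in_Qplus (simple_roots T) (a - b)]%classic.

Definition simply_laced :=
  forall i j, i != j ->
    alpha i (coroot (alpha j)) = 0 \/ alpha i (coroot (alpha j)) = -1.

Definition nplus (x : g) :=
  exists2 s : seq g,
    forall y, y \in s ->
      exists b, [/\ is_root b, in_Qplus (simple_roots T) b & root_space b y]
    & x = \sum_(y <- s) y.

Definition borel (x : g) :=
  exists (y : H) (z : g), nplus z /\ x = vsval y + z.

Definition dominant_integral lam :=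
  forall i, exists n : nat, lam (coroot (alpha i)) = n%:R.

Definition dominant_coweight c := forall i, exists n : nat, alpha i c = n%:R.

Definition coweight c := forall i, exists n : int, alpha i c = n%:~R.

(* Elements of the Weyl group are represented by words in the simple
   reflections: [:: i_1; ...; i_k] stands for s_{i_1} ... s_{i_k}. *)
Definition weyl (w : seq 'I_(rank T)) c : H :=
  foldr (fun i c => c - alpha i c *: coroot (alpha i)) c w.

Definition weyl_dual (w : seq 'I_(rank T)) lam : dual :=
  foldr (fun i lam => lam - lam (coroot (alpha i)) *: alpha i) lam w.

Definition reduced_word (w : seq 'I_(rank T)) :=
  forall w', weyl w' =1 weyl w -> (size w <= size w')%N.

Definition longest_word (w : seq 'I_(rank T)) :=
  reduced_word w /\ forall w', reduced_word w' -> (size w' <= size w)%N.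

Variable B : inv_form g.

Definition nu c : dual := linfun (fun y : H => B (vsval c) (vsval y) : F^o).

Lemma nuE c (y : H) : nu c y = B (vsval c) (vsval y).
Proof.
pose f (y : H) : F^o := B (vsval c) (vsval y).
have fL : linear f.
  by move=> k u v; rewrite /f linearP /= formC formDZl 2!(formC B (vsval c)).
pose fl := HB.pack_for {linear H -> F^o} f (GRing.isLinear.Build F H F^o _ f fL).
exact: (lfunE fl).
Qed.

Definition normalized := nu (coroot highest_root) = highest_root.

(* The triple (lam, k, n) stands for lam + k Lambda_0 + n delta; its first
   component (lam, k) is its class modulo delta. *)
Definition affwt := (dual * F^o * F^o)%type.

(* y + a K + b d |-> L(y + a K + b d) *)
Definition affwt_eval (L : affwt) (x : H * F^o * F^o) : F :=
  L.1.1 x.1.1 + L.1.2 * x.1.2 + L.2 * x.2.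

(* None is the index 0, with alpha_0 = delta - Theta, alpha_0^v = K - Theta^v. *)
Definition affine_root (i : option 'I_(rank T)) : affwt :=
  if i is Some i then (alpha i, 0, 0) else (- highest_root, 0, 1).

Definition affine_coroot (i : option 'I_(rank T)) : H * F^o * F^o :=
  if i is Some i then (coroot (alpha i), 0, 0) else (- coroot highest_root, 1, 0).

Definition affine_weyl (w : seq (option 'I_(rank T))) (L : affwt) : affwt :=
  foldr (fun i L => L - (affwt_eval L (affine_coroot i) : F^o) *: affine_root i) L w.

Definition translation mu (x : dual * F^o) : dual * F^o := (x.1 + x.2 *: mu, x.2).

Definition extended_affine_weyl (f : dual * F^o -> dual * F^o) :=
  exists c w, coweight c /\
    forall x, f x = translation (nu c) (weyl_dual w x.1, x.2).

(* For F = R[i], 0 <= z means that z is real and nonnegative, so this is the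
   chamber of the real form of the space of weights modulo delta. *)
Definition dominant_chamber (x : dual * F^o) :=
  forall i, 0 <= affwt_eval (x, 0) (affine_coroot i).

Definition in_Sigma (f : dual * F^o -> dual * F^o) :=
  extended_affine_weyl f /\
  forall x, dominant_chamber (f x) <-> dominant_chamber x.

Definition affine_borel (x : affine B) :=
  (forall n : int, n < 0 -> (x.1.1)@_n = 0) /\ borel (x.1.1)@_0.

Definition affine_nplus (x : affine B) :=
  [/\ forall n : int, n < 0 -> (x.1.1)@_n = 0, nplus (x.1.1)@_0, x.1.2 = 0
    & x.2 = 0].

Section AffineModules.
Variables (V : lmodType F) (rho : lieRep (affine B) V).

Definition is_weight_vector (L : affwt) (v : V) :=
  v != 0 /\ forall x : H * F^o * F^o,
    rho (tmon (vsval x.1.1) 0, x.1.2, x.2) v = affwt_eval L x *: v.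

(* This determines V(L) up to isomorphism. *)
Definition is_irr_highest_weight (L : affwt) :=
  irreducible_rep rho /\
  exists2 v, is_weight_vector L v & forall x, affine_nplus x -> rho x v = 0.

End AffineModules.

(* A realization of D(m, c) = V_{t_{-nu(c')}}(m Lambda_0), c' = - w_0(c): a
   factorization t_{-nu(c')} = w sigma with w in W^aff and sigma in Sigma, a
   model V of V(L) with L = sigma(m Lambda_0) mod delta, and a generator
   v_{w(L)} of the (one-dimensional) weight space of weight w(L) in V. *)
Record demazure (m : nat) (c : H) := Demazure {
  dm_w0 : seq 'I_(rank T);
  dm_w0P : longest_word dm_w0;
  dm_w : seq (option 'I_(rank T));
  dm_sigma : dual * F^o -> dual * F^o;
  dm_sigmaP : in_Sigma dm_sigma;
  dm_factor : forall x,
    translation (- nu (- weyl dm_w0 c)) x = (affine_weyl dm_w (dm_sigma x, 0)).1;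
  dm_L : affwt;
  dm_LP : dm_L.1 = dm_sigma (0, m%:R);
  dm_V : lmodType F;
  dm_rho : lieRep (affine B) dm_V;
  dm_VP : is_irr_highest_weight dm_rho dm_L;
  dm_v : dm_V;
  dm_vP : is_weight_vector dm_rho (affine_weyl dm_w dm_L) dm_v
}.

Definition demazure_module m c (D : demazure m c) : lmodType F :=
  Usubmod (dm_rho D) affine_borel (dm_v D).

Definition demazure_val m c (D : demazure m c) (u : demazure_module D) : dm_V D :=
  usub_val u.

End SimpleLie.

(* Main.v *)
Require Import Defs.
From HB Require Import structures.
From mathcomp Require Import all_boot all_order all_algebra finmap.
From mathcomp Require Import boolp classical_sets reals.
From mathcomp Require Import complex monalg.
From mathcomp Require Import ring zify.

Set Implicit Arguments.
Unset Strict Implicit.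
Unset Printing Implicit Defensive.

Import Order.TTheory GRing.Theory Num.Theory.
Local Open Scope ring_scope.

(* The module D = D(m, lam) is graded by the eigenvalues of d, and its degrees are
   bounded, so g t^n kills D for n > N. Hence 1 + t acts invertibly, and letting x t^n
   act as x (1 + t)^n, for all integers n, extends the action of g[t], twisted by the
   automorphism t -> 1 + t, to the loop algebra; g itself and the cyclicity are not
   affected.

   What has to be shown is that D is stable under g. Its generator v is an extremal
   vector, of a weight w(L) which is antidominant for g. If f_i v <> 0, then by the
   invariance of the weights of V(L) under the affine Weyl group both L - beta and
   L + (k + 1) beta, with beta = w^-1(alpha_i), are weights; as all weights are <= L,
   this is impossible. So the f_i kill v, they preserve D = U(b^)v, and D is stable
   under the algebra n^- which they generate.

   The form B is nonzero because its normalization involves the highest root; this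
   nondegenerate form replaces the Killing form in the theory of the root system. *)

(** * Representations, sl2 and weights *)

(** The module V(L) is given only as an irreducible module with a highest weight vector; local
    nilpotence of the Chevalley generators and the bound and Weyl invariance of its weights are all
    derived. This starts from L being dominant integral: nonnegativity on the coroots holds because
    sigma preserves the affine chamber, integrality because sigma(m Lambda_0) = m Lambda_0 + m nu(c)
    for a coweight c. No weight space decomposition is available beforehand. Weight arguments use
    finite sums of weight vectors, separated by operators polynomial in the torus action. Modulo
    delta the weight w(L) is m Lambda_0 + m nu(w_0 lambda^v). It is antidominant because w_0 makes
    every simple root negative; as w_0 is only known as a reduced word of maximal length, this takes
    the exchange property. Simple lacing enters through nu(alpha_i^v) = alpha_i, which carries the
    normalization from Theta to the simple roots. The degrees in D are bounded below because D lies
    in U(g[t])v, and above because all weights are at most L. *)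

Section Submod.
Variables (F : fieldType) (V : lmodType F) (S : {pred V}).
Hypothesis Ssub : submod_closed S.

Lemma submod0 : 0 \in S. Proof. by case: Ssub. Qed.
Lemma submodZD c u v : u \in S -> v \in S -> c *: u + v \in S.
Proof. by case: Ssub => _; apply. Qed.
Lemma submodZ c u : u \in S -> c *: u \in S.
Proof. by move=> uS; rewrite -[_ *: _]addr0 submodZD ?submod0. Qed.
Lemma submodD u v : u \in S -> v \in S -> u + v \in S.
Proof. by move=> uS vS; rewrite -[u]scale1r submodZD. Qed.
Lemma submodB u v : u \in S -> v \in S -> u - v \in S.
Proof. by move=> uS vS; rewrite addrC -scaleN1r submodZD. Qed.
Lemma submod_sum (I : eqType) (s : seq I) (P : pred I) (f : I -> V) :
  (forall i, i \in s -> P i -> f i \in S) -> \sum_(i <- s | P i) f i \in S.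
Proof.
move=> fS; rewrite big_seq_cond; apply: (big_ind (fun x => x \in S)).
- exact: submod0.
- exact: submodD.
- by move=> i /andP[]; apply: fS.
Qed.
End Submod.

(** Subspaces are boolean predicates, while the invariants carried through inductions over [Uspan]
    are propositions. *)
Lemma asbool_submod (F : fieldType) (V : lmodType F) (P : V -> Prop) :
  P 0 -> (forall c u v, P u -> P v -> P (c *: u + v)) ->
  submod_closed (fun v => `[< P v >] : bool).
Proof.
by move=> P0 PD; split=> [|c u v /asboolP Pu /asboolP Pv]; apply/asboolP => //; apply: PD.
Qed.

Section RepTheory.
Variables (F : fieldType) (L : lieAlgType F) (V : lmodType F) (rho : lieRep L V).
Implicit Types (a b : L) (u v : V).

Lemma repDr a u v : rho a (u + v) = rho a u + rho a v.
Proof. by rewrite -[u]scale1r rep_linr !scale1r. Qed.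
Lemma rep0r a : rho a 0 = 0.
Proof. by apply: (addIr (rho a 0)); rewrite -repDr !add0r. Qed.
Lemma repZr c a u : rho a (c *: u) = c *: rho a u.
Proof. by rewrite -[c *: u]addr0 rep_linr rep0r addr0. Qed.
Lemma rep_sumr a I (s : seq I) (P : pred I) (f : I -> V) :
  rho a (\sum_(i <- s | P i) f i) = \sum_(i <- s | P i) rho a (f i).
Proof. by elim/big_rec2: _ => [|i x y _ <-]; rewrite ?rep0r ?repDr. Qed.
Lemma repDl a b u : rho (a + b) u = rho a u + rho b u.
Proof. by rewrite -[a]scale1r rep_linl !scale1r. Qed.
Lemma rep0l u : rho 0 u = 0.
Proof. by apply: (addIr (rho 0 u)); rewrite -repDl !add0r. Qed.
Lemma repZl c a u : rho (c *: a) u = c *: rho a u.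
Proof. by rewrite -[c *: a]addr0 rep_linl rep0l addr0. Qed.
Lemma repNl a u : rho (- a) u = - rho a u.
Proof. by rewrite -[- a]scaleN1r repZl scaleN1r. Qed.
Lemma rep_suml u I (s : seq I) (P : pred I) (f : I -> L) :
  rho (\sum_(i <- s | P i) f i) u = \sum_(i <- s | P i) rho (f i) u.
Proof. by elim/big_rec2: _ => [|i x y _ <-]; rewrite ?rep0l ?repDl. Qed.
Lemma rep_swap a b u : rho a (rho b u) = rho b (rho a u) + rho (lie a b) u.
Proof. by rewrite rep_lie addrC subrK. Qed.

Lemma iter_repD n a u v :
  iter n (rho a) (u + v) = iter n (rho a) u + iter n (rho a) v.
Proof. by elim: n => //= n ->; rewrite repDr. Qed.
Lemma iter_repZ n a c u : iter n (rho a) (c *: u) = c *: iter n (rho a) u.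
Proof. by elim: n => //= n ->; rewrite repZr. Qed.
Lemma iter_rep0 n a : iter n (rho a) 0 = 0.
Proof. by elim: n => //= n ->; rewrite rep0r. Qed.
Lemma iter_rep0_le n m a u :
  (n <= m)%N -> iter n (rho a) u = 0 -> iter m (rho a) u = 0.
Proof. by move=> /subnK <- u0; rewrite iterD u0 iter_rep0. Qed.

Lemma Uspan_closed (A : L -> Prop) v : submod_closed (Uspan rho A v).
Proof. exact: Uspan_submod. Qed.

Lemma Uspan_refl (A : L -> Prop) v : v \in Uspan rho A v.
Proof.
apply/asboolP; exists [:: (1, [::])]; first by move=> p; rewrite inE => /eqP->.
by rewrite big_seq1 scale1r.
Qed.

Lemma Uspan_act (A : L -> Prop) v a u :
  A a -> u \in Uspan rho A v -> rho a u \in Uspan rho A v.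
Proof.
move=> Aa /asboolP[s sA ->]; apply/asboolP.
exists [seq (p.1, a :: p.2) | p <- s].
  move=> _ /mapP[p ps ->] b /=; rewrite inE => /orP[/eqP->//|]; exact: sA.
by rewrite rep_sumr big_map; apply: eq_bigr => p _; rewrite /= repZr.
Qed.

Lemma Uspan_min (A : L -> Prop) v (S : {pred V}) :
  submod_closed S -> v \in S -> (forall a u, A a -> u \in S -> rho a u \in S) ->
  forall u, u \in Uspan rho A v -> u \in S.
Proof.
move=> Ssub vS SA u /asboolP[s sA ->]; apply: submod_sum => // p ps _.
apply: submodZ => //; have := sA _ ps; elim: p.2 => //= a l ih Al.
apply: SA; first by apply: Al; rewrite mem_head.
by apply: ih => b bl; apply: Al; rewrite inE bl orbT.
Qed.

(* PBW-type reordering: an element of A is moved to the right through a monomial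
   in the elements of N, at the price of shorter monomials. *)
Lemma Uspan_triangular (A N P : L -> Prop) v :
  (forall a, A a -> exists (s : seq L) p,
     [/\ forall f, f \in s -> N f, P p & a = \sum_(f <- s) f + p]) ->
  (forall p f, P p -> N f -> A (lie p f)) ->
  (forall p, P p -> rho p v \in Uspan rho N v) ->
  forall a u, A a -> u \in Uspan rho N v -> rho a u \in Uspan rho N v.
Proof.
move=> dA comm Pv a u Aa uS; have Usub := Uspan_closed N v.
have red w : w \in Uspan rho N v -> (forall p, P p -> rho p w \in Uspan rho N v) ->
    forall b, A b -> rho b w \in Uspan rho N v.
  move=> wS Pw b /dA[s [p [sN Pp ->]]]; rewrite repDl; apply: submodD => //.
    by rewrite rep_suml; apply: submod_sum => // f fs _; apply: Uspan_act => //; apply: sN.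
  exact: Pw.
(* The condition on [P] is carried along: moving p past f leaves [p, f] in [A], and [red] handles
   [A] on w only once [P] is known on w. *)
pose Q w := w \in Uspan rho N v /\ forall p, P p -> rho p w \in Uspan rho N v.
suff /asboolP[_ Pu] : u \in (fun w => `[< Q w >] : bool) by apply: (red u).
move: uS; apply: Uspan_min.
- apply: asbool_submod => [|c x y [xS Px] [yS Py]].
    by split=> [|p _]; rewrite ?rep0r; apply: submod0.
  split=> [|p Pp]; first exact: submodZD.
  by rewrite rep_linr; apply: submodZD => //; [apply: Px|apply: Py].
- by apply/asboolP; split=> //; apply: Uspan_refl.
move=> f w Nf /asboolP[wS Pw]; apply/asboolP; split=> [|p Pp].
  exact: Uspan_act.
rewrite rep_swap; apply: submodD => //; first exact: (Uspan_act Nf (Pw p Pp)).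
exact: (red w wS Pw _ (comm p f Pp Nf)).
Qed.

(** By the Leibniz rule f^(M+N) a u is a combination of terms ad(f)^i(a) f^(M+N-i) u, each with i >=
    M or M+N-i >= N. Induction on a bound for M + N avoids the binomial coefficients. *)
Lemma nilpotent_act M N f a u : iter M (lie f) a = 0 -> iter N (rho f) u = 0 ->
  iter (M + N) (rho f) (rho a u) = 0.
Proof.
move: {2}(M + N)%N (leqnn (M + N)%N) => k; elim: k M N a u => [|k ih] M N a u.
  by rewrite leqn0 addn_eq0 => /andP[/eqP-> /eqP->] /= _ ->; rewrite rep0r.
case: M => [|M] MN a0 u0; first by move: a0 => /= ->; rewrite rep0l ?iter_rep0 ?rep0r.
case: N MN u0 => [|N] MN u0; first by move: u0 => /= ->; rewrite rep0r ?iter_rep0 ?rep0r.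
rewrite addnS iterSr rep_swap iter_repD addrC.
have -> : iter (M.+1 + N) (rho f) (rho (lie f a) u) = 0.
  by rewrite addSnnS; apply: ih; rewrite // -iterSr.
by rewrite add0r; apply: ih => //; rewrite -?iterSr // addSnnS.
Qed.

End RepTheory.

Section Adjoint.
Variables (F : fieldType) (L : lieAlgType F).

Lemma ad_lie (x y v : L) : lie (lie x y) v = lie x (lie y v) - lie y (lie x v).
Proof.
rewrite lieC; have /eqP := lieJ x y v.
by rewrite addr_eq0 => /eqP <-; rewrite (lieC v x) lieNr.
Qed.

Lemma lie_swap (x y v : L) : lie x (lie y v) = lie y (lie x v) + lie (lie x y) v.
Proof. by rewrite ad_lie addrC subrK. Qed.

(** Through it the sl2 and weight lemmas apply to the Lie algebras themselves, root spaces being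
    weight spaces. *)
Definition ad_rep : lieRep L L :=
  @LieRep F L L (@lie F L) (fun c x y v => lieDZl c x y v)
    (fun c x v w => liexDZ c v w x) ad_lie.

End Adjoint.

(** * Locally nilpotent sl2-actions *)

Section Sl2.
Variables (F : numFieldType) (L : lieAlgType F) (V : lmodType F) (rho : lieRep L V).
Variables (e f h : L).
Hypotheses (ef : lie e f = h) (he : lie h e = 2 *: e) (hf : lie h f = - 2 *: f).
Implicit Types (u w : V) (q : F).

Lemma sl2_hf n q w : rho h w = q *: w ->
  rho h (iter n (rho f) w) = (q - n%:R *+ 2) *: iter n (rho f) w.
Proof.
move=> hw; elim: n => [|n ih]; first by rewrite /= mul0rn subr0.
rewrite iterS rep_swap ih repZr hf repZl -scalerDl; congr (_ *: _).
rewrite -(natr1 n); ring.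
Qed.

Lemma sl2_he n q w : rho h w = q *: w ->
  rho h (iter n (rho e) w) = (q + n%:R *+ 2) *: iter n (rho e) w.
Proof.
move=> hw; elim: n => [|n ih]; first by rewrite /= mul0rn addr0.
rewrite iterS rep_swap ih repZr he repZl -scalerDl; congr (_ *: _).
rewrite -(natr1 n); ring.
Qed.

(** The term with [rho e w] is kept because [sl2_inj] applies the formula to vectors that e does not
    kill. *)
Lemma sl2_efn n q w : rho h w = q *: w ->
  rho e (iter n.+1 (rho f) w) =
  iter n.+1 (rho f) (rho e w) + (n.+1%:R * (q - n%:R)) *: iter n (rho f) w.
Proof.
move=> hw; elim: n => [|n ih].
  by rewrite /= rep_swap ef hw subr0 mul1r.
rewrite iterS rep_swap ih repDr repZr ef (sl2_hf _ hw) -addrA; congr (_ + _).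
rewrite -scalerDl; congr (_ *: _); rewrite -!natr1; ring.
Qed.

(** At the last n with f^n w <> 0, applying e to f^(n+1) w = 0 gives (n + 1)(q - n) f^n w = 0. *)
Lemma sl2_highest_nat q w N : w != 0 -> rho e w = 0 -> rho h w = q *: w ->
  iter N (rho f) w = 0 -> exists n : nat, q = n%:R.
Proof.
move=> w0 ew hw; elim: N => [/= /eqP|n ih fw]; first by rewrite (negPf w0).
have := sl2_efn n hw; rewrite fw ew rep0r iter_rep0 add0r => /esym/eqP.
rewrite scaler_eq0 mulf_eq0 pnatr_eq0 /= subr_eq0 => /orP[/eqP ->|/eqP]; last exact: ih.
by exists n.
Qed.

(** The last nonzero e^n u is a highest weight vector, so its weight q + 2n is a natural number. *)
Lemma sl2_weight_int q u N : u != 0 -> rho h u = q *: u -> iter N (rho e) u = 0 ->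
  (forall w, exists M, iter M (rho f) w = 0) -> exists n : int, q = n%:~R.
Proof.
move=> u0 hu eu fnil.
have ex : exists n, iter n (rho e) u == 0 by exists N; rewrite eu.
case: (ex_minnP ex) => -[/= uz|n] ; first by rewrite uz in u0.
move=> /eqP en minn; have nz : iter n (rho e) u != 0.
  by apply/negP => /minn; rewrite ltnn.
have [M fM] := fnil (iter n (rho e) u).
have [k kE] := sl2_highest_nat nz en (sl2_he n hu) fM.
exists (k%:Z - n%:Z *+ 2); apply: (addIr (n%:R *+ 2)); rewrite kE.
by rewrite intrD rmorphN rmorphMn /= subrK.
Qed.

(** If e u = 0, the coefficients (j + 1)(p - j) with j < p are nonzero, and f^p u = 0 descends to u
    = 0. In general e u has weight p + 2, and f^(p+1) e u = e f^(p+1) u = 0 because the coefficient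
    (p + 1)(p - p) vanishes; induction on N gives e u = 0 and leads back to the first case. *)
Lemma sl2_inj p u N : rho h u = p%:R *: u -> iter N (rho e) u = 0 ->
  iter p (rho f) u = 0 -> u = 0.
Proof.
elim: N p u => [//|a ih] p u hu eu fu.
case: (posnP a) => [a0|a_gt0].
  move: eu; rewrite a0 /= => eu; suff: forall k, (k <= p)%N -> iter (p - k) (rho f) u = 0.
    by move=> /(_ p (leqnn p)); rewrite subnn.
  elim=> [|k ihk] kp; first by rewrite subn0.
  have := sl2_efn (p - k.+1) hu; rewrite subnSK // ihk ?(ltnW kp) // rep0r eu iter_rep0.
  rewrite add0r => /esym/eqP; rewrite scaler_eq0 mulf_eq0 pnatr_eq0 -natrB ?leq_subr //.
  by rewrite subKn // pnatr_eq0 orbF subn_eq0 leqNgt kp => /eqP.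
have e_u : rho h (rho e u) = (p.+2)%:R *: rho e u.
  by have := sl2_he 1 hu; rewrite /= => ->; rewrite -(natrD _ p 2) addn2.
have fe0 : iter p.+1 (rho f) (rho e u) = 0.
  have := sl2_efn p hu; rewrite subrr mulr0 scale0r addr0 => <-.
  by rewrite iterS fu !rep0r.
have eu0 : rho e u = 0.
  apply: (ih p.+2) => //; first by rewrite -iterSr.
  by rewrite iterS fe0 rep0r.
by apply: (ih p) => //; rewrite -(prednK a_gt0) iterSr eu0 iter_rep0.
Qed.

End Sl2.

(** * Weight vectors and their separation *)

Section Weights.
Variables (F : fieldType) (V : lmodType F) (T : Type) (act : T -> V -> V).
Variables (X : eqType) (ev : X -> T -> F).
Hypothesis act_lin : forall t c u v, act t (c *: u + v) = c *: act t u + act t v.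
Hypothesis ev_inj : forall mu nu, mu != nu -> exists t, ev mu t != ev nu t.

(** Zero is included, so that weight spaces are subspaces; nonvanishing is required separately. *)
Definition wvec mu v := forall t, act t v = ev mu t *: v.

Lemma wvecDZ mu c u v : wvec mu u -> wvec mu v -> wvec mu (c *: u + v).
Proof. by move=> wu wv t; rewrite act_lin wu wv scalerDr !scalerA mulrC. Qed.
Lemma wvec0 mu : wvec mu 0.
Proof.
by move=> t; rewrite scaler0 -[X in act t X](addNr 0) -scaleN1r act_lin scaleN1r addNr.
Qed.
Lemma wvecZ mu c u : wvec mu u -> wvec mu (c *: u).
Proof. by move=> wu; rewrite -[c *: u]addr0; apply: wvecDZ wu (wvec0 mu). Qed.
Lemma wvecD mu u v : wvec mu u -> wvec mu v -> wvec mu (u + v).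
Proof. by move=> wu; rewrite -[u]scale1r; apply: wvecDZ. Qed.

(* Q is the product of the operators (t - nu(t)) / (mu(t) - nu(t)) over nu in l,
   with t separating mu and nu. *)
Lemma weight_proj mu (l : seq X) : exists Q : V -> V,
  [/\ forall c u v, Q (c *: u + v) = c *: Q u + Q v,
      forall S : {pred V}, submod_closed S -> (forall t v, v \in S -> act t v \in S) ->
        forall v, v \in S -> Q v \in S,
      forall v, wvec mu v -> Q v = v
    & forall nu v, nu \in l -> nu != mu -> wvec nu v -> Q v = 0].
Proof.
elim: l => [|nu l [Q [Qlin Qstab Qid Q0]]]; first by exists id.
case: (eqVneq nu mu) => [->|nm].
  exists Q; split=> // nu' v; rewrite inE => /orP[/eqP->|]; last exact: Q0.
  by rewrite eqxx.
have [t] := ev_inj nm; rewrite eq_sym -subr_eq0 => dt.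
pose P v := (ev mu t - ev nu t)^-1 *: (act t v - ev nu t *: v).
have Plin c u v : P (c *: u + v) = c *: P u + P v.
  rewrite /P act_lin !scalerBr !scalerDr !scalerA opprD addrACA.
  by congr (_ *: _ - _ *: _ + _); ring.
have PE nu' v : wvec nu' v -> P v = ((ev mu t - ev nu t)^-1 * (ev nu' t - ev nu t)) *: v.
  by move=> wv; rewrite /P wv -scalerBl scalerA.
have Q00 : Q 0 = 0 by have := Qlin (-1) 0 0; rewrite scaler0 addr0 scaleN1r addNr.
exists (fun v => Q (P v)); split.
- by move=> c u v; rewrite Plin Qlin.
- move=> S Ssub Sact v vS; apply: Qstab => //; apply: submodZ => //.
  by apply: submodB => //; [apply: Sact|apply: submodZ].
- by move=> v wv; rewrite (PE _ _ wv) mulVf // scale1r Qid.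
move=> nu' v; rewrite inE => /orP[/eqP-> _ wv|nl nm' wv].
  by rewrite (PE _ _ wv) subrr mulr0 scale0r.
by rewrite (PE _ _ wv) -[_ *: v]addr0 Qlin Q00 addr0 (Q0 _ _ nl nm' wv) scaler0.
Qed.

Lemma weight_component (S : {pred V}) mu (s : seq (X * V)) :
  submod_closed S -> (forall t v, v \in S -> act t v \in S) ->
  (forall p, p \in s -> wvec p.1 p.2) ->
  \sum_(p <- s) p.2 \in S -> \sum_(p <- s | p.1 == mu) p.2 \in S.
Proof.
move=> Ssub Sact sw sS; have [Q [Qlin Qstab Qid Q0]] := weight_proj mu (map fst s).
have Q00 : Q 0 = 0 by have := Qlin (-1) 0 0; rewrite scaler0 addr0 scaleN1r addNr.
have QD u v : Q (u + v) = Q u + Q v by rewrite -[u]scale1r Qlin !scale1r.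
suff <- : Q (\sum_(p <- s) p.2) = \sum_(p <- s | p.1 == mu) p.2 by apply: Qstab.
rewrite (big_morph Q QD Q00) [RHS]big_mkcond big_seq [RHS]big_seq.
apply: eq_bigr => p ps; case: eqP => [pm|/eqP nm].
  by rewrite Qid // -pm; apply: sw.
by rewrite (Q0 p.1) //; [apply: map_f|apply: sw].
Qed.

(** Stands in for the independence of weight spaces: a projection fixing v kills every summand whose
    weight is not mu. *)
Lemma weight_support mu v (s : seq (X * V)) : v != 0 -> wvec mu v ->
  (forall p, p \in s -> wvec p.1 p.2) -> v = \sum_(p <- s) p.2 ->
  exists2 p, p \in s & p.1 = mu.
Proof.
move=> v0 wv sw vE; have [Q [Qlin _ Qid Q0]] := weight_proj mu (map fst s).
have Q00 : Q 0 = 0 by have := Qlin (-1) 0 0; rewrite scaler0 addr0 scaleN1r addNr.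
have QD x y : Q (x + y) = Q x + Q y by rewrite -[x]scale1r Qlin !scale1r.
have [/hasP[p ps /eqP pm]|/hasPn sn] := boolP (has (fun p => p.1 == mu) s).
  by exists p.
case/eqP: v0; rewrite -(Qid _ wv) vE (big_morph Q QD Q00) big_seq big1 // => p ps.
by apply: (Q0 p.1); [apply: map_f|apply: sn|apply: sw].
Qed.

(** The summands themselves need not lie in [S]; the sums of all terms of one weight do, being
    projections of the whole sum. *)
Lemma weight_regroup (S : {pred V}) (s : seq (X * V)) :
  submod_closed S -> (forall t v, v \in S -> act t v \in S) ->
  (forall p, p \in s -> wvec p.1 p.2) -> \sum_(p <- s) p.2 \in S ->
  exists2 s' : seq (X * V), forall p, p \in s' -> wvec p.1 p.2 /\ p.2 \in S
    & \sum_(p <- s) p.2 = \sum_(p <- s') p.2.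
Proof.
move=> Ssub Sact sw sS.
exists [seq (mu, \sum_(p <- s | p.1 == mu) p.2) | mu <- undup (map fst s)].
  move=> _ /mapP[mu _ ->] /=; split; last exact: weight_component.
  rewrite big_seq_cond; apply: (big_ind (wvec mu)) => [|u v|p /andP[ps /eqP <-]].
  - exact: wvec0.
  - exact: wvecD.
  - exact: sw.
rewrite big_map /= (exchange_big_dep xpredT) //= big_seq [RHS]big_seq.
apply: eq_bigr => p ps; rewrite -big_filter.
suff -> : [seq mu <- undup (map fst s) | p.1 == mu] = [:: p.1] by rewrite big_seq1.
rewrite (eq_filter (a2 := pred1 p.1)) => [|mu]; last by rewrite /= eq_sym.
by rewrite filter_pred1_uniq ?undup_uniq // mem_undup map_f.
Qed.

End Weights.

Section WeightModules.
Variables (F : numFieldType) (L : lieAlgType F) (T : Type) (tor : T -> L).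
Variables (X : lmodType F) (ev : X -> T -> F).
Hypothesis evD : forall mu nu t, ev (mu + nu) t = ev mu t + ev nu t.
Hypothesis evZ : forall c mu t, ev (c *: mu) t = c * ev mu t.
Hypothesis ev_inj : forall mu nu, mu != nu -> exists t, ev mu t != ev nu t.
Variables (V : lmodType F) (rho : lieRep L V).

Local Notation wtL := (wvec (fun t => @lie F L (tor t)) ev).
Local Notation wtV := (wvec (fun t => rho (tor t)) ev).

Lemma wvec_act gam f mu u : wtL gam f -> wtV mu u -> wtV (mu + gam) (rho f u).
Proof.
move=> wf wu t; rewrite rep_swap wu wf repZr repZl -scalerDl.
by rewrite evD.
Qed.

Lemma wvec_iter gam f mu u n : wtL gam f -> wtV mu u ->
  wtV (mu + gam *+ n) (iter n (rho f) u).
Proof.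
move=> wf wu; elim: n => [|n ih]; first by rewrite mulr0n addr0.
by rewrite mulrSr addrA; apply: wvec_act.
Qed.

Definition weight_sum (P : X -> Prop) (u : V) :=
  exists2 s : seq (X * V), forall p, p \in s -> P p.1 /\ wtV p.1 p.2
    & u = \sum_(p <- s) p.2.

Lemma weight_sum_submod (P : X -> Prop) : submod_closed (fun u => `[< weight_sum P u >] : bool).
Proof.
apply: asbool_submod => [|c u v [s sP ->] [s' sP' ->]].
  by exists [::] => //; rewrite big_nil.
exists ([seq (p.1, c *: p.2) | p <- s] ++ s').
  move=> p; rewrite mem_cat => /orP[/mapP[q qs ->]|/sP'//] /=.
  by have [Pq wq] := sP q qs; split=> //; apply: wvecZ => // t c' x y; apply: rep_linr.
by rewrite big_cat /= big_map scaler_sumr.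
Qed.

Lemma Uspan_weight_sum (N : L -> Prop) (P : X -> Prop) lam v :
  wtV lam v -> P lam ->
  (forall f, N f -> exists gam, wtL gam f /\ forall mu, P mu -> P (mu + gam)) ->
  forall u, u \in Uspan rho N v -> weight_sum P u.
Proof.
move=> wv Pl Ngam u uU; apply/asboolP.
apply: (Uspan_min (weight_sum_submod P) _ _ uU).
  apply/asboolP; exists [:: (lam, v)]; last by rewrite big_seq1.
  by move=> p; rewrite inE => /eqP->.
move=> f w /Ngam[gam [wf PD]] /asboolP[s sP ->]; apply/asboolP.
exists [seq (p.1 + gam, rho f p.2) | p <- s].
  move=> _ /mapP[p ps ->] /=; have [Pp wp] := sP _ ps.
  by split; [apply: PD|apply: wvec_act].
by rewrite rep_sumr big_map.
Qed.

Lemma weight_sum_wvec P mu u : u != 0 -> wtV mu u -> weight_sum P u -> P mu.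
Proof.
move=> u0 wu [s sP uE].
have [||p ps <-] := weight_support _ ev_inj u0 wu _ uE.
- by move=> t c x y; apply: rep_linr.
- by move=> p /sP[].
by have [] := sP p ps.
Qed.

Variables (e f : L) (tc : T) (al : X).
Hypotheses (we : wtL al e) (wf : wtL (- al) f).
Hypotheses (ef : lie e f = tor tc) (altc : ev al tc = 2).
Hypothesis enil : forall u : V, exists n, iter n (rho e) u = 0.
Hypothesis fnil : forall u : V, exists n, iter n (rho f) u = 0.

Lemma evN mu t : ev (- mu) t = - ev mu t.
Proof. by rewrite -scaleN1r evZ mulN1r. Qed.

(** If p = mu(h) >= 0 take u' = f^p u, otherwise u' = e^(-p) u; both are nonzero by [sl2_inj], used
    for (e, f, h) and for (f, e, - h). *)
Lemma weight_reflect mu u : u != 0 -> wtV mu u ->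
  exists p : int, ev mu tc = p%:~R /\
    exists2 u', u' != 0 & wtV (mu - ev mu tc *: al) u'.
Proof.
move=> u0 wu; have he : lie (tor tc) e = 2 *: e by rewrite we altc.
have hf : lie (tor tc) f = -2 *: f by rewrite wf evN altc.
have [n eu] := enil u; have [m fu] := fnil u.
have [p pE] := sl2_weight_int ef he hf u0 (wu tc) eu fnil.
exists p; split=> //; rewrite pE; case: p pE => p.
  rewrite -pmulrn => pE; exists (iter p (rho f) u); last first.
    by have := wvec_iter p wf wu; rewrite mulNrn scaler_nat.
  by apply: contra_neq u0; apply: (sl2_inj ef he hf _ eu); rewrite wu pE.
rewrite NegzE mulrNz -pmulrn => pE; exists (iter p.+1 (rho e) u); last first.
  by have := wvec_iter p.+1 we wu; rewrite scaleNr opprK scaler_nat.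
have fe : lie f e = - tor tc by rewrite lieC ef.
have hf' : lie (- tor tc) f = 2 *: f by rewrite lieNl hf scaleNr opprK.
have he' : lie (- tor tc) e = -2 *: e by rewrite lieNl he scaleNr.
apply: contra_neq u0; apply: (sl2_inj fe hf' he' _ fu).
by rewrite repNl wu pE scaleNr opprK.
Qed.

End WeightModules.

(** Simplicity is stated for [{vspace g}], while the ideals below arise as predicates. A vector
    space of maximal dimension inside [S] cannot be enlarged by any element of [S]. *)
Lemma submod_vspace (F : fieldType) (V : vectType F) (S : {pred V}) :
  submod_closed S -> exists U : {vspace V}, forall x, (x \in U) = (x \in S).
Proof.
move=> Ssub.
pose P n := `[< exists2 U : {vspace V}, {subset U <= S} & \dim U = n >].
have exP : exists n, P n.
  exists 0%N; apply/asboolP; exists 0%VS; last exact: dimv0.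
  by move=> x; rewrite memv0 => /eqP ->; apply: submod0.
have ubP n : P n -> (n <= \dim (fullv : {vspace V}))%N.
  by move=> /asboolP[U _ <-]; rewrite dimvS ?subvf.
case: (ex_maxnP exP ubP) => n /asboolP[U US dU] maxn.
exists U => x; apply/idP/idP => [/US//|xS].
have UxS : {subset (U + <[x]>)%VS <= S}.
  move=> _ /memv_addP[u uU [_ /vlineP[k ->] ->]].
  by apply: submodD => //; [apply: US|apply: submodZ].
have dUx : (\dim (U + <[x]>) <= n)%N by apply: maxn; apply/asboolP; exists (U + <[x]>)%VS.
have /eqP -> : U == (U + <[x]>)%VS by rewrite -(dimv_leqif_eq (addvSl _ _)) eqn_leq dimvS ?addvSl // dU.
by rewrite memvE addvSr.
Qed.

(** * The root system of g *)

Section FiniteRoots.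
Variables (F : numFieldType) (g : fdLieAlgType F) (T : triangular g).
Local Notation H := (subvs_of (cartan T)).
Local Notation dual := 'Hom(H, F^o).
Local Notation S := (simple_roots T).
Local Notation alpha := (tnth (simple_roots T)).
Local Notation Qp := (in_Qplus (simple_roots T)).
Implicit Types (a b : dual) (c : H) (x z : g).

Definition dual_ev a (y : H) : F := a y.
Definition hact (y : H) (x : g) : g := lie (vsval y) x.

Lemma dual_evD a b y : dual_ev (a + b) y = dual_ev a y + dual_ev b y.
Proof. by rewrite /dual_ev add_lfunE. Qed.
Lemma dual_evZ k a y : dual_ev (k *: a) y = k * dual_ev a y.
Proof. by rewrite /dual_ev scale_lfunE. Qed.
Lemma dual_ev_inj a b : a != b -> exists y, dual_ev a y != dual_ev b y.
Proof.
move=> ab; apply: contrapT => h; case/eqP: ab; apply/lfunP => y.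
by apply/eqP/negPn/negP => hy; apply: h; exists y.
Qed.
Lemma hact_lin y k u v : hact y (k *: u + v) = k *: hact y u + hact y v.
Proof. exact: liexDZ. Qed.

Lemma root_space_lie a b x z :
  root_space a x -> root_space b z -> root_space (a + b) (lie x z).
Proof.
rewrite addrC => rx rz; exact: (wvec_act (rho := ad_rep g) (tor := vsval) (ev := dual_ev) dual_evD rx rz).
Qed.

Lemma root_spaceZ a k x : root_space a x -> root_space a (k *: x).
Proof. exact: (wvecZ hact_lin (ev := dual_ev)). Qed.
Lemma root_spaceD a x z : root_space a x -> root_space a z -> root_space a (x + z).
Proof. exact: (wvecD hact_lin (ev := dual_ev)). Qed.
Lemma root_space0P x : root_space (0 : dual) x <-> x \in cartan T.
Proof.
have [hh hc _] := cartanP T; split=> [rx|xh y].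
  apply: hc => y yh; rewrite -[y](vsprojK yh) rx.
  by rewrite zero_lfunE scale0r.
by rewrite hh ?subvsP // zero_lfunE scale0r.
Qed.

(** Diagonalizability is given for one element at a time. If z is a joint eigenvector for l, its
    joint eigenspace is stable under ad y0, which commutes with l; so the eigencomponents of z for
    ad y0 stay in that eigenspace. *)
Lemma simult_diag (l : seq g) : {subset l <= cartan T} -> forall x,
  exists2 s : seq g, forall z, z \in s -> forall y, y \in l -> exists k : F, lie y z = k *: z
    & x = \sum_(z <- s) z.
Proof.
have [hh _ hd] := cartanP T.
elim: l => [|y0 l ih] lh x; first by exists [:: x]; rewrite ?big_seq1.
have lh' : {subset l <= cartan T} by move=> y yl; apply: lh; rewrite inE yl orbT.
have y0h : y0 \in cartan T by apply: lh; rewrite mem_head.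
have step z : (forall y, y \in l -> exists k : F, lie y z = k *: z) ->
  exists2 s : seq g, forall w, w \in s -> forall y, y \in y0 :: l -> exists k : F, lie y w = k *: w
    & z = \sum_(w <- s) w.
  move=> zl.
  have /choice[kf kfE] : forall y, exists k : F, y \in l -> lie y z = k *: z.
    by move=> y; have [/zl[k E]|] := boolP (y \in l); [exists k|exists 0].
  pose W (w : g) := forall y, y \in l -> lie y w = kf y *: w.
  have Wsub : submod_closed (fun w => `[< W w >] : bool).
    apply: asbool_submod => [y _|k u v Wu Wv y yl]; first by rewrite lie0r scaler0.
    by rewrite liexDZ (Wu y yl) (Wv y yl) scalerDr !scalerA mulrC.
  pose act (_ : unit) (w : g) := lie y0 w.
  pose ev (k : F) (_ : unit) := k.
  have act_lin t k u v : act t (k *: u + v) = k *: act t u + act t v by apply: liexDZ.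
  have ev_inj (k k' : F) : k != k' -> exists t, ev k t != ev k' t by exists tt.
  have Wact t w : w \in (fun w => `[< W w >] : bool) ->
      act t w \in (fun w => `[< W w >] : bool).
    move=> /asboolP Ww; apply/asboolP => y yl.
    have := ad_lie y y0 w; rewrite (hh y y0 (lh' y yl) y0h) (lie0l w) => /esym/eqP.
    by rewrite subr_eq0 (Ww y yl) lieZr => /eqP.
  have [e eb /choice[lam lamE]] : exists2 e : seq g, basis_of fullv e
      & forall w, exists k : F, w \in e -> lie y0 w = k *: w.
    have [e eb ee] := hd _ y0h; exists e => // w.
    by have [/ee[k E]|] := boolP (w \in e); [exists k|exists 0].
  pose s0 := [seq (lam e`_(val i), coord (in_tuple e) i z *: e`_(val i)) | i : 'I_(size e) <- enum 'I_(size e)].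
  have zE : z = \sum_(p <- s0) p.2.
    rewrite big_map big_enum /=; apply: (coord_basis (X := in_tuple e) eb).
    exact: memvf.
  have s0w p : p \in s0 -> wvec act ev p.1 p.2.
    by move=> /mapP[i _ ->] t /=; rewrite /act lieZr lamE ?mem_nth // !scalerA mulrC.
  have [|s' s'P sE] := weight_regroup act_lin ev_inj Wsub Wact s0w.
    by rewrite -zE; apply/asboolP => y yl; apply: kfE.
  exists (map snd s'); last by rewrite big_map -sE.
  move=> _ /mapP[p ps ->] y; have [wp /asboolP Wp] := s'P p ps.
  rewrite inE => /orP[/eqP->|yl]; first by exists p.1; apply: (wp tt).
  by exists (kf y); apply: Wp.
have [s sl ->] := ih lh' x.
elim: s sl => [|z s ihs] sl; first by exists [::].
have [|s1 s1P ->] := step z; first by apply: sl; rewrite mem_head.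
rewrite big_cons; have [|s2 s2P ->] := ihs; first by move=> w ws; apply: sl; rewrite inE ws orbT.
exists (s1 ++ s2); last by rewrite big_cat.
by move=> w; rewrite mem_cat => /orP[/s1P|/s2P].
Qed.

Lemma root_decomp x : exists2 s : seq (dual * g),
  forall p, p \in s -> root_space p.1 p.2 & x = \sum_(p <- s) p.2.
Proof.
have [|s sP ->] := @simult_diag (vbasis (cartan T)) _ x.
  by move=> y; apply: vbasis_mem.
elim: s sP => [|z s ih] sP; first by exists [::] => //; rewrite !big_nil.
rewrite big_cons; have [|s' s'P ->] := ih; first by move=> w ws; apply: sP; rewrite inE ws orbT.
have zP := sP z (mem_head _ _).
have /choice[k kE] : forall i : 'I_(\dim (cartan T)), exists k : F,
    lie (vbasis (cartan T))`_i z = k *: z.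
  by move=> i; apply: zP; rewrite mem_nth // size_tuple.
(* The eigenvalues on a basis of the Cartan subalgebra, extended linearly to a functional. *)
pose f (y : H) : F^o := \sum_i coord (vbasis (cartan T)) i (vsval y) * k i.
have fL : linear f.
  move=> c u v; rewrite /f scaler_sumr -big_split; apply: eq_bigr => i _.
  by rewrite linearP /= mulrDl -mulrA.
pose fl := HB.pack_for {linear H -> F^o} f (GRing.isLinear.Build F H F^o _ f fL).
exists ((linfun f, z) :: s'); last by rewrite big_cons.
move=> p; rewrite inE => /orP[/eqP->|/s'P//] y /=; rewrite (lfunE fl) /= /f.
rewrite [X in lie X _](coord_vbasis (subvsP y)) lie_suml scaler_suml.
by apply: eq_bigr => i _; rewrite lieZl kE scalerA.
Qed.

(** Split each vector of a basis of g into root vectors. Any x is a combination of these, so by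
    [weight_support] its weight is among theirs. *)
Lemma finite_weights : exists l : seq dual,
  forall b x, x != 0 -> root_space b x -> b \in l.
Proof.
have /choice[s sP] : forall x, exists s : seq (dual * g),
    (forall p, p \in s -> root_space p.1 p.2) /\ x = \sum_(p <- s) p.2.
  by move=> x; have [s] := root_decomp x; exists s.
exists (flatten [seq map fst (s (vbasis fullv)`_i) | i : 'I_(\dim (fullv : {vspace g})) <- enum 'I_(\dim (fullv : {vspace g}))]).
move=> b x x0 bx.
pose t := flatten [seq [seq (p.1, coord (vbasis fullv) i x *: p.2) | p <- s (vbasis fullv)`_i]
   | i : 'I_(\dim (fullv : {vspace g})) <- enum 'I_(\dim (fullv : {vspace g}))].
have tw p : p \in t -> root_space p.1 p.2.
  move=> /flatten_mapP[i _ /mapP[q qs ->]] /=; apply: root_spaceZ.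
  by have [+ _] := sP (vbasis fullv)`_i; apply.
have xE : x = \sum_(p <- t) p.2.
  rewrite big_flatten big_map big_enum /= {1}(coord_vbasis (memvf x)).
  apply: eq_bigr => i _; rewrite big_map -scaler_sumr; congr (_ *: _).
  by have [] := sP (vbasis fullv)`_i.
have [p /flatten_mapP[i ie /mapP[q qs ->]] /= <-] :=
  weight_support hact_lin dual_ev_inj x0 bx tw xE.
by apply/flatten_mapP; exists i => //; apply: map_f.
Qed.

Lemma finite_roots : exists2 rs : seq dual, uniq rs & forall b, b \in rs <-> is_root b.
Proof.
have [l lP] := finite_weights; exists (undup (filter (fun b => `[< is_root b >]) l)).
  exact: undup_uniq.
move=> b; rewrite mem_undup mem_filter; split=> [/andP[/asboolP//]|rb].
apply/andP; split; first exact/asboolP.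
by have [_ [x x0 bx]] := rb; apply: lP bx.
Qed.

(** The weights b + n a are pairwise distinct in characteristic 0, so only finitely many of them can
    occur. *)
Lemma root_vector_nilpotent a x : a != 0 -> root_space a x ->
  forall z, exists n, iter n (lie x) z = 0.
Proof.
move=> a0 ax; have [l lP] := finite_weights.
have nil b z : root_space b z -> iter (size l) (lie x) z = 0.
  move=> bz; apply: contrapT => /eqP nz.
  have wz n : root_space (b + a *+ n) (iter n (lie x) z).
    exact: (wvec_iter (rho := ad_rep g) (tor := vsval) (ev := dual_ev) dual_evD n ax bz).
  have nzn n : (n <= size l)%N -> iter n (lie x) z != 0.
    by move=> nl; apply: contra_neq nz; apply: (iter_rep0_le (rho := ad_rep g) nl).
  have u : uniq [seq b + a *+ n | n <- iota 0 (size l).+1].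
    rewrite map_inj_uniq ?iota_uniq // => n m /addrI /eqP.
    rewrite -subr_eq0 -!scaler_nat -scalerBl scaler_eq0 (negPf a0) orbF.
    by rewrite subr_eq0 eqr_nat => /eqP.
  have := @uniq_leq_size _ _ l u; rewrite size_map size_iota ltnn => h.
  suff : false by []. apply: h => _ /mapP[n + ->]; rewrite mem_iota ltnS /= => nl.
  by apply: lP (wz n); apply: nzn.
move=> z; exists (size l); have [s sP ->] := root_decomp z.
elim: s sP => [|p s ih] sP; first by rewrite big_nil (iter_rep0 (ad_rep g)).
rewrite big_cons (iter_repD (ad_rep g)) (nil p.1) ?add0r; last exact/sP/mem_head.
by apply: ih => q qs; apply: sP; rewrite inE qs orbT.
Qed.

End FiniteRoots.

(** * Positive cone, heights and the highest root *)

Section HighestRoot.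
Variables (F : numFieldType) (g : fdLieAlgType F) (T : triangular g).
Local Notation H := (subvs_of (cartan T)).
Local Notation dual := 'Hom(H, F^o).
Local Notation S := (simple_roots T).
Local Notation alpha := (tnth (simple_roots T)).
Local Notation Qp := (in_Qplus (simple_roots T)).
Implicit Types (a b : dual) (c : H) (x z : g).

Definition cf i b : F := coord (simple_roots T) i b.

Lemma cf_sum (k : 'I_(rank T) -> F) i : cf i (\sum_j k j *: alpha j) = k i.
Proof.
have [_ fS _] := simple_rootsP T.
rewrite -(coord_sum_free k i fS) /cf; congr (coord _ _ _).
by apply: eq_bigr => j _; rewrite (tnth_nth 0).
Qed.

Lemma cfD i a b : cf i (a + b) = cf i a + cf i b. Proof. exact: linearD. Qed.
Lemma cfN i a : cf i (- a) = - cf i a. Proof. exact: linearN. Qed.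
Lemma cfZ i k a : cf i (k *: a) = k * cf i a. Proof. exact: linearZ. Qed.

Lemma cf_simple i j : cf i (alpha j) = (i == j)%:R.
Proof.
rewrite -(cf_sum (fun i => (i == j)%:R) i); congr (cf i _).
rewrite (bigD1 j) //= eqxx scale1r big1 ?addr0 // => k /negPf ->.
by rewrite scale0r.
Qed.

Lemma QpE b : Qp b -> b = \sum_i cf i b *: alpha i.
Proof.
move=> [n ->]; apply: eq_bigr => i _.
rewrite -scaler_nat; congr (_ *: _).
rewrite -(cf_sum (fun i => (n i)%:R) i); congr (cf i _).
by apply: eq_bigr => j _; rewrite scaler_nat.
Qed.

Lemma Qp_cf b i : Qp b -> exists n : nat, cf i b = n%:R.
Proof.
move=> [n ->]; exists (n i); rewrite -(cf_sum (fun i => (n i)%:R) i).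
by congr (cf i _); apply: eq_bigr => j _; rewrite scaler_nat.
Qed.

Lemma Qp_cf_ge0 b i : Qp b -> 0 <= cf i b.
Proof. by move=> /(Qp_cf i)[n ->]. Qed.

Lemma Qp0 : Qp 0.
Proof. by exists (fun=> 0%N); rewrite big1. Qed.
Lemma QpD a b : Qp a -> Qp b -> Qp (a + b).
Proof.
move=> [n ->] [m ->]; exists (fun i => n i + m i)%N; rewrite -big_split.
by apply: eq_bigr => i _; rewrite mulrnDr.
Qed.
Lemma QpMn a n : Qp a -> Qp (a *+ n).
Proof. by move=> Qa; elim: n => [|n ih]; [exact: Qp0|rewrite mulrS; apply: QpD]. Qed.
Lemma Qp_simple i : Qp (alpha i).
Proof.
exists (fun j => (j == i)%N); rewrite (bigD1 i) //= eqxx big1 ?addr0 // => j /negPf ->.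
by [].
Qed.

Lemma Qp_anti b : Qp b -> Qp (- b) -> b = 0.
Proof.
move=> Qb Qn; rewrite (QpE Qb) big1 // => i _.
have := Qp_cf_ge0 i Qn; rewrite cfN oppr_ge0 => le0.
by have -> : cf i b = 0; [apply/eqP; rewrite eq_le le0 Qp_cf_ge0|rewrite scale0r].
Qed.

Definition height b : F := \sum_i cf i b.

Lemma heightD a b : height (a + b) = height a + height b.
Proof. by rewrite /height -big_split; apply: eq_bigr => i _; rewrite cfD. Qed.
Lemma heightN a : height (- a) = - height a.
Proof. by rewrite /height -sumrN; apply: eq_bigr => i _; rewrite cfN. Qed.
Lemma heightZ k a : height (k *: a) = k * height a.
Proof. by rewrite /height mulr_sumr; apply: eq_bigr => i _; rewrite cfZ. Qed.
Lemma height_simple i : height (alpha i) = 1.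
Proof.
rewrite /height (bigD1 i) //= cf_simple eqxx big1 ?addr0 // => j /negPf ji.
by rewrite cf_simple ji.
Qed.

Lemma Qp_height b : Qp b -> exists n : nat, height b = n%:R.
Proof.
move=> Qb; have /choice[n nE] : forall i, exists n : nat, cf i b = n%:R.
  by move=> i; apply: Qp_cf.
by exists (\sum_i n i)%N; rewrite natr_sum; apply: eq_bigr.
Qed.

Lemma Qp_height_gt0 b : Qp b -> b != 0 -> 0 < height b.
Proof.
move=> Qb b0; rewrite lt_def sumr_ge0 ?andbT; last by move=> i _; apply: Qp_cf_ge0.
apply: contra_neq b0 => /eqP; rewrite psumr_eq0; last by move=> i _; apply: Qp_cf_ge0.
move=> /allP h; rewrite (QpE Qb) big1 // => i _.
by have /eqP -> := h i (mem_index_enum i); rewrite scale0r.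
Qed.

Definition negvec (f : g) := exists b, [/\ is_root b, Qp (- b) & root_space b f].

Lemma nplusD x z : nplus T x -> nplus T z -> nplus T (x + z).
Proof.
move=> [s sP ->] [t tP ->]; exists (s ++ t); last by rewrite big_cat.
by move=> w; rewrite mem_cat => /orP[/sP|/tP].
Qed.
Lemma nplus0 : nplus T 0. Proof. by exists [::] => //; rewrite big_nil. Qed.
Lemma nplus_root b x : is_root b -> Qp b -> root_space b x -> nplus T x.
Proof.
move=> rb Qb bx; exists [:: x]; last by rewrite big_seq1.
by move=> w; rewrite inE => /eqP->; exists b.
Qed.
Lemma borelD x z : borel T x -> borel T z -> borel T (x + z).
Proof.
move=> [y [n [nn ->]]] [y' [n' [nn' ->]]]; exists (y + y'), (n + n').
by rewrite addrACA; split=> //; apply: nplusD.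
Qed.
Lemma borel_nplus x : nplus T x -> borel T x.
Proof. by move=> nx; exists 0, x; rewrite add0r. Qed.
Lemma borel_cartan c : borel T (vsval c).
Proof. by exists c, 0; rewrite addr0; split=> //; apply: nplus0. Qed.

Lemma tri_decomp x : exists (s : seq g) p,
  [/\ forall f, f \in s -> negvec f, borel T p & x = \sum_(f <- s) f + p].
Proof.
have [s sP ->] := root_decomp T x; elim: s sP => [|[b z] s ih] sP.
  exists [::], 0; rewrite !big_nil addr0; split=> //; exact: borel_nplus nplus0.
rewrite big_cons; have [|t [p [tP bp ->]]] := ih.
  by move=> q qs; apply: sP; rewrite inE qs orbT.
have bz := sP _ (mem_head _ _); rewrite /= in bz *.
case: (eqVneq z 0) => [->|z0]; first by exists t, p; rewrite add0r.
case: (eqVneq b 0) => [b0|b0].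
  move: bz; rewrite b0 => /root_space0P zh; exists t, (z + p); split=> //.
    by apply: borelD => //; rewrite -(vsprojK zh); apply: borel_cartan.
  by rewrite addrCA.
have rb : is_root b by split=> //; exists z.
have [_ _ /(_ b rb)[Qb|Qb]] := simple_rootsP T.
  exists t, (z + p); split=> //; last by rewrite addrCA.
  by apply: borelD => //; apply: borel_nplus; apply: nplus_root bz.
exists (z :: t), p; split=> //; last by rewrite big_cons addrA.
by move=> f; rewrite inE => /orP[/eqP->|/tP//]; exists b.
Qed.

Hypothesis simp : simple_lie g.

Lemma simple_root_exists : exists b, is_root b.
Proof.
have [[x [z xz]] _] := simp; apply: contrapT => h.
have [hh _ _] := cartanP T.
have all_h w : w \in cartan T.
  have [s sP ->] := root_decomp T w; rewrite big_seq; apply: memv_suml => p ps.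
  have bp := sP p ps; case: (eqVneq p.2 0) => [->|p0]; first exact: mem0v.
  case: (eqVneq p.1 0) => [p1|p1]; first by apply/root_space0P; rewrite -p1.
  by case: h; exists p.1; split=> //; exists p.2.
by case/eqP: xz; apply: hh.
Qed.

Lemma simple_ideal (J : {pred g}) : submod_closed J ->
  (forall x z, z \in J -> lie x z \in J) -> (exists2 x, x \in J & x != 0) ->
  forall x, x \in J.
Proof.
move=> Jsub Jid [x xJ x0] z; have [U UJ] := submod_vspace Jsub.
have [_ /(_ U)[|U0|UT]] := simp.
- by move=> u v; rewrite !UJ; apply: Jid.
- by move: xJ; rewrite -UJ U0 memv0 (negPf x0).
by rewrite -UJ UT memvf.
Qed.

Lemma max_pos_root : exists2 a, is_root a /\ Qp a &
  forall b, is_root b -> Qp b -> ~ (height a < height b).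
Proof.
have [rs _ rsP] := finite_roots T.
have [a0 ra0 Qa0] : exists2 a, is_root a & Qp a.
  have [b rb] := simple_root_exists; have [rS _ /(_ b rb) Qb] := simple_rootsP T.
  have [i _|no] := pickP (fun i : 'I_(rank T) => true).
    by exists (alpha i); [apply: rS|apply: Qp_simple].
  have [/eqP[]] := rb; have noS n : \sum_i alpha i *+ n i = 0.
    by rewrite big1 // => i; have := no i.
  by case: Qb => -[n]; rewrite noS // => /eqP; rewrite oppr_eq0 => /eqP.
have /choice[nh nhE] : forall b, exists n : nat, Qp b -> height b = n%:R.
  move=> b; have [Qb|nQ] := pselect (Qp b); last by exists 0%N.
  by have [n] := Qp_height Qb; exists n.
pose P n := `[< exists b, [/\ is_root b, Qp b & nh b = n] >].
have exP : exists n, P n by exists (nh a0); apply/asboolP; exists a0.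
have ubP n : P n -> (n <= \max_(b <- rs) nh b)%N.
  by move=> /asboolP[b [/rsP brs _ <-]]; apply: leq_bigmax_seq.
case: (ex_maxnP exP ubP) => n /asboolP[a [ra Qa <-]] maxn.
exists a => // b rb Qb; rewrite !nhE // ltr_nat ltnNge => /negP; apply; apply: maxn.
by apply/asboolP; exists b.
Qed.

(** A root vector x for a positive root a of maximal height is killed by n^+. By simplicity g =
    U(n^-) x, so every root is a minus a sum of positive roots. *)
Lemma highest_root_exists : exists a, is_root a /\ forall b, is_root b -> Qp (a - b).
Proof.
have [a [[a0 [x x0 ax]] Qa] amax] := max_pos_root.
exists a; split=> [|b [b0 [z z0 bz]]]; first by split=> //; exists x.
have px p : borel T p -> lie p x \in Uspan (ad_rep g) negvec x.
  move=> [y [n [[s sP ->] ->]]]; rewrite lieDl ax lie_suml.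
  apply: (submodZD (Uspan_closed _ _ _)); first exact: Uspan_refl.
  apply: (submod_sum (Uspan_closed _ _ _)) => w ws _.
  have [b' [rb' Qb' bw]] := sP w ws; suff -> : lie w x = 0.
    exact: submod0 (Uspan_closed _ _ _).
  apply: contrapT => /eqP wx0; have abw := root_space_lie bw ax.
  have Qab : Qp (b' + a) by apply: QpD.
  have [b'0 _] := rb'; apply: (amax (b' + a)) => //.
    split; last by exists (lie w x).
    apply: contra_neq b'0 => /eqP; rewrite addr_eq0 => /eqP b'E.
    by apply: Qp_anti => //; rewrite b'E opprK.
  by rewrite heightD ltrDr; apply: Qp_height_gt0.
have all_U w : w \in Uspan (ad_rep g) negvec x.
  apply: simple_ideal; [exact: Uspan_closed| |by exists x => //; apply: Uspan_refl].
  move=> u v vU; apply: (@Uspan_triangular _ _ _ (ad_rep g) (fun=> True) negvec (borel T)) => //.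
  by move=> w' _; apply: tri_decomp.
have := @Uspan_weight_sum _ _ _ vsval _ (@dual_ev _ _ T) (@dual_evD _ _ T) _ (ad_rep g)
  negvec (fun mu => Qp (a - mu)) a x ax.
rewrite subrr => /(_ Qp0) h.
apply: (@weight_sum_wvec _ _ _ vsval _ (@dual_ev _ _ T) (@dual_ev_inj _ _ T) _ (ad_rep g)
  (fun mu => Qp (a - mu)) b z z0 bz).
apply: h => // f [c [rc Qc cf]]; exists c; split=> // mu Qmu.
by rewrite opprD addrA; apply: QpD.
Qed.

Lemma highest_rootP : is_root (highest_root T) /\
  forall b, is_root b -> Qp (highest_root T - b).
Proof.
rewrite /highest_root; have [a aP] := highest_root_exists.
by case: xgetP => [b _ //|/(_ a)].
Qed.

End HighestRoot.

Section InvariantForm.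
Variables (F : fieldType) (g : lieAlgType F) (B : inv_form g).
Implicit Types x y z : g.

Lemma formDl x y z : B (x + y) z = B x z + B y z.
Proof. by rewrite -[x]scale1r formDZl mul1r scale1r. Qed.
Lemma form0l z : B 0 z = 0.
Proof. by apply: (addIr (B 0 z)); rewrite -formDl !add0r. Qed.
Lemma formZl k x z : B (k *: x) z = k * B x z.
Proof. by rewrite -[k *: x]addr0 formDZl form0l addr0. Qed.
Lemma formDr x y z : B z (x + y) = B z x + B z y.
Proof. by rewrite !(Defs.formC B z) formDl. Qed.
Lemma form0r z : B z 0 = 0. Proof. by rewrite Defs.formC form0l. Qed.
Lemma formZr k x z : B z (k *: x) = k * B z x.
Proof. by rewrite !(Defs.formC B z) formZl. Qed.
Lemma formBl x y z : B (x - y) z = B x z - B y z.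
Proof. by rewrite formDl -scaleN1r formZl mulN1r. Qed.
Lemma form_sumr I (s : seq I) (f : I -> g) z :
  B z (\sum_(i <- s) f i) = \sum_(i <- s) B z (f i).
Proof. by elim/big_rec2: _ => [|i a b _ <-]; rewrite ?form0r ?formDr. Qed.
End InvariantForm.

(** * Nondegeneracy of the form, coroots and reflections *)

Section Coroots.
Variables (F : numFieldType) (g : fdLieAlgType F) (T : triangular g) (B : inv_form g).
Local Notation H := (subvs_of (cartan T)).
Local Notation dual := 'Hom(H, F^o).
Local Notation alpha := (tnth (simple_roots T)).
Local Notation Qp := (in_Qplus (simple_roots T)).
Local Notation nuB := (nu (T := T) B).
Implicit Types (a b : dual) (c t : H) (x y z : g).

Hypothesis simp : simple_lie g.
Hypothesis norm : normalized T B.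

(** The radical is an ideal. Were it nonzero, it would be g, so [nu] would vanish and [normalized]
    would make the highest root 0. *)
Lemma form_nondeg x : (forall z, B x z = 0) -> x = 0.
Proof.
move=> Bx; apply: contrapT => /eqP x0.
pose J (u : g) := forall z, B u z = 0.
have Jsub : submod_closed (fun u => `[< J u >] : bool).
  apply: asbool_submod => [z|k u v Ju Jv z]; first exact: form0l.
  by rewrite formDZl Ju Jv mulr0 addr0.
have [[T0 _] _] := highest_rootP T simp; case/eqP: T0; rewrite -norm.
apply/lfunP => y; rewrite nuE zero_lfunE.
have /asboolP -> // :
  vsval (coroot (highest_root T)) \in (fun u => `[< J u >] : bool).
apply: (simple_ideal simp Jsub); last by exists x => //; apply/asboolP.
move=> u v /asboolP Jv; apply/asboolP => z.
by rewrite lieC -scaleN1r formZl form_inv Jv mulr0.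
Qed.

Lemma form_orth a b x z : root_space a x -> root_space b z -> a + b != 0 -> B x z = 0.
Proof.
move=> ax bz.
have H0 (y : H) : (a + b) y * B x z = 0.
  rewrite add_lfunE mulrDl -formZl -formZr -ax -bz.
  by rewrite lieC -scaleN1r formZl mulN1r form_inv addNr.
move=> ab; have [y] := dual_ev_inj ab.
rewrite /dual_ev zero_lfunE => y0; have /eqP := H0 y.
by rewrite mulf_eq0 (negPf y0) /= => /eqP.
Qed.

Lemma form_pair a x : root_space a x -> x != 0 ->
  exists2 y, root_space (- a) y & B x y != 0.
Proof.
move=> ax x0; apply: contrapT => h; case/eqP: x0; apply: form_nondeg => z.
have [s sP ->] := root_decomp T z; rewrite form_sumr big_seq big1 // => p ps.
have bp := sP p ps; case: (eqVneq (a + p.1) 0) => [ap|ap]; last exact: form_orth ax bp ap.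
apply/eqP/negPn/negP => Bp; apply: h; exists p.2 => //.
by rewrite -(_ : p.1 = - a) //; apply/eqP; rewrite -addr_eq0 addrC ap.
Qed.

(** An element of the Cartan subalgebra is orthogonal to every root space, so nondegeneracy on g
    restricts to it. *)
Lemma nu_inj : injective nuB.
Proof.
move=> c c' e; apply/eqP; rewrite -subr_eq0; apply/eqP.
apply: (can_inj vsvalK); rewrite [RHS]linear0; apply: form_nondeg => z.
have rc : root_space (0 : dual) (vsval (c - c')) by apply/root_space0P/subvsP.
have [s sP ->] := root_decomp T z; rewrite form_sumr big_seq big1 // => p ps.
have bp := sP p ps; case: (eqVneq p.1 0) => [p0|p0]; last first.
  by apply: form_orth rc bp _; rewrite add0r.
have /root_space0P ph : root_space (0 : dual) p.2 by rewrite -p0.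
by rewrite -(vsprojK ph) linearB /= formBl -!nuE e subrr.
Qed.

Lemma nuD c c' : nuB (c + c') = nuB c + nuB c'.
Proof. by apply/lfunP => y; rewrite add_lfunE !nuE linearD formDl. Qed.
Lemma nuZ k c : nuB (k *: c) = k *: nuB c.
Proof. by apply/lfunP => y; rewrite scale_lfunE !nuE linearZ formZl. Qed.
Lemma nuN c : nuB (- c) = - nuB c.
Proof. by rewrite -scaleN1r nuZ scaleN1r. Qed.
Lemma nu_sym c c' : nuB c c' = nuB c' c.
Proof. by rewrite !nuE Defs.formC. Qed.

Lemma lie_opp_roots a t x y : nuB t = a -> root_space a x -> root_space (- a) y ->
  lie x y = B x y *: vsval t.
Proof.
move=> ta ax ay; apply/eqP; rewrite -subr_eq0; apply/eqP.
have rxy : lie x y \in cartan T.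
  by apply/root_space0P; rewrite -(subrr a); apply: root_space_lie.
have -> : lie x y - B x y *: vsval t = vsval (vsproj (cartan T) (lie x y) - B x y *: t).
  by rewrite linearB linearZ /= vsprojK.
suff -> : vsproj (cartan T) (lie x y) - B x y *: t = 0 by rewrite linear0.
apply: nu_inj; apply/lfunP => h; rewrite !nuE linearB linearZ /= vsprojK //.
rewrite form0l formDl formZl -[- vsval t]scaleN1r formZl -nuE ta form_inv.
by rewrite (lieC y) ay -scaleN1r !formZr opp_lfunE; ring.
Qed.

Lemma root_dual a : is_root a -> exists2 t, nuB t = a & exists x y,
  [/\ root_space a x, root_space (- a) y, x != 0 & lie x y = vsval t].
Proof.
move=> [a0 [x x0 ax]]; have [y ay Bxy] := form_pair ax x0.
have rxy : lie x y \in cartan T.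
  by apply/root_space0P; rewrite -(subrr a); apply: root_space_lie.
have ta : nuB (vsproj (cartan T) (lie x ((B x y)^-1 *: y))) = a.
  apply/lfunP => h; rewrite nuE lieZr vsprojK; last by rewrite memvZ.
  rewrite formZl form_inv lieC ay -scaleN1r scalerA formZr opp_lfunE mulN1r opprK.
  by rewrite mulrCA mulVf ?mulr1.
exists (vsproj (cartan T) (lie x ((B x y)^-1 *: y))) => //.
exists x, ((B x y)^-1 *: y); split=> //; first exact: root_spaceZ.
by rewrite vsprojK // lieZr memvZ.
Qed.

(* If a(t) = 0 then x, y, t span a Heisenberg algebra; x and y being nilpotent,
   t must act by 0. *)
Lemma root_norm_neq0 a t : is_root a -> nuB t = a -> a t != 0.
Proof.
move=> ra ta; apply/negP => /eqP at0.
have [t' ta' [x [y [ax ay x0 xy]]]] := root_dual ra.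
have tt : t' = t by apply: nu_inj; rewrite ta ta'.
rewrite {t' ta'}tt in xy; have [a0 _] := ra.
have xnil := root_vector_nilpotent a0 ax.
have ynil : forall z, exists n, iter n (lie y) z = 0.
  by apply: (root_vector_nilpotent (a := - a)) => //; rewrite oppr_eq0.
have tx : lie (vsval t) x = 0 by rewrite ax at0 scale0r.
have ty : lie (vsval t) y = 0 by rewrite ay opp_lfunE at0 oppr0 scale0r.
(* For u the last nonzero x^n z one finds x y^(k+1) u = (k + 1) b(t) y^k u; since some y^m u is 0
   and u is not, b(t) = 0. *)
have wt0 b z : root_space b z -> z != 0 -> b t = 0.
  move=> bz z0; have [n0 xn] := xnil z.
  have ex : exists n, iter n (lie x) z == 0 by exists n0; rewrite xn.
  case: (ex_minnP ex) => -[/= zz|n]; first by rewrite zz in z0.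
  set u := iter n (lie x) z => /eqP xu minn.
  have u0 : u != 0 by apply/negP => /minn; rewrite ltnn.
  have xu0 : lie x u = 0 by [].
  have tu : lie (vsval t) u = b t *: u.
    rewrite /u; elim: (n) => [|k ih]; first exact: bz.
    rewrite iterS; have := ad_lie (vsval t) x (iter k (lie x) z).
    rewrite tx lie0l ih lieZr => /esym/eqP.
    by rewrite subr_eq0 => /eqP.
  have tyu k : lie (vsval t) (iter k (lie y) u) = b t *: iter k (lie y) u.
    elim: k => [|k ih]; first exact: tu.
    rewrite iterS; have := ad_lie (vsval t) y (iter k (lie y) u).
    rewrite ty lie0l ih lieZr => /esym/eqP.
    by rewrite subr_eq0 => /eqP.
  have xyu k : lie x (iter k.+1 (lie y) u) = (k.+1%:R * b t) *: iter k (lie y) u.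
    elim: k => [|k ih].
      by rewrite /= lie_swap xu0 lie0r add0r xy tu mul1r.
    rewrite iterS lie_swap ih xy tyu lieZr -scalerDl -iterS.
    by rewrite -[k.+2%:R]natr1 mulrDl mul1r.
  have [m ym] := ynil u; elim: m ym => [/= /eqP|m ih ym]; first by rewrite (negPf u0).
  have /eqP := xyu m; rewrite ym lie0r eq_sym scaler_eq0 mulf_eq0 pnatr_eq0 /=.
  by case/orP => [/eqP|/eqP].
have tcent z : lie (vsval t) z = 0.
  have [s sP ->] := root_decomp T z; rewrite lie_sumr big_seq big1 // => p ps.
  have bp := sP p ps; case: (eqVneq p.2 0) => [->|p0]; first by rewrite lie0r.
  by rewrite bp (wt0 _ _ bp p0) scale0r.
(* Thus t is central. The centre is an ideal, and if it were nonzero g would be abelian. *)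
pose J (u : g) := forall z, lie u z = 0.
have Jsub : submod_closed (fun u => `[< J u >] : bool).
  apply: asbool_submod => [z|k u v Ju Jv z]; first exact: lie0l.
  by rewrite lieDZl Ju Jv scaler0 addr0.
have [[u [v uv]] _] := simp; case/eqP: uv.
have /asboolP -> // : u \in (fun u => `[< J u >] : bool).
apply: (simple_ideal simp Jsub).
  move=> w z /asboolP Jz; apply/asboolP => z'.
  by rewrite (lieC w) Jz oppr0 lie0l.
exists (vsval t); first exact/asboolP.
apply: contra_neq a0 => t0; rewrite -ta; apply/lfunP => h.
by rewrite nuE t0 form0l zero_lfunE.
Qed.

(** [coroot] is a choice made by [xget]. Every candidate in [g_a, g_-a] is a multiple of the element
    t with nu(t) = a, and (2 / a(t)) t is a candidate because a(t) <> 0. *)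
Lemma corootP a : is_root a -> a (coroot a) = 2 /\
  exists2 k : F, k != 0 & nuB (coroot a) = k *: a.
Proof.
move=> ra; have [t ta [x [y [ax ay x0 xy]]]] := root_dual ra.
have at0 := root_norm_neq0 ra ta.
have Ucor c : is_coroot a c -> a c = 2 /\ exists2 k : F, k != 0 & nuB c = k *: a.
  move=> [ac [s sP cE]]; split=> //.
  have cE' : c = (\sum_(p <- s) B p.1 p.2) *: t.
    apply: (can_inj vsvalK); rewrite linearZ /= cE scaler_suml big_seq [RHS]big_seq.
    apply: eq_bigr => p ps; have [ap1 ap2] := sP p ps.
    exact: (lie_opp_roots ta ap1 ap2).
  exists (\sum_(p <- s) B p.1 p.2); last by rewrite cE' nuZ ta.
  apply/negP => /eqP s0; move: ac; rewrite cE' s0 scale0r linear0 => /esym/eqP.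
  by rewrite pnatr_eq0.
rewrite /coroot; case: xgetP => [c _ /Ucor//|/(_ ((2 / a t) *: t))].
case; split; first by rewrite linearZ /= -[_ *: _]/(_ * _) divfK.
exists [:: ((2 / a t) *: x, y)]; last by rewrite big_seq1 /= lieZl xy.
by move=> p; rewrite inE => /eqP-> /=; split=> //; apply: root_spaceZ.
Qed.

Lemma sl2_triple a x : is_root a -> root_space a x -> x != 0 ->
  exists2 y, root_space (- a) y & lie x y = vsval (coroot a).
Proof.
move=> ra ax x0; have [y ay Bxy] := form_pair ax x0.
have [t ta _] := root_dual ra; have [_ [k k0 kE]] := corootP ra.
exists ((k / B x y) *: y); first exact: root_spaceZ.
rewrite lieZr (lie_opp_roots ta ax ay) scalerA divfK //.
by have -> : coroot a = k *: t by apply: nu_inj; rewrite nuZ ta.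
Qed.

Lemma is_rootN a : is_root a -> is_root (- a).
Proof.
move=> [a0 [x x0 ax]]; have [y ay Bxy] := form_pair ax x0.
split; first by rewrite oppr_eq0.
by exists y => //; apply: contra_neq Bxy => ->; rewrite form0r.
Qed.

Definition refl a b : dual := b - b (coroot a) *: a.

Lemma weight_refl a b z : is_root a -> root_space b z -> z != 0 ->
  (exists p : int, b (coroot a) = p%:~R) /\
  exists2 z', z' != 0 & root_space (refl a b) z'.
Proof.
move=> ra bz z0; have [aca _] := corootP ra; have [a0 [x x0 ax]] := ra.
have [y ay xy] := sl2_triple ra ax x0.
have na0 : - a != 0 by rewrite oppr_eq0.
have [p [pE [z' z'0 bz']]] := @weight_reflect _ _ _ vsval _ (@dual_ev _ _ T) (@dual_evD _ _ T)
  (@dual_evZ _ _ T) _ (ad_rep g) x y (coroot a) a ax ay xy aca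
  (root_vector_nilpotent a0 ax) (root_vector_nilpotent na0 ay) b z z0 bz.
by split; [exists p|exists z'].
Qed.

Lemma coroot_int a b : is_root a -> is_root b -> exists p : int, b (coroot a) = p%:~R.
Proof. by move=> ra [b0 [z z0 bz]]; have [] := weight_refl ra bz z0. Qed.

Lemma reflK a : is_root a -> involutive (refl a).
Proof.
move=> ra b; have [aca _] := corootP ra; rewrite /refl add_lfunE opp_lfunE scale_lfunE aca.
have E (p : F^o) : p - p *: (2 : F^o) = - p by rewrite -[_ *: _]/((p : F) * 2) mulr_natr; ring.
by rewrite E scaleNr opprK subrK.
Qed.

Lemma is_root_refl a b : is_root a -> is_root b -> is_root (refl a b).
Proof.
move=> ra [b0 [z z0 bz]]; have [_ [z' z'0 bz']] := weight_refl ra bz z0.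
split; last by exists z'.
apply: contra_neq b0 => e; rewrite -(reflK ra b) e /refl zero_lfunE scale0r subr0 //.
Qed.

Lemma refl_self a : is_root a -> refl a a = - a.
Proof.
move=> ra; have [aca _] := corootP ra; rewrite /refl aca.
by rewrite scaler_nat mulr2n opprD addrA subrr add0r.
Qed.

End Coroots.

(** * Positive roots and their lengths *)

Section PositiveRoots.
Variables (F : numFieldType) (g : fdLieAlgType F) (T : triangular g) (B : inv_form g).
Local Notation H := (subvs_of (cartan T)).
Local Notation dual := 'Hom(H, F^o).
Local Notation alpha := (tnth (simple_roots T)).
Local Notation Qp := (in_Qplus (simple_roots T)).
Local Notation nuB := (nu (T := T) B).
Implicit Types (a b : dual) (c t : H) (x y z : g).

Hypothesis simp : simple_lie g.
Hypothesis norm : normalized T B.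

(** For the triple (y, x, - h) such a z is a highest weight vector of negative weight, which
    [sl2_highest_nat] excludes. *)
Lemma lowest_weight_eq0 a x y z n : is_root a -> root_space a x -> root_space (- a) y ->
  lie x y = vsval (coroot a) -> lie y z = 0 ->
  lie (vsval (coroot a)) z = n.+1%:R *: z -> z = 0.
Proof.
move=> ra ax ay xy yz hz; have [aca _] := corootP simp norm ra; have [a0 _] := ra.
apply: contrapT => /eqP z0; have [N xN] := root_vector_nilpotent a0 ax z.
have yx : lie y x = - vsval (coroot a) by rewrite lieC xy.
have hx : lie (- vsval (coroot a)) x = -2 *: x by rewrite lieNl ax aca scaleNr.
have hz' : lie (- vsval (coroot a)) z = (- n.+1%:R) *: z by rewrite lieNl hz scaleNr.
have [m mE] := sl2_highest_nat (rho := ad_rep g) yx hx z0 yz hz' xN.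
have : (0 : F) <= m%:R by [].
by rewrite -mE oppr_ge0 lern0.
Qed.

Lemma sl2_form_neq0 a x y : is_root a -> root_space a x -> root_space (- a) y ->
  lie x y = vsval (coroot a) -> B x y != 0.
Proof.
move=> ra ax ay; have [t ta _] := root_dual simp norm ra.
have [aca _] := corootP simp norm ra.
rewrite (lie_opp_roots simp norm ta ax ay) => e; apply/negP => /eqP B0.
move: aca; have -> : coroot a = 0 by apply: (can_inj vsvalK); rewrite -e B0 scale0r linear0.
by rewrite linear0 => /esym/eqP; rewrite pnatr_eq0.
Qed.

(** Subtract from z the multiple of x that makes it orthogonal to y. The difference then commutes
    with y, yet has weight 2 for the coroot. *)
Lemma root_space_line a x z : is_root a -> root_space a x -> x != 0 -> root_space a z ->
  exists k : F, z = k *: x.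
Proof.
move=> ra ax x0 az; have [y ay xy] := sl2_triple simp norm ra ax x0.
have [t ta _] := root_dual simp norm ra; have [aca _] := corootP simp norm ra.
have Bxy := sl2_form_neq0 ra ax ay xy.
exists (B z y / B x y); apply/eqP; rewrite -subr_eq0; apply/eqP.
have az' : root_space a (z - (B z y / B x y) *: x).
  by rewrite -scaleNr; apply: root_spaceD => //; apply: root_spaceZ.
apply: (lowest_weight_eq0 (n := 1) ra ax ay xy); last by rewrite az' aca.
rewrite lieC (lie_opp_roots simp norm ta az' ay) formBl formZl divfK //.
by rewrite subrr scale0r oppr0.
Qed.

(** For z of weight 2a, [y, z] is a multiple of x and is orthogonal to y by invariance, hence 0. A
    vector killed by y cannot have positive weight, here 4; higher multiples follow inductively,
    since [y, z] has one multiple of a less. *)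
Lemma root_multiple a n z : is_root a -> root_space (a *+ n.+2) z -> z = 0.
Proof.
move=> ra; have [a0 [x x0 ax]] := ra; have [y ay xy] := sl2_triple simp norm ra ax x0.
have [t ta _] := root_dual simp norm ra; have [aca _] := corootP simp norm ra.
have Bxy := sl2_form_neq0 ra ax ay xy.
have hz k w : root_space (a *+ k) w -> lie (vsval (coroot a)) w = (2 * k)%N%:R *: w.
  move=> ->; congr (_ *: _); rewrite -scaler_nat scale_lfunE aca natrM mulrC.
  by rewrite -[_ *: _]/(_ * _).
elim: n z => [|n ih] z az.
  apply: (lowest_weight_eq0 (n := 3) ra ax ay xy); last by rewrite (hz 2%N).
  have : root_space a (lie y z).
    by have := root_space_lie ay az; rewrite mulrSr mulr1n addrCA addNr addr0.
  move=> /(root_space_line ra ax x0)[k kE].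
  have /eqP : B (lie y z) y = 0.
    by rewrite (lieC y) -scaleN1r formZl form_inv liexx form0r mulr0.
  by rewrite kE formZl mulf_eq0 (negPf Bxy) orbF => /eqP ->; rewrite scale0r.
apply: (lowest_weight_eq0 (n := (2 * n.+2).+1) ra ax ay xy).
  by apply: ih; have := root_space_lie ay az; rewrite mulrS addKr.
by rewrite (hz n.+3) // mulnS.
Qed.

(* The ratio r compares the values of the Weyl-invariant positive form
   kappa(x, y) = sum_b b(x) b(y) on the two coroots. *)
Lemma coroot_sign a b : is_root a -> is_root b ->
  exists2 r : F, 0 < r & a (coroot b) = r * b (coroot a).
Proof.
have [rs urs rsP] := finite_roots T.
pose kap c t : F := \sum_(b <- rs) (b c : F) * b t.
have kap_refl d c t : is_root d ->
    kap (c - d c *: coroot d) (t - d t *: coroot d) = kap c t.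
  move=> rd; have rsE : perm_eq [seq refl d b | b <- rs] rs.
    apply: uniq_perm => //; first by rewrite map_inj_uniq //; apply: can_inj (reflK simp norm rd).
    move=> b'; apply/mapP/idP => [[b'' /rsP rb'' ->]|/rsP rb'].
      exact/rsP/(is_root_refl simp norm).
    exists (refl d b'); last by rewrite (reflK simp norm).
    exact/rsP/(is_root_refl simp norm).
  rewrite /kap -[RHS](perm_big _ rsE) big_map; apply: eq_bigr => b' _.
  have rE s : b' (s - d s *: coroot d) = refl d b' s.
    rewrite linearB linearZ /= /refl add_lfunE opp_lfunE scale_lfunE.
    by rewrite -[_ *: b' _]/(_ * _) -[_ *: d _]/(_ * _) mulrC.
  by rewrite !rE.
have kapD c t s k : kap (c + k *: t) s = kap c s + k * kap t s.
  rewrite /kap mulr_sumr -big_split; apply: eq_bigr => b' _.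
  by rewrite linearD linearZ /= -[_ *: b' t]/(_ * _) mulrDl mulrA.
have kapC c t : kap c t = kap t c by apply: eq_bigr => b' _; rewrite mulrC.
have kap2 d c : is_root d -> 2 * kap c (coroot d) = d c * kap (coroot d) (coroot d).
  move=> rd; have [dcd _] := corootP simp norm rd.
  have := kap_refl d c (coroot d) rd; rewrite dcd.
  have -> : coroot d - 2 *: coroot d = 0 + (-1) *: coroot d.
    by rewrite add0r scaleN1r scaler_nat mulr2n opprD addrA subrr add0r.
  have kap0 s : kap 0 s = 0.
    by rewrite /kap big1 // => b' _; rewrite linear0 mul0r.
  rewrite kapC kapD kap0 add0r kapC -scaleNr kapD => e.
  by rewrite mulrDl mul1r -{1}e; ring.
have kap_gt0 d : is_root d -> 0 < kap (coroot d) (coroot d).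
  move=> rd; rewrite /kap (bigD1_seq d) ?urs //=; last exact/rsP.
  have [-> _] := corootP simp norm rd.
  apply: ltr_wpDr; last by rewrite mulr_gt0.
  rewrite big_seq_cond; apply: sumr_ge0 => b' /andP[/rsP rb' _].
  have [p ->] := coroot_int simp norm rd rb'.
  by rewrite -intrM ler0z -expr2 sqr_ge0.
move=> ra rb; exists (kap (coroot b) (coroot b) / kap (coroot a) (coroot a)).
  by rewrite divr_gt0 ?kap_gt0.
have := kap2 _ (coroot a) rb; rewrite kapC kap2 // => e.
have nz : kap (coroot a) (coroot a) != 0 by rewrite gt_eqF ?kap_gt0.
by apply: (mulIf nz); rewrite e mulrAC divfK // mulrC.
Qed.

Lemma root_simple i : is_root (alpha i).
Proof. by have [rS _ _] := simple_rootsP T. Qed.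

Lemma root_pos_neg b : is_root b -> Qp b \/ Qp (- b).
Proof. by have [_ _] := simple_rootsP T; apply. Qed.

(** Otherwise all alpha_i(b^v) would be <= 0 by [coroot_sign], and so would b(b^v) = 2. *)
Lemma pos_root_descent b : is_root b -> Qp b -> exists i, 0 < b (coroot (alpha i)).
Proof.
move=> rb Qb; apply: contrapT => h; have [bcb _] := corootP simp norm rb.
have : b (coroot b) <= 0.
  rewrite {1}(QpE Qb) sum_lfunE; apply: sumr_le0 => i _.
  have [r r0 rE] := coroot_sign (root_simple i) rb.
  rewrite scale_lfunE -[_ *: _]/(_ * _) rE; apply: mulr_ge0_le0; first exact: Qp_cf_ge0.
  apply: mulr_ge0_le0; first exact: ltW.
  have [p pE] := coroot_int simp norm (root_simple i) rb.
  rewrite pE lerz0 leNgt; apply/negP => p0; apply: h; exists i.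
  by rewrite pE ltr0z.
by rewrite bcb lern0.
Qed.

Lemma cf_refl i j b : j != i -> cf j (refl (alpha i) b) = cf j b.
Proof. by move=> /negPf ji; rewrite cfD cfN cfZ cf_simple ji mulr0 subr0. Qed.

(** s_i changes only the coefficient of alpha_i. If the result is negative, all other coefficients
    of b vanish, and the only positive root proportional to alpha_i is alpha_i. *)
Lemma refl_pos i b : is_root b -> Qp b -> b != alpha i -> Qp (refl (alpha i) b).
Proof.
move=> rb Qb bi; have rr := is_root_refl simp norm (root_simple i) rb.
have [//|Qn] := root_pos_neg rr.
have bE : b = cf i b *: alpha i.
  rewrite {1}(QpE Qb) (bigD1 i) //= big1 ?addr0 // => j ji.
  suff -> : cf j b = 0 by rewrite scale0r.
  apply/eqP; rewrite eq_le Qp_cf_ge0 // andbT -oppr_ge0 -(cf_refl b ji) -cfN.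
  exact: Qp_cf_ge0.
have [n nE] := Qp_cf i Qb; rewrite nE scaler_nat in bE.
have [b0 [z z0 bz]] := rb; case: n => [|[|n]] in nE bE.
- by rewrite bE mulr0n eqxx in b0.
- by rewrite bE mulr1n eqxx in bi.
by move: bz; rewrite bE => /(root_multiple (root_simple i)) zE; rewrite zE eqxx in z0.
Qed.

(** Induction on the height, which s_i lowers by b(alpha_i^v) > 0. *)
Lemma pos_root_ind (P : dual -> Prop) : (forall i, P (alpha i)) ->
  (forall i b, is_root b -> Qp b -> is_root (refl (alpha i) b) -> Qp (refl (alpha i) b) ->
     b != alpha i -> 0 < b (coroot (alpha i)) -> P (refl (alpha i) b) -> P b) ->
  forall b, is_root b -> Qp b -> P b.
Proof.
move=> P1 PS b rb Qb; have [n] := Qp_height Qb.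
elim/ltn_ind: n b rb Qb => n ih b rb Qb nE.
have [i bi] := pos_root_descent rb Qb.
case: (eqVneq b (alpha i)) => [->|bni]; first exact: P1.
have rr := is_root_refl simp norm (root_simple i) rb.
have Qr := refl_pos rb Qb bni; have [m mE] := Qp_height Qr.
apply: (PS i) => //; apply: (ih m) => //.
rewrite -(ltr_nat F) -mE -nE /refl heightD heightN heightZ height_simple mulr1.
by rewrite gtrDl oppr_lt0.
Qed.

Lemma coroot_unique b c k : is_root b -> nuB c = k *: b -> b c = 2 -> coroot b = c.
Proof.
move=> rb cE bc; have [bcb [l l0 lE]] := corootP simp norm rb.
have e : l *: c = k *: coroot b.
  by apply: (nu_inj simp norm); rewrite !nuZ cE lE !scalerA mulrC.
have /eqP := congr1 b e; rewrite !linearZ /= bc bcb -subr_eq0 -scalerBl scaler_eq0.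
rewrite subr_eq0 pnatr_eq0 orbF => /eqP lk; rewrite -lk in e.
by rewrite -(scalerK l0 c) e scalerK.
Qed.

Lemma coroot_refl a b : is_root a -> is_root b ->
  coroot (refl a b) = coroot b - a (coroot b) *: coroot a.
Proof.
move=> ra rb; have [aca [l l0 lE]] := corootP simp norm ra.
have [bcb [k k0 kE]] := corootP simp norm rb.
have e : a (coroot b) * l = k * b (coroot a).
  have := nu_sym (T := T) B (coroot a) (coroot b); rewrite lE kE !scale_lfunE.
  by rewrite mulrC.
apply: (coroot_unique (k := k)); first exact: (is_root_refl simp norm).
  by rewrite nuD nuN nuZ lE kE scalerA e /refl scalerBr scalerA.
rewrite /refl add_lfunE opp_lfunE scale_lfunE !linearB !linearZ /= aca bcb.
rewrite -![_ *: _]/(_ * _) /=; ring.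
Qed.

(** Meant for the highest root, with k = 1. As s_i b is nonzero on the coroot of alpha_i, its
    support contains alpha_i or some alpha_j not orthogonal to it; in the second case both Cartan
    integers are -1, and the symmetry of the form equates the two constants. *)
Lemma simply_laced_norm b k : simply_laced T -> is_root b -> Qp b -> nuB (coroot b) = k *: b ->
  forall i, cf i b != 0 -> nuB (coroot (alpha i)) = k *: alpha i.
Proof.
move=> SL; move: b; apply: pos_root_ind => [j kE i|i b rb Qb rr Qr bni bi ih kE j jb].
  by rewrite cf_simple; case: (i =P j) => [->|_]; rewrite ?eqxx.
have ri := root_simple i; have [_ [l l0 lE]] := corootP simp norm ri.
have rkE : nuB (coroot (refl (alpha i) b)) = k *: refl (alpha i) b.
  rewrite (coroot_refl ri rb) nuD nuN nuZ kE lE /refl scalerBr !scalerA.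
  congr (_ - _ *: _); have := nu_sym (T := T) B (coroot (alpha i)) (coroot b).
  by rewrite lE kE !scale_lfunE mulrC.
have ihj := ih rkE; case: (eqVneq (cf j (refl (alpha i) b)) 0) => [j0|/ihj//].
have ji : j = i.
  by apply: contra_neq_eq jb => ji; rewrite -(cf_refl b ji).
rewrite {j jb j0}ji; have [aca _] := corootP simp norm ri.
have ne0 : refl (alpha i) b (coroot (alpha i)) != 0.
  rewrite /refl add_lfunE opp_lfunE scale_lfunE aca -[_ *: _]/(_ * _).
  by rewrite mulr_natr mulr2n opprD addrA subrr add0r oppr_eq0 gt_eqF.
have [j cj aj] : exists2 j, cf j (refl (alpha i) b) != 0 & alpha j (coroot (alpha i)) != 0.
  apply: contrapT => h; case/eqP: ne0; rewrite {1}(QpE Qr) sum_lfunE big1 // => j _.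
  rewrite scale_lfunE -[_ *: _]/(_ * _); apply/eqP; rewrite mulf_eq0.
  apply: contrapT => /negP; rewrite negb_or => /andP[c1 c2]; apply: h; by exists j.
case: (eqVneq j i) cj aj => [->|ji] cj aj; first exact: ihj.
have := nu_sym (T := T) B (coroot (alpha i)) (coroot (alpha j)).
rewrite lE (ihj j cj) !scale_lfunE.
have [/eqP|->] := SL j i ji; first by rewrite (negPf aj).
rewrite eq_sym in ji; have [->|->] := SL i j ji; rewrite -![_ *: _]/(_ * _).
  move/eqP; rewrite mulr0 mulrN1 eq_sym oppr_eq0 => /eqP k0.
  have [_ [k' k'0 k'E]] := corootP simp norm rr.
  have [b'0 _] := rr; case/eqP: b'0.
  by apply: (scalerI k'0); rewrite -k'E rkE k0 !scale0r scaler0.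
by move/eqP; rewrite !mulrN1 eqr_opp => /eqP ->.
Qed.

Lemma Qp_highest_root : Qp (highest_root T).
Proof.
have [rT Thi] := highest_rootP T simp; have [//|Qn] := root_pos_neg rT.
have := Thi _ (is_rootN simp norm rT); rewrite opprK -mulr2n => Q2; have [T0 _] := rT.
suff /eqP : highest_root T *+ 2 = 0.
  by rewrite -scaler_nat scaler_eq0 pnatr_eq0 (negPf T0).
by apply: Qp_anti => //; rewrite mulr2n opprD; apply: QpD.
Qed.

(** Theta - alpha_i is in the positive cone, so every alpha_i occurs in Theta. *)
Lemma nu_coroot_simple i : simply_laced T -> nuB (coroot (alpha i)) = alpha i.
Proof.
move=> SL; have [rT Thi] := highest_rootP T simp.
rewrite -[RHS]scale1r; apply: (simply_laced_norm SL rT Qp_highest_root); first by rewrite scale1r; exact: norm.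
have := Qp_cf_ge0 i (Thi _ (root_simple i)).
rewrite cfD cfN cf_simple eqxx subr_ge0 => le1.
by rewrite gt_eqF // (lt_le_trans ltr01).
Qed.

End PositiveRoots.

(** * The Weyl group *)

Section WeylGroup.
Variables (F : numFieldType) (g : fdLieAlgType F) (T : triangular g) (B : inv_form g).
Local Notation H := (subvs_of (cartan T)).
Local Notation dual := 'Hom(H, F^o).
Local Notation alpha := (tnth (simple_roots T)).
Local Notation Qp := (in_Qplus (simple_roots T)).
Local Notation nuB := (nu (T := T) B).
Local Notation wd := (weyl_dual (T := T)).
Implicit Types (a b : dual) (c : H) (i j : 'I_(rank T)) (w u v : seq 'I_(rank T)).

Hypothesis simp : simple_lie g.
Hypothesis norm : normalized T B.
Hypothesis SL : simply_laced T.

Local Lemma simple_coroot i : alpha i (coroot (alpha i)) = 2.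
Proof. by have [] := corootP simp norm (root_simple i). Qed.

Lemma weyl_cat u v c : weyl (u ++ v) c = weyl u (weyl v c).
Proof. by rewrite /weyl foldr_cat. Qed.
Lemma weyl_dual_cat u v a : wd (u ++ v) a = wd u (wd v a).
Proof. by rewrite /weyl_dual foldr_cat. Qed.

Lemma weyl_dual_revK w : cancel (wd w) (wd (rev w)).
Proof.
elim: w => [|i w ih] a //; rewrite rev_cons -cats1 weyl_dual_cat /=.
rewrite -[RHS]ih; congr (wd _ _).
exact: (reflK simp norm (root_simple i) (wd w a)).
Qed.

Lemma weyl_pair w a c : wd w a (weyl w c) = a c.
Proof.
elim: w => [//|i w] /=; move: (wd w a) (weyl w c) => b d <-.
rewrite add_lfunE opp_lfunE scale_lfunE !linearB !linearZ /= simple_coroot.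
rewrite -![_ *: _]/(_ * _) /=; ring.
Qed.

Lemma weyl_dual_rev w a c : wd (rev w) a c = a (weyl w c).
Proof. by rewrite -(weyl_pair w) -{1}(revK w) weyl_dual_revK. Qed.

Lemma weyl_dual_root w a : is_root a -> is_root (wd w a).
Proof.
by move=> ra; elim: w => //= i w ih; apply: (is_root_refl simp norm (root_simple i)).
Qed.

Lemma weyl_dualN w a : wd w (- a) = - wd w a.
Proof.
by elim: w => //= i w ->; rewrite opp_lfunE scaleNr opprK opprB addrC.
Qed.

Lemma weylBZ w c (k : F) c' : weyl w (c - k *: c') = weyl w c - k *: weyl w c'.
Proof.
elim: w => //= i w ->; move: (weyl w c) (weyl w c') => d d'.
have -> : alpha i (d - k *: d') = alpha i d - k *: alpha i d'.
  by rewrite linearB; congr (_ - _); apply: linearZZ.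
rewrite scalerBl scalerBr !opprB !addrA [LHS](ACl (1*4*3*2)) /= scalerA.
by rewrite -[k *: alpha i d']/(k * _).
Qed.

Lemma nu_weyl w c : nuB (weyl w c) = wd w (nuB c).
Proof.
elim: w => //= i w <-; rewrite nuD nuN nuZ; move: (weyl w c) => d.
have -> : alpha i d = nuB d (coroot (alpha i)).
  by rewrite nu_sym (nu_coroot_simple simp norm i SL).
by rewrite (nu_coroot_simple simp norm i SL).
Qed.

Lemma weyl_refl2 j w : weyl [:: j, j & w] =1 weyl w.
Proof.
move=> c /=; move: (weyl w c) => d.
have -> : alpha j (d - alpha j d *: coroot (alpha j)) = - alpha j d.
  have -> : alpha j (d - alpha j d *: coroot (alpha j)) =
      alpha j d - alpha j d *: alpha j (coroot (alpha j)).
    by rewrite linearB; congr (_ - _); apply: linearZZ.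
  rewrite simple_coroot; move: (alpha j d) => k.
  by rewrite -[k *: _]/((k : F) * 2) mulr_natr mulr2n opprD addrA subrr add0r.
by rewrite scaleNr opprK subrK.
Qed.

(** At some letter j of w, with u the word before it, u^-1(alpha_i) is positive but becomes negative
    under s_j. By [refl_pos] it equals alpha_j, which means s_i u = u s_j. *)
Lemma exchange i w : ~ Qp (wd (rev w) (alpha i)) ->
  exists u j v, w = u ++ j :: v /\ weyl (i :: u) =1 weyl (rcons u j).
Proof.
elim/last_ind: w => [|w j ih]; first by case; apply: Qp_simple.
rewrite rev_rcons /= => nQ; have [Qw|/ih[a [j' [b [-> e]]]]] :=
  pselect (Qp (wd (rev w) (alpha i))); last first.
  by exists a, j', (rcons b j); rewrite rcons_cat.
exists w, j, [::]; rewrite cats1; split=> // c.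
have wj : wd (rev w) (alpha i) = alpha j.
  apply: contrapT => /eqP ne; apply: nQ; apply: (refl_pos simp norm) => //.
  exact/weyl_dual_root/root_simple.
have aE : wd w (alpha j) = alpha i by rewrite -wj -{1}(revK w) weyl_dual_revK.
have cE : weyl w (coroot (alpha j)) = coroot (alpha i).
  by apply: (nu_inj simp norm); rewrite nu_weyl !nu_coroot_simple.
rewrite -cats1 weyl_cat /= weylBZ cE; congr (_ - _ *: _).
by rewrite -weyl_dual_rev wj.
Qed.

(** Otherwise w = u j v with s_i u = u s_j, and s_i w is given by the word u v, shorter by two
    letters. *)
Lemma reduced_pos i w : reduced_word (i :: w) -> Qp (wd (rev w) (alpha i)).
Proof.
move=> red; apply: contrapT => /exchange[a [j [b [wE e]]]].
have : (size (i :: w) <= size (a ++ b))%N.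
  apply: red => c; rewrite wE -cat_cons !weyl_cat e -cats1 weyl_cat; congr (weyl a _).
  exact/esym/weyl_refl2.
by rewrite wE /= !size_cat /= addnS => /ltnW; rewrite ltnn.
Qed.

Lemma reduced_behead i w : reduced_word (i :: w) -> reduced_word w.
Proof. by move=> red w' e; apply: (red (i :: w')) => c /=; rewrite e. Qed.

Variable rs : seq dual.
Hypotheses (urs : uniq rs) (rsP : forall b, b \in rs <-> is_root b).

(** The length function. It depends only on the Weyl group element and bounds the size of every word
    for that element from below, which gives a test for being reduced. *)
Definition inversions w : nat :=
  count (fun b => `[< Qp b >] && ~~ `[< Qp (wd (rev w) b) >]) rs.

Lemma inversions_ext w w' : weyl w' =1 weyl w -> inversions w' = inversions w.
Proof.
move=> e; apply: eq_count => b; congr (_ && ~~ `[< Qp _ >]); apply/lfunP => c.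
by rewrite !weyl_dual_rev e.
Qed.

Lemma Qp_opp_root b : is_root b -> `[< Qp (- b) >] = ~~ `[< Qp b >].
Proof.
move=> rb; apply/asboolP/idP => [Qn|/asboolP nQ].
  by apply/asboolP => Qb; have [b0 _] := rb; rewrite (Qp_anti Qb Qn) eqxx in b0.
by have [] := root_pos_neg rb.
Qed.

(** Written additively since the count changes by 1 in either direction. s_i permutes the roots
    other than alpha_i and - alpha_i and keeps their signs, so only these two matter. *)
Lemma inversions_cons i w :
  (inversions (i :: w) + ~~ `[< Qp (wd (rev w) (alpha i)) >] =
   inversions w + `[< Qp (wd (rev w) (alpha i)) >])%N.
Proof.
have ri := root_simple i; have rK := reflK simp norm ri.
have perm_refl : perm_eq [seq refl (alpha i) b | b <- rs] rs.
  apply: uniq_perm => //; first by rewrite map_inj_uniq //; apply: can_inj rK.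
  move=> b; apply/mapP/idP => [[b' /rsP rb' ->]|/rsP rb].
    exact/rsP/(is_root_refl simp norm).
  by exists (refl (alpha i) b); [exact/rsP/(is_root_refl simp norm)|rewrite rK].
have -> : inversions (i :: w) =
  count (fun b => `[< Qp (refl (alpha i) b) >] && ~~ `[< Qp (wd (rev w) b) >]) rs.
  rewrite /inversions -(permP perm_refl) count_map; apply: eq_count => b /=.
  by rewrite rev_cons -cats1 weyl_dual_cat /= -/(refl _ _) rK.
have ars : alpha i \in rs by apply/rsP.
have nai : - alpha i != alpha i.
  have [a0 _] := ri; apply: contra_neq a0 => /eqP.
  by rewrite -subr_eq0 -opprD oppr_eq0 -mulr2n -scaler_nat scaler_eq0 pnatr_eq0 => /eqP.
have nrs : - alpha i \in rem (alpha i) rs.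
  by rewrite mem_rem_uniq // inE nai; apply/rsP/(is_rootN simp norm).
have pE : perm_eq rs [:: alpha i, - alpha i & rem (- alpha i) (rem (alpha i) rs)].
  by apply: (perm_trans (perm_to_rem ars)); rewrite perm_cons perm_to_rem.
rewrite /inversions !(permP pE) /= (refl_self simp norm ri) /refl opp_lfunE.
have -> : - alpha i - - alpha i (coroot (alpha i)) *: alpha i = alpha i.
  by rewrite simple_coroot scaleNr opprK scaler_nat mulr2n addKr.
have rw := weyl_dual_root (rev w) ri.
rewrite weyl_dualN !Qp_opp_root // negbK (asboolT (Qp_simple i)) /=.
rewrite (@eq_in_count _ _ (fun b => `[< Qp b >] && ~~ `[< Qp (wd (rev w) b) >])
   (rem (- alpha i) (rem (alpha i) rs))); first by rewrite !add0n [RHS]addnC -addnA; congr (_ + _)%N; rewrite addnC.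
move=> b; rewrite mem_rem_uniq ?rem_uniq // inE mem_rem_uniq // inE.
move=> /and3P[bn bi /rsP rb]; congr (_ && _); apply/asboolP/asboolP => Qb.
  rewrite -(rK b); apply: (refl_pos simp norm _ Qb); first exact: (is_root_refl simp norm).
  by apply: contra_neq bn => e; rewrite -(rK b) (_ : refl _ b = alpha i) ?(refl_self simp norm ri).
exact: (refl_pos simp norm rb Qb bi).
Qed.

Lemma inversions_le w : (inversions w <= size w)%N.
Proof.
elim: w => [|i w ih] /=.
  rewrite /inversions (eq_count (a2 := pred0)) ?count_pred0 // => b /=.
  by rewrite andbN.
by have := inversions_cons i w; case: `[< _ >]; lia.
Qed.

Lemma inversions_reduced w : reduced_word w -> inversions w = size w.
Proof.
elim: w => [|i w ih] red; first by apply/eqP; rewrite -leqn0 inversions_le.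
have := inversions_cons i w; rewrite (asboolT (reduced_pos red)) /=.
rewrite ih; [lia|exact: reduced_behead red].
Qed.

End WeylGroup.

(** * The longest element *)

Section LongestElement.
Variables (F : numFieldType) (g : fdLieAlgType F) (T : triangular g) (B : inv_form g).
Local Notation H := (subvs_of (cartan T)).
Local Notation alpha := (tnth (simple_roots T)).
Local Notation Qp := (in_Qplus (simple_roots T)).
Local Notation nuB := (nu (T := T) B).
Hypothesis simp : simple_lie g.
Hypothesis norm : normalized T B.
Hypothesis SL : simply_laced T.

(** If w^-1(alpha_i) were positive, [i :: w] would have as many inversions as letters, hence be
    reduced and longer than w. *)
Lemma longest_neg (w : seq 'I_(rank T)) i :
  longest_word w -> Qp (- weyl_dual (rev w) (alpha i)).
Proof.
move=> [red maxw]; have [rs urs rsP] := finite_roots T.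
have rw := weyl_dual_root simp norm (rev w) (root_simple i).
have [Qw|//] := root_pos_neg rw.
have := inversions_cons simp norm urs rsP i w.
rewrite (asboolT Qw) (inversions_reduced simp norm SL urs rsP red) /= => Ni.
suff /maxw : reduced_word (i :: w) by rewrite /= ltnn.
move=> w' e; rewrite /= -addn1 -Ni addn0 -(inversions_ext simp norm rs e).
exact: (inversions_le simp norm urs rsP).
Qed.

(** The value is (w^-1 alpha_i)(c), where w^-1 alpha_i is minus a sum of simple roots. *)
Lemma longest_antidominant (w : seq 'I_(rank T)) (c : H) i :
  longest_word w -> dominant_coweight c ->
  exists n : nat, nuB (weyl w c) (coroot (alpha i)) = - n%:R.
Proof.
move=> lw dc; rewrite nu_sym (nu_coroot_simple simp norm i SL).
rewrite -(weyl_dual_rev simp norm) -[weyl_dual _ _]opprK opp_lfunE.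
have [n ->] := longest_neg i lw; have /choice[k kE] := dc.
exists (\sum_j k j * n j)%N; congr (- _); rewrite sum_lfunE natr_sum.
by apply: eq_bigr => j _; rewrite -scaler_nat scale_lfunE kE natrM mulrC.
Qed.

End LongestElement.

(** * The affine algebra and its highest weight modules *)

Section AffineAlgebra.
Variables (F : numFieldType) (g : fdLieAlgType F) (T : triangular g) (B : inv_form g).
Local Notation H := (subvs_of (cartan T)).
Local Notation dual := 'Hom(H, F^o).
Local Notation alpha := (tnth (simple_roots T)).
Local Notation Qp := (in_Qplus (simple_roots T)).
Local Notation nuB := (nu (T := T) B).
Local Notation A := (affine B).
Implicit Types (x y z : g) (n k : int) (a p : A).

(** [am x n] is x (x) t^n, [acd a b] is a K + b d, and [tor] embeds the affine Cartan subalgebra. *)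
Definition am x n : A := (tmon x n, 0, 0).
Definition acd (c d : F^o) : A := (0, c, d).
Definition tor (y : H * F^o * F^o) : A := (tmon (vsval y.1.1) 0, y.1.2, y.2).
Definition awt (al : affwt T) a := wvec (fun t => @lie F A (tor t)) (@affwt_eval F g T) al a.

Lemma affwt_evalD (mu nu : affwt T) t :
  affwt_eval (mu + nu) t = affwt_eval mu t + affwt_eval nu t.
Proof. by rewrite /affwt_eval /= add_lfunE; ring. Qed.

Lemma affwt_evalZ (r : F) (mu : affwt T) t :
  affwt_eval (r *: mu) t = r * affwt_eval mu t.
Proof.
rewrite /affwt_eval /= scale_lfunE.
by rewrite -![_ *: _]/(_ * _) !mulrDr !mulrA.
Qed.

Lemma affwt_eval_inj (mu nu : affwt T) : mu != nu ->
  exists t, affwt_eval mu t != affwt_eval nu t.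
Proof.
move=> mn; apply: contrapT => h; case/eqP: mn.
have E t : affwt_eval mu t = affwt_eval nu t.
  by apply/eqP/negPn/negP => hy; apply: h; exists t.
case: mu nu E {h} => [[a1 b1] c1] [[a2 b2] c2] E.
have e1 : a1 = a2.
  apply/lfunP => y; have := E (y, 0, 0).
  by rewrite /affwt_eval /= !mulr0 !addr0.
have e2 : b1 = b2.
  have := E (0, 1, 0); rewrite /affwt_eval /= !linear0 !mulr1 !mulr0 !addr0.
  by rewrite !add0r.
have e3 : c1 = c2.
  have := E (0, 0, 1); rewrite /affwt_eval /= !linear0 !mulr1 !mulr0 !addr0.
  by rewrite !add0r.
by rewrite e1 e2 e3.
Qed.

Lemma amD x y n : am (x + y) n = am x n + am y n.
Proof. by apply: affineP; rewrite /= ?addr0 // tmonD. Qed.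
Lemma amZ (c : F) x n : am (c *: x) n = c *: am x n.
Proof. by apply: affineP; rewrite /= ?scaler0 // tmonZ. Qed.
Lemma am0 n : am 0 n = 0.
Proof. by apply: affineP; rewrite //= tmon0. Qed.
Lemma am_sum (I : Type) (s : seq I) (f : I -> g) n :
  am (\sum_(i <- s) f i) n = \sum_(i <- s) am (f i) n.
Proof. by elim/big_rec2: _ => [|i u v _ <-]; rewrite ?am0 ?amD. Qed.

Lemma affine_ind (P : A -> Prop) : (forall a b, P a -> P b -> P (a + b)) ->
  (forall c d, P (acd c d)) -> (forall x n, P (am x n)) -> forall a, P a.
Proof.
move=> PD Pc Pa [[x c] d].
have -> : (x, c, d) = (x, 0, 0) + acd c d :> A.
  by apply: affineP; rewrite /= ?addr0 ?add0r.
apply: (PD) => //; elim/loop_ind: x => [|x y Px Py|x n]; [exact: (Pc 0 0)| |exact: Pa].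
have -> : (x + y, 0, 0) = (x, 0, 0) + (y, 0, 0) :> A.
  by apply: affineP; rewrite /= ?addr0.
exact: PD.
Qed.

Lemma lie_am x y n k : lie (am x n) (am y k) =
  (tmon (lie x y) (n + k), if n + k == 0 then n%:~R * B x y else 0, 0) :> A.
Proof.
apply: affineP => //=; last exact: cocycle_tmon.
by rewrite !scale0r subr0 addr0 lie_tmon.
Qed.

(** The cocycle is n times the form when n + k = 0, which here forces n = 0: g[t] embeds without a
    central term. *)
Lemma lie_am_nonneg x y (n k : nat) : lie (am x n) (am y k) = am (lie x y) (n + k)%N.
Proof.
rewrite lie_am -PoszD /am; congr (_, _, _); case: eqP => // /eqP.
by rewrite eqz_nat addn_eq0 => /andP[/eqP-> _]; rewrite mul0r.
Qed.

Lemma lie_am_cd x n c d : lie (am x n) (acd c d) = (- (d * n%:~R)) *: am x n.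
Proof.
apply: affineP => /=; last by rewrite scaler0.
  by rewrite lie0r scale0r addr0 add0r loop_deriv_tmon scalerA scaleNr.
rewrite scaler0 /cocycle big1 // => i _.
rewrite (_ : (0 : loop g)@_(- i) = 0) ?form0r ?mulr0 //; exact: mcoeff0.
Qed.

Lemma awt_am b x n : root_space (h := cartan T) b x -> awt (b, 0, n%:~R) (am x n).
Proof.
move=> bx t; have -> : tor t = am (vsval t.1.1) 0 + acd t.1.2 t.2.
  by apply: affineP; rewrite /= ?addr0 ?add0r.
rewrite lieDl lie_am bx (lieC (acd _ _)) lie_am_cd scaleNr opprK.
rewrite /affwt_eval /= mul0r if_same mul0r addr0 add0r.
rewrite -[(tmon _ _, _, _)]/(am (b t.1.1 *: x) n) amZ -scalerDl; congr (_ *: _).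
by rewrite mulrC.
Qed.

(** Up to a central term, iterated brackets apply ad x to the g-component. Once that is 0, one
    further bracket removes the central term, hence [N.+1]. *)
Lemma am_nilpotent b x n : b != 0 -> root_space (h := cartan T) b x ->
  forall a, exists N, iter N (lie (am x n)) a = 0.
Proof.
move=> b0 bx; apply: affine_ind => [a a' [N aN] [N' aN']|c d|z k].
- exists (N + N')%N; rewrite (iter_repD (ad_rep A)).
  rewrite (iter_rep0_le (rho := ad_rep A) (leq_addr N' N) aN).
  by rewrite (iter_rep0_le (rho := ad_rep A) (leq_addl N N') aN') addr0.
- by exists 2%N; rewrite /= lie_am_cd lieZr liexx scaler0.
have [N xN] := root_vector_nilpotent b0 bx z.
have E m : exists k' c, iter m (lie (am x n)) (am z k) = am (iter m (lie x) z) k' + acd c 0.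
  elim: m => [|m [k' [c ih]]].
    by exists k, 0; apply: affineP; rewrite /= ?addr0.
  rewrite iterS ih lieDr lie_am lie_am_cd mul0r oppr0 scale0r addr0.
  by exists (n + k'), (if n + k' == 0 then n%:~R * B x (iter m (lie x) z) else 0);
    apply: affineP; rewrite /= ?addr0 ?add0r.
have [k' [c NE]] := E N.
exists N.+1; rewrite iterS NE xN am0 add0r lie_am_cd mul0r oppr0.
by rewrite scale0r.
Qed.

Lemma affine_borelD a p : affine_borel T a -> affine_borel T p -> affine_borel T (a + p).
Proof.
move=> [a1 a2] [p1 p2]; split=> [n n0|] /=; rewrite loop_coefD.
  by rewrite a1 // p1 // addr0.
exact: borelD.
Qed.

Lemma affine_borel_cd c d : affine_borel T (acd c d).
Proof.
split=> [n _|] /=; rewrite (mcoeff0 _ : (0 : loop g)@_ _ = 0) //.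
exact: borel_nplus (nplus0 T).
Qed.

Lemma affine_borel_am x n : 0 <= n -> (n = 0 -> borel T x) -> affine_borel T (am x n).
Proof.
move=> n0 nx; split=> [k k0|] /=; rewrite coef_tmon.
  by case: eqP => // nk; rewrite nk leNgt k0 in n0.
by case: eqP => [/nx//|_]; apply: borel_nplus (nplus0 T).
Qed.

Definition aneg a := exists b x n, [/\ a = am x n, root_space (h := cartan T) b x,
  b = 0 \/ is_root b & n < 0 \/ n = 0 /\ is_root b /\ Qp (- b)].

Lemma affine_tri_decomp a : exists (s : seq A) p,
  [/\ forall f, f \in s -> aneg f, affine_borel T p & a = \sum_(f <- s) f + p].
Proof.
elim/affine_ind: a => [a a' [s [p [sP pP ->]]] [s' [p' [sP' pP' ->]]]|c d|x n].
- exists (s ++ s'), (p + p'); rewrite big_cat addrACA; split=> //.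
    by move=> f; rewrite mem_cat => /orP[/sP|/sP'].
  exact: affine_borelD.
- exists [::], (acd c d); rewrite big_nil add0r; split=> //.
  exact: affine_borel_cd.
have [n0|n0|n0] := ltgtP n 0.
- have [s sP ->] := root_decomp T x; pose s' := [seq q <- s | q.2 != 0].
  exists [seq am q.2 n | q <- s'], 0; split.
  + move=> _ /mapP[p + ->]; rewrite mem_filter => /andP[p0 ps].
    exists p.1, p.2, n; split=> //; [exact: sP|idtac|by left].
    case: (eqVneq p.1 0) => [->|p10]; [by left|right; split=> //].
    by exists p.2 => //; apply: sP.
  + exact: affine_borel_cd.
  rewrite addr0 am_sum big_map big_filter [RHS]big_mkcond; apply: eq_bigr => p _.
  by case: eqP => // ->; rewrite am0.
- exists [::], (am x n); rewrite big_nil add0r; split=> //.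
  by apply: affine_borel_am => [|n1]; [apply: ltW|rewrite n1 ltxx in n0].
have [s [p [sP bp ->]]] := tri_decomp T x; rewrite n0.
exists [seq am f 0 | f <- s], (am p 0); split.
- move=> _ /mapP[f fs ->]; have [b [rb Qb bf]] := sP f fs.
  by exists b, f, 0; split=> //; right.
- exact: affine_borel_am.
by rewrite amD am_sum big_map.
Qed.

End AffineAlgebra.

(** * The affine positive cone and the weights of a highest weight module *)

Section AffineWeights.
Variables (F : numFieldType) (g : fdLieAlgType F) (T : triangular g) (B : inv_form g).
Local Notation H := (subvs_of (cartan T)).
Local Notation dual := 'Hom(H, F^o).
Local Notation alpha := (tnth (simple_roots T)).
Local Notation Qp := (in_Qplus (simple_roots T)).
Local Notation Th := (highest_root T).
Local Notation A := (affine B).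
Local Notation am := (am B).
Local Notation tor := (tor (T := T) B).
Hypothesis simp : simple_lie g.
Hypothesis norm : normalized T B.
Implicit Types (ga : affwt T) (a b : dual).

(** The cone of natural combinations of affine simple roots: since alpha_0 = delta - Theta, b + n
    delta = n alpha_0 + (b + n Theta). *)
Definition Qa ga := ga.1.2 = 0 /\
  exists n : nat, ga.2 = n%:R /\ Qp (ga.1.1 + n%:R *: Th).

Lemma Qa0 : Qa 0.
Proof. by split=> //; exists 0%N; rewrite scale0r addr0; split=> //; apply: Qp0. Qed.

Lemma QaD ga ga' : Qa ga -> Qa ga' -> Qa (ga + ga').
Proof.
move=> [g0 [n [gn Qg]]] [g0' [n' [gn' Qg']]]; split; first by rewrite /= g0 g0' addr0.
exists (n + n')%N; rewrite /= gn gn' natrD scalerDl addrACA; split=> //.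
exact: QpD.
Qed.

Lemma QaZ ga (n : nat) : Qa ga -> Qa ((n%:R : F) *: ga).
Proof.
move=> Qg; elim: n => [|n ih]; first by rewrite scale0r; apply: Qa0.
by rewrite -natr1 scalerDl scale1r; apply: QaD.
Qed.

Lemma Qa_anti ga : Qa ga -> Qa (- ga) -> ga = 0.
Proof.
case: ga => [[a c] d] [/= -> [n [-> Qn]]] [_ [m [/= mE Qm]]].
have n0 : n = 0%N.
  by apply/eqP; rewrite -(pnatr_eq0 F) eq_le ler0n -oppr_ge0 mE ler0n.
have m0 : m = 0%N by apply/eqP; rewrite -(pnatr_eq0 F) -mE n0 oppr0.
move: Qn Qm; rewrite n0 m0 scale0r !addr0 => Qn Qm.
by rewrite (Qp_anti Qn Qm).
Qed.

Local Notation Qp_Th := (Qp_highest_root simp norm).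

Lemma is_root_Th : is_root Th. Proof. by have [] := highest_rootP T simp. Qed.

Lemma Th_root b : b = 0 \/ is_root b -> Qp (Th - b).
Proof.
case=> [->|rb]; first by rewrite subr0; apply: Qp_Th.
by have [_] := highest_rootP T simp; apply.
Qed.

Lemma root_oppE b : b = 0 \/ is_root b -> - b = 0 \/ is_root (- b).
Proof. by case=> [->|rb]; [left; rewrite oppr0|right; apply: (is_rootN simp norm)]. Qed.

Lemma Qa_imag b (n : nat) : b = 0 \/ is_root b -> Qa (b, 0, n.+1%:R).
Proof.
move=> rb; split=> //; exists n.+1; split=> //=.
rewrite -natr1 scalerDl scale1r addrCA; apply: QpD.
  by rewrite scaler_nat; apply: QpMn Qp_Th.
by rewrite addrC -[b]opprK; apply/Th_root/root_oppE.
Qed.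

Lemma Qa_finite b : Qp b -> Qa (b, 0, 0).
Proof. by move=> Qb; split=> //; exists 0%N; rewrite scale0r addr0. Qed.

Lemma Qa_affine_root i : Qa (affine_root i).
Proof.
case: i => [i|]; first exact/Qa_finite/Qp_simple.
exact/(@Qa_imag (- Th) 0)/root_oppE/or_intror/is_root_Th.
Qed.

Lemma affine_root_neq0 (i : option 'I_(rank T)) : affine_root i != 0.
Proof.
case: i => [i|]; apply/eqP => [[e]].
  by have [a0 _] := root_simple i; rewrite e eqxx in a0.
by move=> /eqP; rewrite oner_eq0.
Qed.

(** Each affine simple root spans an extremal ray of the cone. *)
Lemma Qa_multiple i (M : nat) ga : Qa ga -> Qa ((M%:R : F) *: affine_root i - ga) ->
  exists j : nat, ga = (j%:R : F) *: affine_root i.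
Proof.
case: ga => [[a c] d] [/= -> [n [-> Qn]]]; case: i => [i|] [_ [m [/= mE Qm]]].
  have n0 : n = 0%N.
    apply/eqP; rewrite -(pnatr_eq0 F) eq_le ler0n -oppr_ge0.
    by move: mE; rewrite -[_ *: 0]/(_ * 0) mulr0 add0r => ->; rewrite ler0n.
  have m0 : m = 0%N.
    by apply/eqP; rewrite -(pnatr_eq0 F) -mE n0 -[_ *: 0]/(_ * 0) mulr0 subr0.
  move: Qn Qm; rewrite n0 m0 scale0r !addr0 => Qn Qm.
  have [j jE] := Qp_cf i Qn; exists j.
  suff -> : a = j%:R *: alpha i.
    by congr (_, _, _); rewrite -[_ *: 0]/(_ * 0) mulr0.
  rewrite [LHS](QpE Qn) (bigD1 i) //= big1 ?addr0 -?jE // => k ki.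
  suff -> : cf k a = 0 by rewrite scale0r.
  apply/eqP; rewrite eq_le Qp_cf_ge0 // andbT -oppr_ge0.
  have := Qp_cf_ge0 k Qm; rewrite cfD cfN cfZ cf_simple (negPf ki) mulr0 add0r.
  by [].
exists n; have mE' : m%:R = M%:R - n%:R :> F.
  by rewrite -mE -[_ *: 1]/(_ * 1) mulr1.
move: Qm; rewrite mE'.
have -> : M%:R *: - Th - a + (M%:R - n%:R) *: Th = - (a + n%:R *: Th).
  by rewrite scalerN scalerBl opprD !addrA [LHS](ACl (1*3*2*4)) /= addNr add0r.
move=> Qm; have /eqP := Qp_anti Qn Qm; rewrite addr_eq0 => /eqP ->.
congr (_, _, _); first by rewrite scalerN.
- by rewrite -[_ *: 0]/(_ * 0) mulr0.
- by rewrite -[_ *: 1]/(_ * 1) mulr1.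
Qed.

Definition apos (f : A) := exists b x n, [/\ f = am x n, root_space b x, x != 0 &
  (b = 0 \/ is_root b) /\ 0 < n \/ n = 0 /\ is_root b /\ Qp b].

Lemma affine_nplus_decomp (p : A) : affine_nplus T p ->
  exists2 s : seq A, forall f, f \in s -> apos f & p = \sum_(f <- s) f.
Proof.
case: p => [[x c] d] [/= xn x0 -> ->].
pose Q (q : A) := exists2 s : seq A, forall f, f \in s -> apos f & q = \sum_(f <- s) f.
have Q0 : Q 0 by exists [::] => //; rewrite big_nil.
have QD q q' : Q q -> Q q' -> Q (q + q').
  move=> [s sP ->] [s' sP' ->]; exists (s ++ s'); last by rewrite big_cat.
  by move=> f; rewrite mem_cat => /orP[/sP|/sP'].
have Q1 f : apos f -> Q f.
  by move=> pf; exists [:: f]; rewrite ?big_seq1 // => f'; rewrite inE => /eqP->.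
have -> : (x, 0, 0) = \sum_(n <- msupp x) am (x@_n) n :> A.
  rewrite {1}[x]loopE; elim/big_rec2: _ => [//|n u v _ <-].
  by apply: affineP; rewrite /= ?addr0.
rewrite -/(Q _); apply: (big_ind Q) => // n _.
have [n0|n0|->] := ltgtP n 0.
- by rewrite xn // am0.
- have [s sP ->] := root_decomp T x@_n; rewrite am_sum big_seq.
  apply: (big_ind Q) => // q qs; case: (eqVneq q.2 0) => [->|q0]; first by rewrite am0.
  apply: Q1; exists q.1, q.2, n; split=> //; [exact: sP|left; split=> //].
  case: (eqVneq q.1 0) => [->|q10]; [by left|right; split=> //].
  by exists q.2 => //; apply: sP.
have [s sP ->] := x0; rewrite am_sum big_seq; apply: (big_ind Q) => // z zs.
have [b [rb Qb bz]] := sP z zs; case: (eqVneq z 0) => [->|z0]; first by rewrite am0.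
by apply: Q1; exists b, z, 0; split=> //; right.
Qed.

Lemma apos_weight b (n : int) : (b = 0 \/ is_root b) /\ 0 < n \/ n = 0 /\ is_root b /\ Qp b ->
  Qa (b, 0, n%:~R).
Proof.
case=> [[rb]|[-> [_ Qb]]]; last exact: Qa_finite.
by case: n => // -[//|n] _; apply: Qa_imag.
Qed.

Lemma aneg_weight (f : A) : aneg T f -> exists ga, awt ga f /\ Qa (- ga).
Proof.
move=> [b [x [n [-> bx rb bn]]]]; exists (b, 0, n%:~R); split; first exact: awt_am.
have -> : - (b, 0, n%:~R) = (- b, 0, (- n)%:~R) :> affwt T.
  by congr (_, _, _); rewrite ?oppr0 // mulrNz.
apply: apos_weight; case: bn => [n0|[n0 [rb' Qb]]].
  by left; split; [apply: root_oppE|rewrite oppr_gt0].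
by right; rewrite n0 oppr0; split=> //; split=> //; apply: (is_rootN simp norm).
Qed.

Lemma affine_borel_split (p : A) : affine_borel T p ->
  exists y q, affine_nplus T q /\ p = tor y + q.
Proof.
case: p => [[x c] d] [/= xn [y [z [nz x0]]]].
exists (y, c, d), (x - tmon (vsval y) 0, 0, 0); split.
  have cE n : (x - tmon (vsval y) 0)@_n = x@_n - (tmon (vsval y) 0)@_n.
    exact: (@mcoeffB _ _ n (x : {malg g[int]}) (tmon (vsval y) 0)).
  split=> //= [n n0|]; rewrite cE coef_tmon; last by rewrite x0 eqxx mulr1n addrC addKr.
  by rewrite xn // gt_eqF // mulr0n subr0.
by apply: affineP; rewrite /= ?addr0 // addrC subrK.
Qed.

Variables (V : lmodType F) (rho : lieRep A V).
Local Notation awv := (wvec (fun t => rho (tor t)) (@affwt_eval F g T)).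

Lemma highest_borel mu u p : awv mu u -> (forall q, affine_nplus T q -> rho q u = 0) ->
  affine_borel T p -> exists c : F, rho p u = c *: u.
Proof.
move=> wu pu /affine_borel_split[y [q [nq ->]]].
rewrite repDl (pu q nq) addr0 wu; by exists (affwt_eval mu y).
Qed.

Hypothesis irr : irreducible_rep rho.

Lemma irr_full (S : {pred V}) u : submod_closed S -> (forall q v, v \in S -> rho q v \in S) ->
  u \in S -> u != 0 -> forall v, v \in S.
Proof.
move=> Ssub Sact uS u0 v; have [_ /(_ S Ssub Sact)[S0|]] := irr; last exact.
by rewrite (S0 u) ?eqxx in u0.
Qed.

(** Irreducibility and the triangular decomposition give V = U(n^-) u, where n^- only lowers
    weights. *)
Lemma highest_weights mu u : u != 0 -> awv mu u ->
  (forall q, affine_nplus T q -> rho q u = 0) ->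
  forall nu w, w != 0 -> awv nu w -> Qa (mu - nu).
Proof.
move=> u0 wu pu nu w w0 wnu.
have all_U : w \in Uspan rho (aneg T (B:=B)) u.
  apply: (irr_full (Uspan_closed _ _ _) _ (Uspan_refl _ _ _) u0) => q v vU.
  have tri (q' : A) : True -> exists (s : seq A) p,
      [/\ forall f, f \in s -> aneg T f, affine_borel T p & q' = \sum_(f <- s) f + p].
    by move=> _; apply: affine_tri_decomp.
  apply: (Uspan_triangular tri _ _ _ vU) => // p /(highest_borel wu pu)[c ->].
  exact: (submodZ (Uspan_closed _ _ _) _ (Uspan_refl _ _ _)).
apply: (@weight_sum_wvec _ _ _ tor _ (@affwt_eval F g T) (@affwt_eval_inj F g T) _ rho
  (fun nu => Qa (mu - nu)) nu w w0 wnu).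
apply: (@Uspan_weight_sum _ _ _ tor _ (@affwt_eval F g T) (@affwt_evalD F g T) _ rho
  (aneg T (B:=B)) (fun nu => Qa (mu - nu)) mu u wu _ _ _ all_U); first by rewrite subrr; apply: Qa0.
move=> f /aneg_weight[ga [wf Qga]]; exists ga; split=> // nu' Qn.
by rewrite opprD addrA; apply: QaD.
Qed.

End AffineWeights.

(** * Integrability and Weyl invariance of the weights *)

Section Integrability.
Variables (F : numFieldType) (g : fdLieAlgType F) (T : triangular g) (B : inv_form g).
Local Notation H := (subvs_of (cartan T)).
Local Notation dual := 'Hom(H, F^o).
Local Notation alpha := (tnth (simple_roots T)).
Local Notation Qp := (in_Qplus (simple_roots T)).
Local Notation Th := (highest_root T).
Local Notation A := (affine B).
Local Notation am := (am B).
Local Notation tor := (tor (T := T) B).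
Hypothesis simp : simple_lie g.
Hypothesis norm : normalized T B.
Implicit Types (b : dual) (i : option 'I_(rank T)) (mu : affwt T).

(** Writing alpha_i = [fin_root i] + [deg i] delta treats alpha_0 together with the finite simple
    roots. *)
Definition fin_root i : dual := if i is Some j then alpha j else - Th.
Definition deg i : nat := if i is Some _ then 0 else 1.

Lemma fin_rootP i : is_root (fin_root i).
Proof.
case: i => [j|]; first exact: root_simple.
exact/(is_rootN simp norm)/is_root_Th.
Qed.

Lemma affine_rootE i : affine_root i = (fin_root i, 0, (deg i)%:R).
Proof. by case: i. Qed.

Lemma coroot_opp_highest : coroot (- Th) = - coroot Th.
Proof.
have [cT _] := corootP simp norm (is_root_Th T simp).
apply: (coroot_unique simp norm (k := 1) (fin_rootP None)).
  by rewrite nuN norm scale1r.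
by rewrite opp_lfunE linearN opprK.
Qed.

Lemma affine_corootE i : affine_coroot i = (coroot (fin_root i), (deg i)%:R, 0).
Proof. by case: i => // ; rewrite /affine_coroot /fin_root coroot_opp_highest. Qed.

Lemma affine_coroot_root i : affwt_eval (affine_root i) (affine_coroot i) = 2.
Proof.
have [c2 _] := corootP simp norm (fin_rootP i).
by rewrite affine_rootE affine_corootE /affwt_eval /= c2 mul0r mulr0 !addr0.
Qed.

(** e = x t^deg and f = y t^(-deg), with x, y, [x, y] an sl2-triple for the finite root. The last
    clause says that e is, up to scalars, the only positive root vector whose weight is a multiple
    of alpha_i. *)
Lemma affine_triple i : exists e f : A,
  [/\ awt (affine_root i) e, awt (- affine_root i) f, lie e f = tor (affine_coroot i),
      (forall a, exists N, iter N (lie e) a = 0) /\ (forall a, exists N, iter N (lie f) a = 0)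
    & affine_nplus T e /\ forall b x (n : int) (j : nat), root_space b x -> x != 0 ->
      (b = 0 \/ is_root b) /\ 0 < n \/ n = 0 /\ is_root b /\ Qp b ->
      (b, 0, n%:~R) = (j%:R : F) *: affine_root i -> exists c : F, am x n = c *: e].
Proof.
have ra := fin_rootP i; have [a0 [x x0 ax]] := ra.
have [y ay xy] := sl2_triple simp norm ra ax x0.
have na0 : - fin_root i != 0 by rewrite oppr_eq0.
exists (am x (deg i)), (am y (- (deg i)%:Z)); split.
- by rewrite affine_rootE; apply: awt_am.
- have -> : - affine_root i = (- fin_root i, 0, (- (deg i)%:Z)%:~R).
    by rewrite affine_rootE; congr (_, _, _); rewrite ?oppr0 // mulrNz.
  exact: awt_am.
- rewrite lie_am subrr eqxx affine_corootE xy; congr (_, _, _).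
  have [->|iN] : deg i = 0%N \/ i = None by case: (i) => [j|]; [left|right].
    by rewrite mul0r.
  (* For alpha_0 the coefficient of K is B(x, y). It is 1 since [x, y] = B(x, y) (- Theta^v) by the
     normalization, and also [x, y] = - Theta^v. *)
  subst i; rewrite /= mul1r; have nuT : nu B (- coroot Th) = - Th by rewrite nuN norm.
  have := lie_opp_roots simp norm nuT ax ay; rewrite xy /= coroot_opp_highest => e.
  have [cT _] := corootP simp norm (is_root_Th T simp).
  have /eqP : (B x y - 1) *: (- coroot Th) = 0.
    by apply: (can_inj vsvalK); rewrite linear0 scalerBl scale1r linearB linearZ /= -e subrr.
  rewrite scaler_eq0 subr_eq0 oppr_eq0 => /orP[/eqP//|/eqP c0].
  by move: cT; rewrite c0 linear0 => /esym/eqP; rewrite pnatr_eq0.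
- by split; [apply: (am_nilpotent _ a0 ax)|apply: (am_nilpotent _ na0 ay)].
split.
  split=> //= [n n0|]; rewrite coef_tmon.
    by case: eqP => // nE; move: n0; rewrite -nE.
  have [[j iS]|->] : (exists j, i = Some j) \/ deg i = 1%N.
  - by case: (i) => [j|]; [left; exists j|right].
  - subst i; rewrite eqxx mulr1n; apply: (nplus_root ra _ ax); exact: Qp_simple.
  - exact: nplus0.
move=> b z n j bz z0 cond; rewrite affine_rootE => -[bE _ nE].
have nE' : n = (j * deg i)%N%:Z.
  by apply: (@intr_inj F); rewrite nE -[_ *: _]/(_ * _) -natrM pmulrn.
case: j => [|[|j]] in bE nE' {nE}.
- move: cond; rewrite bE nE' scale0r; case=> [[_]|[_ [[+ _] _]]]; first by rewrite ltxx.
  by rewrite eqxx.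
- rewrite scale1r in bE; rewrite bE in bz; rewrite nE' mul1n.
  have [c ->] := root_space_line simp norm ra ax x0 bz.
  by exists c; rewrite amZ.
rewrite bE scaler_nat in bz.
by rewrite (root_multiple simp norm ra bz) eqxx in z0.
Qed.

Variables (V : lmodType F) (rho : lieRep A V).
Local Notation awv := (wvec (fun t => rho (tor t)) (@affwt_eval F g T)).
Hypothesis irr : irreducible_rep rho.
Variables (L : affwt T) (v : V).
Hypotheses (v0 : v != 0) (wv : awv L v).
Hypothesis nv : forall q, affine_nplus T q -> rho q v = 0.
Hypothesis Lint : forall i, exists k : nat, affwt_eval L (affine_coroot i) = k%:R.

(** By [nilpotent_act] the vectors on which f is nilpotent form a submodule, and it contains v. *)
Lemma loc_nilpotent (f : A) N : (forall a, exists N, iter N (lie f) a = 0) ->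
  iter N (rho f) v = 0 -> forall w, exists N, iter N (rho f) w = 0.
Proof.
move=> fnil fv w.
pose S (w : V) := exists N, iter N (rho f) w = 0.
have Ssub : submod_closed (fun w => `[< S w >] : bool).
  apply: asbool_submod => [|c u u' [N1 N1u] [N2 N2u]]; first by exists 0%N.
  exists (N1 + N2)%N; rewrite iter_repD iter_repZ (iter_rep0_le (leq_addr N2 N1) N1u).
  by rewrite (iter_rep0_le (leq_addl N1 N2) N2u) scaler0 addr0.
apply/asboolP.
apply: (irr_full irr Ssub _ _ v0); last by apply/asboolP; exists N.
move=> q u /asboolP[N1 N1u]; apply/asboolP; have [N2 N2q] := fnil q.
by exists (N2 + N1)%N; apply: nilpotent_act.
Qed.

(** Suppose u = f^(k+1) v <> 0. A positive root vector of weight ga not killing u makes (k + 1)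
    alpha_i - ga positive, so ga is a multiple of alpha_i and the vector a multiple of e; but e u =
    0. Hence u is another highest weight vector, and L <= L - (k + 1) alpha_i is absurd. *)
Lemma simple_f_nilpotent i (e f : A) (k : nat) :
  awt (affine_root i) e -> awt (- affine_root i) f -> lie e f = tor (affine_coroot i) ->
  affine_nplus T e ->
  (forall b x (n : int) (j : nat), root_space b x -> x != 0 ->
      (b = 0 \/ is_root b) /\ 0 < n \/ n = 0 /\ is_root b /\ Qp b ->
      (b, 0, n%:~R) = (j%:R : F) *: affine_root i -> exists c : F, am x n = c *: e) ->
  affwt_eval L (affine_coroot i) = k%:R -> iter k.+1 (rho f) v = 0.
Proof.
move=> we wf ef ne line Lk; apply: contrapT => /eqP u0.
set u := iter k.+1 (rho f) v in u0.
have hf : lie (tor (affine_coroot i)) f = -2 *: f.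
  by rewrite wf (evN (@affwt_evalZ F g T)) affine_coroot_root.
have wu : awv (L + (- affine_root i) *+ k.+1) u.
  exact: (wvec_iter (@affwt_evalD F g T) k.+1 wf wv).
have {}wu : awv (L - k.+1%:R *: affine_root i) u.
  by rewrite scaler_nat -mulNrn.
have eu : rho e u = 0.
  have hv : rho (tor (affine_coroot i)) v = k%:R *: v by rewrite wv Lk.
  by rewrite (sl2_efn ef hf k hv) subrr mulr0 scale0r addr0 (nv ne) iter_rep0.
have pu q : affine_nplus T q -> rho q u = 0.
  move=> /affine_nplus_decomp[s sP ->]; rewrite rep_suml big_seq big1 // => f' fs.
  have [b [x [n [-> bx x0 cond]]]] := sP f' fs.
  apply: contrapT => /eqP fu0; have wf' := awt_am B n bx.
  have wfu := wvec_act (@affwt_evalD F g T) wf' wu.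
  have := highest_weights simp norm irr v0 wv nv fu0 wfu.
  rewrite opprD opprB addrA addrCA subrr addr0 => Q2.
  have [j jE] := Qa_multiple (apos_weight simp norm cond) Q2.
  have [c cE] := line b x n j bx x0 cond jE.
  by rewrite cE repZl eu scaler0 eqxx in fu0.
have := highest_weights simp norm irr u0 wu pu v0 wv.
rewrite addrAC subrr add0r => Qn.
have Q1 := QaZ k.+1 (Qa_affine_root simp norm i).
have /eqP := Qa_anti Q1 Qn; rewrite scaler_eq0 pnatr_eq0 /=.
by apply/negP/affine_root_neq0.
Qed.

Definition is_weight mu := exists2 u, u != 0 & awv mu u.

Lemma is_weight_le mu : is_weight mu -> Qa (L - mu).
Proof. by move=> [u u0 wu]; apply: (highest_weights simp norm irr v0 wv nv u0 wu). Qed.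

Lemma is_weight_weyl w mu : is_weight mu -> is_weight (affine_weyl w mu).
Proof.
move=> wmu; elim: w => //= i w [u u0 wu].
have [e [f [we wf ef [enil fnil] [ne line]]]] := affine_triple i.
have [k Lk] := Lint i.
have ev0 : iter 1 (rho e) v = 0 by rewrite /= nv.
have fv0 := simple_f_nilpotent we wf ef ne line Lk.
have [_ [_ [u' u'0 wu']]] := weight_reflect (@affwt_evalD F g T) (@affwt_evalZ F g T)
  we wf ef (affine_coroot_root i) (loc_nilpotent enil ev0) (loc_nilpotent fnil fv0) u0 wu.
by exists u'.
Qed.

Lemma affine_weylDZ w (c : F) mu nu' :
  affine_weyl w (mu + c *: nu') = affine_weyl w mu + c *: affine_weyl w nu'.
Proof.
elim: w => //= i w ->; rewrite affwt_evalD affwt_evalZ scalerDl opprD scalerBr.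
by rewrite addrACA scalerA.
Qed.

Lemma affine_weyl0 w : affine_weyl w 0 = 0 :> affwt T.
Proof.
by have := affine_weylDZ w (-1) 0 0; rewrite scaler0 addr0 scaleN1r addrN => ->.
Qed.

Lemma affine_weyl_revK w mu : affine_weyl (rev w) (affine_weyl w mu) = mu.
Proof.
elim: w mu => // i w ih mu; rewrite rev_cons -cats1 /affine_weyl foldr_cat.
rewrite -/(affine_weyl _ _) -[RHS]ih; congr (affine_weyl _ _) => /=.
rewrite -/(affine_weyl w mu); move: (affine_weyl w mu) => nu'.
set r := affwt_eval nu' (affine_coroot i).
have -> : affwt_eval (nu' - r *: affine_root i) (affine_coroot i) = - r.
  by rewrite -scaleNr affwt_evalD affwt_evalZ affine_coroot_root -/r; ring.
by rewrite scaleNr opprK subrK.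
Qed.

(* If f v <> 0, then L - beta and L + (k + 1) beta are both weights, where
   beta = w^-1(alpha_i), although all weights are <= L. *)
Lemma extremal_lowering w j (k : nat) x u : u != 0 -> awv (affine_weyl w L) u ->
  affwt_eval (affine_weyl w L) (affine_coroot (Some j)) = - k%:R ->
  root_space (- alpha j) x -> rho (am x 0) u = 0.
Proof.
move=> u0 wu uk ax; apply: contrapT => /eqP fu0.
pose al := affine_root (Some j); pose be := affine_weyl (rev w) al.
have wf := awt_am B 0 ax.
have W1 : is_weight (affine_weyl w L + (-1) *: al).
  exists (rho (am x 0) u) => //; have := wvec_act (@affwt_evalD F g T) wf wu.
  by rewrite scaleN1r; congr (wvec _ _ (_ + _) _); congr (_, _, _); rewrite ?oppr0.
(* w(L) - alpha_j takes the value - k - 2 on the coroot, so s_j adds (k + 2) alpha_j to it. *)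
have W2 : is_weight (affine_weyl w L + k.+1%:R *: al).
  have := is_weight_weyl [:: Some j] W1; rewrite /= -/al affwt_evalD affwt_evalZ uk.
  rewrite -/(affine_coroot (Some j)) affine_coroot_root; congr (is_weight _).
  rewrite -addrA -scaleNr -scalerDl; congr (_ + _ *: _).
  rewrite -natr1; ring.
have := is_weight_le (is_weight_weyl (rev w) W1).
have := is_weight_le (is_weight_weyl (rev w) W2).
rewrite !affine_weylDZ !affine_weyl_revK -/be !opprD !addrA !subrr !add0r scaleN1r opprK.
move=> Q2 Q1; have /eqP := Qa_anti (QaZ k.+1 Q1) Q2.
rewrite scaler_eq0 pnatr_eq0 /= => /eqP be0.
have := affine_weyl_revK (rev w) al; rewrite revK -/be be0 affine_weyl0 => /esym/eqP.
by apply/negP/affine_root_neq0.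
Qed.

End Integrability.

(** * Demazure modules *)

Section DemazureStability.
Variables (F : numFieldType) (g : fdLieAlgType F) (T : triangular g) (B : inv_form g).
Local Notation H := (subvs_of (cartan T)).
Local Notation dual := 'Hom(H, F^o).
Local Notation alpha := (tnth (simple_roots T)).
Local Notation Qp := (in_Qplus (simple_roots T)).
Local Notation Th := (highest_root T).
Local Notation A := (affine B).
Local Notation am := (am B).
Local Notation tor := (tor (T := T) B).
Hypothesis simp : simple_lie g.
Hypothesis norm : normalized T B.
Implicit Types (a b : dual) (x y z : g) (p q : A).

Lemma root_sub_simple b j : is_root b -> Qp b -> b != alpha j -> is_root (b - alpha j) ->
  Qp (b - alpha j).
Proof.
move=> rb Qb bj /root_pos_neg[//|]; rewrite opprB => Qn.
have bE : b = cf j b *: alpha j.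
  rewrite {1}(QpE Qb) (bigD1 j) //= big1 ?addr0 // => k kj.
  suff -> : cf k b = 0 by rewrite scale0r.
  apply/eqP; rewrite eq_le Qp_cf_ge0 // andbT -oppr_ge0.
  by have := Qp_cf_ge0 k Qn; rewrite cfD cfN cf_simple (negPf kj) add0r.
have := Qp_cf_ge0 j Qn; rewrite cfD cfN cf_simple eqxx subr_ge0.
have [n nE] := Qp_cf j Qb; rewrite nE in bE *; rewrite lern1.
case: n => [|[|//]] in bE {nE} * => _.
  by have [b0 _] := rb; rewrite bE scale0r eqxx in b0.
by rewrite bE scale1r eqxx in bj.
Qed.

Variables (V : lmodType F) (rho : lieRep A V) (v : V).
Local Notation awv := (wvec (fun t => rho (tor t)) (@affwt_eval F g T)).
Local Notation Dm := (Uspan rho (affine_borel T (B := B)) v).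
Hypothesis lowv : forall j y, root_space (- alpha j) y -> rho (am y 0) v = 0.

(** The affine Borel and f_j form a minimal parabolic: [f_j, b^] lies in b^ + C f_j. As f_j kills v,
    [Uspan_triangular] applies with b^ as [N] and the multiples of f_j as [P]. *)
Lemma demazure_simple_stable j y u :
  root_space (- alpha j) y -> u \in Dm -> rho (am y 0) u \in Dm.
Proof.
move=> ay uD.
pose par p := exists q (c : F), affine_borel T q /\ p = q + c *: am y 0.
have parD p q : par p -> par q -> par (p + q).
  move=> [p' [c [bp ->]]] [q' [d [bq ->]]]; exists (p' + q'), (c + d).
  by rewrite scalerDl addrACA; split=> //; apply: affine_borelD.
have parb p : affine_borel T p -> par p.
  by move=> bp; exists p, 0; rewrite scale0r addr0.
have par0 : par 0 by apply/parb/(affine_borel_cd T B 0 0).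
have comm q : affine_borel T q -> par (lie (am y 0) q).
  move=> /affine_borel_split[t [q' [nq ->]]]; rewrite lieDr; apply: (parD).
    rewrite (lieC (am y 0)) (awt_am B 0 ay t) -scaleNr.
    exists 0, (- affwt_eval (- alpha j, 0, 0%:~R) t).
    by rewrite add0r; split=> //; apply: (affine_borel_cd T B 0 0).
  have [s sP ->] := affine_nplus_decomp nq; rewrite lie_sumr big_seq.
  apply: (big_ind par) => [|p p'|f fs]; [exact: par0|exact: parD|]; have [b [x [n [-> bx x0 cond]]]] := sP f fs.
  case: n cond => [n|n] cond; last by case: cond => [[]|[]].
  rewrite (lie_am_nonneg B y x 0 n) add0n; apply: parb.
  case: cond => [[_ n0]|[n0 [rb Qb]]].
    by apply: affine_borel_am => // n0'; move: n0; rewrite n0' ltxx.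
  apply: affine_borel_am => // _.
  have bw := root_space_lie ay bx; rewrite addrC in bw.
  case: (eqVneq (lie y x) 0) => [->|yx0]; first exact: borel_nplus (nplus0 T).
  case: (eqVneq b (alpha j)) => [bj|bj].
    move: bw; rewrite bj subrr => /root_space0P wh.
    by rewrite -(vsprojK wh); apply: borel_cartan.
  apply: borel_nplus; have rw : is_root (b - alpha j).
    by split; [rewrite subr_eq0|exists (lie y x)].
  exact: nplus_root rw (root_sub_simple rb Qb bj rw) bw.
have dec p : par p -> exists (s : seq A) q, [/\ forall f, f \in s -> affine_borel T f,
    exists c : F, q = c *: am y 0 & p = \sum_(f <- s) f + q].
  move=> [q [c [bq ->]]]; exists [:: q], (c *: am y 0); rewrite big_seq1; split=> //.
    by move=> f; rewrite inE => /eqP->.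
  by exists c.
apply: (Uspan_triangular dec _ _ _ uD).
- move=> p f [c ->] bf; rewrite lieZl; have [q [d [bq ->]]] := comm f bf.
  exists (c *: q), (c * d); rewrite scalerDr scalerA; split=> //.
  have [q1 q2] := bq; split=> [n n0|] /=; rewrite loop_coefZ; first by rewrite q1 ?scaler0.
  have [h [z [[s sP ->] ->]]] := q2; exists (c *: h), (c *: \sum_(i <- s) i).
  rewrite scalerDr linearZ; split=> //; exists [seq c *: i | i <- s].
    move=> _ /mapP[w ws ->]; have [b [rb Qb bw]] := sP w ws.
    by exists b; split=> //; apply: root_spaceZ.
  by rewrite big_map scaler_sumr.
- by move=> p [c ->]; rewrite repZl (lowv ay) scaler0; apply: submod0 (Uspan_closed _ _ _).
by exists 0, 1; rewrite add0r scale1r; split=> //; apply: (affine_borel_cd T B 0 0).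
Qed.

(** With n = b(alpha_i^v), the vector w = e^n y has weight - s_i b, so it preserves D by induction.
    Now f^n w is nonzero of weight - b, hence spans the line of y, and it is an iterated bracket of
    f and w, which both preserve D. *)
Lemma demazure_neg_stable b : is_root b -> Qp b -> forall y u,
  root_space (- b) y -> u \in Dm -> rho (am y 0) u \in Dm.
Proof.
move=> rb Qb; move: b rb Qb; apply: (pos_root_ind simp norm).
  by move=> i y u ay; apply: demazure_simple_stable ay.
move=> i b rb Qb rr Qr bi b0 ih y u ay uD.
have Dsub := Uspan_closed rho (affine_borel T (B := B)) v.
case: (eqVneq y 0) => [->|y0]; first by rewrite am0 rep0l; apply: submod0.
have ri := root_simple i; have [a0 [e e0 ae]] := ri.
have na0 : - alpha i != 0 by rewrite oppr_eq0.
have [f af ef] := sl2_triple simp norm ri ae e0.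
have [c2 _] := corootP simp norm ri.
have [n nE] : exists n : nat, b (coroot (alpha i)) = n%:R.
  have [[n|n] nE] := coroot_int simp norm ri rb; first by exists n; rewrite nE pmulrn.
  by move: b0; rewrite nE ltr0z.
have he : lie (vsval (coroot (alpha i))) e = 2 *: e by rewrite ae c2.
have hf : lie (vsval (coroot (alpha i))) f = -2 *: f by rewrite af opp_lfunE c2.
have fe : lie f e = - vsval (coroot (alpha i)) by rewrite lieC ef.
have hf' : lie (- vsval (coroot (alpha i))) f = 2 *: f by rewrite lieNl hf scaleNr opprK.
have he' : lie (- vsval (coroot (alpha i))) e = -2 *: e by rewrite lieNl he scaleNr.
have hy : lie (vsval (coroot (alpha i))) y = (- n%:R) *: y by rewrite ay opp_lfunE nE.
have hy' : lie (- vsval (coroot (alpha i))) y = n%:R *: y by rewrite lieNl hy scaleNr opprK.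
pose w := iter n (lie e) y.
have wr : root_space (- refl (alpha i) b) w.
  have := wvec_iter (rho := ad_rep g) (tor := vsval) (@dual_evD F g T) n ae ay.
  by rewrite /refl nE scaler_nat opprB addrC.
have [N1 N1y] := root_vector_nilpotent na0 af y.
have w0 : w != 0.
  by apply: contra_neq y0 => wz; apply: (sl2_inj (rho := ad_rep g) fe hf' he' hy' N1y wz).
have hw : lie (vsval (coroot (alpha i))) w = n%:R *: w.
  rewrite wr opp_lfunE add_lfunE opp_lfunE scale_lfunE c2 nE -[_ *: 2]/(_ * 2).
  congr (_ *: _); ring.
have [N2 N2w] := root_vector_nilpotent a0 ae w.
have fw0 : iter n (lie f) w != 0.
  by apply: contra_neq w0 => wz; apply: (sl2_inj (rho := ad_rep g) ef he hf hw N2w wz).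
have fwr : root_space (- b) (iter n (lie f) w).
  have := wvec_iter (rho := ad_rep g) (tor := vsval) (@dual_evD F g T) n af wr.
  by rewrite /refl nE scaler_nat opprB mulNrn addrAC subrr add0r.
have [c ->] := root_space_line simp norm (is_rootN simp norm rb) fwr fw0 ay.
rewrite amZ repZl; apply: submodZ => //; move: u uD; elim: (n) => [|m ihm] u uD.
  exact: ih.
have -> : am (iter m.+1 (lie f) w) 0 = lie (am f 0) (am (iter m (lie f) w) 0).
  by rewrite (lie_am_nonneg B f _ 0 0).
rewrite rep_lie; apply: submodB => //.
  by apply: (demazure_simple_stable af); apply: ihm.
by apply: ihm; apply: (demazure_simple_stable af).
Qed.

Lemma demazure_current_stable x (n : nat) u : u \in Dm -> rho (am x n) u \in Dm.
Proof.
move=> uD; have Dsub := Uspan_closed rho (affine_borel T (B := B)) v.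
case: n => [|n]; last by apply: Uspan_act => //; apply: affine_borel_am.
have [s [p [sP bp ->]]] := tri_decomp T x; rewrite amD repDl; apply: submodD => //.
  rewrite am_sum rep_suml; apply: submod_sum => // f fs _.
  have [b [rb Qb bf]] := sP f fs.
  by apply: (demazure_neg_stable (b := - b)); rewrite ?opprK //; apply: (is_rootN simp norm).
by apply: Uspan_act => //; apply: affine_borel_am.
Qed.

Variable mu : affwt T.
Hypothesis wv : awv mu v.

Definition current_root (q : A) := exists b x (n : nat), q = am x n /\ root_space b x.

(** K and d act on v by scalars and only rescale the vectors x t^n, so they can be moved to v and
    absorbed. *)
Lemma demazure_current_span u : u \in Dm -> u \in Uspan rho current_root v.
Proof.
pose cur q := exists (s : seq A) p, [/\ forall f, f \in s -> current_root f,
  exists c d, p = acd B c d & q = \sum_(f <- s) f + p].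
have curD p q : cur p -> cur q -> cur (p + q).
  move=> [s [_ [sP [c [d ->]] ->]]] [s' [_ [s'P [c' [d' ->]] ->]]].
  exists (s ++ s'), (acd B c d + acd B c' d'); rewrite big_cat addrACA; split=> //.
    by move=> f; rewrite mem_cat => /orP[/sP|/s'P].
  by exists (c + c'), (d + d'); apply: affineP; rewrite /= ?addr0.
have cur1 x (n : nat) : cur (am x n).
  have [s sP ->] := root_decomp T x; exists [seq am r.2 n | r <- s], (acd B 0 0); split.
  - by move=> _ /mapP[r rs ->]; exists r.1, r.2, n; split=> //; apply: sP.
  - by exists 0, 0.
  by rewrite am_sum big_map addr0.
have cur_cd c d : cur (acd B c d).
  by exists [::], (acd B c d); rewrite big_nil add0r; split=> //; exists c, d.
have curb q : affine_borel T q -> cur q.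
  case: q => [[x c] d] [/= xn _].
  have -> : (x, c, d) = \sum_(n <- msupp x) am (x@_n) n + acd B c d :> A.
    have -> : \sum_(n <- msupp x) am (x@_n) n = (x, 0, 0) :> A.
      rewrite {3}[x]loopE; elim/big_rec2: _ => [//|n u' w _ ->].
      by apply: affineP; rewrite /= ?addr0.
    by apply: affineP; rewrite /= ?addr0 ?add0r.
  apply: (curD); last exact: cur_cd.
  apply: (big_ind cur) => [|p p'|n _]; [exact: (cur_cd 0 0)|exact: curD|].
  by case: n => [n|n] //; rewrite xn // am0; apply: (cur_cd 0 0).
apply: Uspan_min; [exact: Uspan_closed|exact: Uspan_refl|].
move=> q w /curb cq; apply: (Uspan_triangular (A := cur) (P := fun p => exists c d, p = acd B c d)) => //.
  move=> p f [c [d ->]] [b [x [n [-> bx]]]]; rewrite lieC lie_am_cd scaleNr opprK -amZ.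
  exact: cur1.
move=> p [c [d ->]]; have -> : acd B c d = tor (0, c, d).
  by rewrite /tor /= tmon0.
rewrite wv; apply: submodZ; [exact: Uspan_closed|exact: Uspan_refl].
Qed.

Hypothesis v0 : v != 0.
Variable L : affwt T.
Hypothesis wle : forall nu w, w != 0 -> awv nu w -> Qa (L - nu).

(** On U(g[t])v the eigenvalue of d starts at that of v and only grows, while L bounds it; N is the
    difference of L and mu in the delta coordinate. *)
Lemma demazure_degree_bound : exists N : nat, forall x (n : nat) u,
  (N < n)%N -> u \in Dm -> rho (am x n) u = 0.
Proof.
have [_ [N [NE _]]] := wle v0 wv; exists N => x n u Nn /demazure_current_span uC.
pose P (nu : affwt T) := exists m : nat, nu.2 = mu.2 + m%:R.
have [||s sP ->] := @Uspan_weight_sum _ _ _ tor _ (@affwt_eval F g T) (@affwt_evalD F g T) _ rho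
  current_root P mu v wv _ _ u uC.
- by exists 0%N; rewrite addr0.
- move=> f [b [y [m [-> bY]]]]; exists (b, 0, m%:R); split; first exact: (awt_am B m bY).
  by move=> nu [k kE]; exists (k + m)%N; rewrite /= kE natrD addrA.
rewrite rep_sumr big_seq big1 // => q qs; have [[m mE] wq] := sP q qs.
have [t tP ->] := root_decomp T x; rewrite am_sum rep_suml big_seq big1 // => r rt.
have br := tP r rt; apply: contrapT => /eqP nz.
have := wle nz (wvec_act (@affwt_evalD F g T) (awt_am B n br) wq).
move=> [_ [k [/= kE _]]]; move: kE; rewrite mE => kE.
have : (N%:R : F) = (m + n + k)%:R.
  by rewrite -NE !natrD -kE /= -[n%:~R]/(n%:R); ring.
by move/eqP; rewrite eqr_nat => /eqP NmE; lia.
Qed.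

End DemazureStability.

(** * Integer powers of 1 + t *)

Section BinomialSeries.
Variable F : numFieldType.
Implicit Types (f h : nat -> F) (n m : int).

(** Power series are coefficient sequences: [times1t] multiplies by 1 + t, [div1t] divides by it,
    and [pow1t n] multiplies by (1 + t)^n. [Negz k] is - (k + 1), hence [k.+1] divisions. *)
Definition times1t f k : F := f k + (if k is j.+1 then f j else 0).
Fixpoint div1t f k : F := if k is j.+1 then f k - div1t f j else f 0%N.
Definition pow1t n f : nat -> F :=
  match n with Posz k => iter k times1t f | Negz k => iter k.+1 div1t f end.
Definition one_ser (k : nat) : F := (k == 0%N)%:R.

(* binz n k is the coefficient of t^k in (1 + t)^n. *)
Definition binz n : nat -> F := pow1t n one_ser.
Definition cauchy f h k : F := \sum_(i < k.+1) f i * h (k - i)%N.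

Lemma div1tK : cancel div1t times1t.
Proof. by move=> f; apply: funext; case=> [|k]; rewrite /times1t /= ?addr0 ?subrK. Qed.

Lemma times1tK : cancel times1t div1t.
Proof.
move=> f; apply: funext; elim=> [|k ih]; rewrite /times1t /= ?addr0 //.
by rewrite -/(times1t f) ih addrK.
Qed.

Lemma pow1tS n f : pow1t (n + 1) f = times1t (pow1t n f).
Proof.
case: n => [n|[|n]]; first by rewrite -PoszD addn1.
  by rewrite /= div1tK.
have -> : Negz n.+1 + 1 = Negz n by rewrite !NegzE; lia.
by rewrite /= div1tK.
Qed.

Lemma pow1t_ind (P : int -> Prop) : P 0 -> (forall n, P n -> P (n + 1)) ->
  (forall n, P (n + 1) -> P n) -> forall n, P n.
Proof.
move=> P0 PS PP; elim/int_ind => [//|n /PS|n Pn]; first by rewrite -PoszD addn1.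
by apply: PP; rewrite (_ : - n.+1%:Z + 1 = - n%:Z) //; lia.
Qed.

Lemma cauchy_times f h : cauchy (times1t f) h = times1t (cauchy f h).
Proof.
apply: funext => -[|k]; rewrite /times1t /cauchy.
  by rewrite !big_ord1 /= !addr0.
under eq_bigr => i _ do rewrite mulrDl.
rewrite big_split; congr (_ + _); rewrite big_ord_recl /= mul0r add0r.
by apply: eq_bigr => i _; rewrite /= /bump add1n subSS.
Qed.

Lemma cauchy_pow1t n f h : cauchy (pow1t n f) h = pow1t n (cauchy f h).
Proof.
elim/pow1t_ind: n => [//|n ih|n ih]; first by rewrite !pow1tS cauchy_times ih.
by apply: (can_inj times1tK); rewrite -cauchy_times -!pow1tS.
Qed.

Lemma cauchy_one h : cauchy one_ser h = h.
Proof.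
apply: funext => k; rewrite /cauchy big_ord_recl subn0 mul1r big1 ?addr0 // => i _.
by rewrite mul0r.
Qed.

(** Vandermonde convolution for integer exponents, from the fact that multiplication by 1 + t
    commutes with the Cauchy product. *)
Lemma binzD n m : cauchy (binz n) (binz m) = binz (n + m).
Proof.
rewrite cauchy_pow1t cauchy_one; elim/pow1t_ind: n => [|n ih|n ih]; first by rewrite add0r.
  by rewrite pow1tS ih addrAC /binz pow1tS.
by apply: (can_inj times1tK); rewrite -pow1tS ih addrAC /binz pow1tS.
Qed.

(** Inductively, t^(k+1) = (1 + t) t^k - t^k. *)
Lemma binz_expand (k : nat) : exists s : seq (F * int),
  forall i, \sum_(p <- s) p.1 * binz p.2 i = (i == k)%:R.
Proof.
elim: k => [|k [s sE]]; first by exists [:: (1, 0)] => i; rewrite big_seq1 mul1r.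
exists ([seq (p.1, p.2 + 1) | p <- s] ++ [seq (- p.1, p.2) | p <- s]) => i.
rewrite big_cat !big_map /= -big_split /=.
under eq_bigr => p _ do rewrite /binz pow1tS /times1t mulNr mulrDr addrAC subrr add0r.
by case: i => [|i]; [rewrite big1 // => p _; rewrite mulr0|rewrite sE eqSS].
Qed.

(** The square i, j <= N contributes only its triangle i + j <= N. *)
Lemma truncated_cauchy (V : lmodType F) f h (X : nat -> V) N :
  (forall k, (N < k)%N -> X k = 0) ->
  \sum_(i < N.+1) \sum_(j < N.+1) (f i * h j) *: X (i + j)%N =
  \sum_(k < N.+1) cauchy f h k *: X k.
Proof.
move=> X0; under [RHS]eq_bigr => k _.
  rewrite /cauchy scaler_suml (big_ord_widen N.+1 (fun i => (f i * h (k - i)%N) *: X k)) //.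
  over.
rewrite [RHS](exchange_big_dep xpredT) //=; apply: eq_bigr => i _.
have iN : (i <= N.+1)%N by apply/ltnW/ltn_ord.
transitivity (\sum_(i <= k < N.+1) (f i * h (k - i)%N) *: X k).
  rewrite -[X in _ = \sum_(X <= _ < _) _]add0n big_addn -(big_mkord xpredT (fun j => (f i * h j) *: X (i + j)%N)).
  have Z : \sum_(N.+1 - i <= j < N.+1) (f i * h j) *: X (i + j)%N = 0.
    by rewrite big_nat big1 // => j /andP[ij _]; rewrite X0 ?scaler0 //; lia.
  rewrite (@big_cat_nat _ _ _ (N.+1 - i)) ?leq_subr //= Z addr0.
  by apply: eq_big_nat => j _; rewrite addnK addnC.
by rewrite big_geq_mkord; apply: eq_bigl => k; rewrite ltnS.
Qed.

End BinomialSeries.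

(** * The twisted action of the loop algebra *)

Section Twist.
Variables (F : numFieldType) (g : fdLieAlgType F) (B : inv_form g).
Variables (V : lmodType F) (rho : lieRep (affine B) V).
Variables (Ab : affine B -> Prop) (v : V) (N : nat).
Local Notation am := (am B).
Local Notation Dm := (Uspan rho Ab v).
Hypothesis Dstab : forall x (n : nat) u, u \in Dm -> rho (am x n) u \in Dm.
Hypothesis Dvan : forall x (n : nat) u, (N < n)%N -> u \in Dm -> rho (am x n) u = 0.

(** The series x (1 + t)^n cut at t^N, which makes sense on all of V; on D the omitted terms
    vanish. *)
Definition twist1 (x : g) (n : int) (u : V) : V :=
  \sum_(k < N.+1) binz F n k *: rho (am x k) u.

(* x t^n acts as x (1 + t)^n does under rho; 1 + t is invertible since t is nilpotent. *)
Definition twist (f : loop g) (u : V) : V := \sum_(n <- msupp f) twist1 f@_n n u.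

Lemma twist1_linl n c x y u : twist1 (c *: x + y) n u = c *: twist1 x n u + twist1 y n u.
Proof.
rewrite /twist1 scaler_sumr -big_split; apply: eq_bigr => k _.
by rewrite amD amZ repDl repZl scalerDr !scalerA mulrC.
Qed.

Lemma twist1_linr x n c u w : twist1 x n (c *: u + w) = c *: twist1 x n u + twist1 x n w.
Proof.
rewrite /twist1 scaler_sumr -big_split; apply: eq_bigr => k _.
by rewrite rep_linr scalerDr !scalerA mulrC.
Qed.

Lemma twist1_0 n u : twist1 0 n u = 0.
Proof. by rewrite /twist1 big1 // => k _; rewrite am0 rep0l scaler0. Qed.

Lemma twist_tmon x n u : twist (tmon x n) u = twist1 x n u.
Proof. by rewrite /twist (big_tmon (G := fun x n => twist1 x n u)) // => k; apply: twist1_0. Qed.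

Lemma twist_linl c x y u : twist (c *: x + y) u = c *: twist x u + twist y u.
Proof.
apply: (big_loopDZ (G := fun x n => twist1 x n u)) => n a x' y'.
exact: twist1_linl.
Qed.

Lemma twist_linr x c u w : twist x (c *: u + w) = c *: twist x u + twist x w.
Proof.
rewrite /twist scaler_sumr -big_split; apply: eq_bigr => n _.
exact: twist1_linr.
Qed.

Lemma twistDl x y u : twist (x + y) u = twist x u + twist y u.
Proof. by rewrite -[x]scale1r twist_linl !scale1r. Qed.
Lemma twistDr x u w : twist x (u + w) = twist x u + twist x w.
Proof. by rewrite -[u]scale1r twist_linr !scale1r. Qed.
Lemma twist0l u : twist 0 u = 0.
Proof. by apply: (addIr (twist 0 u)); rewrite -twistDl !add0r. Qed.
Lemma twist0r x : twist x 0 = 0.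
Proof. by apply: (addIr (twist x 0)); rewrite -twistDr !add0r. Qed.

Lemma twist_stable f u : u \in Dm -> twist f u \in Dm.
Proof.
move=> uD; have Dsub := Uspan_closed rho Ab v.
apply: submod_sum => // n _ _; apply: submod_sum => // k _ _.
by apply: submodZ => //; apply: Dstab.
Qed.

Lemma twist1_comp x y n m u : twist1 x n (twist1 y m u) =
  \sum_(i < N.+1) \sum_(j < N.+1) (binz F n i * binz F m j) *: rho (am x i) (rho (am y j) u).
Proof.
apply: eq_bigr => i _; rewrite rep_sumr scaler_sumr; apply: eq_bigr => j _.
by rewrite repZr scalerA.
Qed.

(** Expresses (1 + t)^n (1 + t)^m = (1 + t)^(n+m). It is claimed on D, where the terms of degree
    above N in the product of truncated series act by 0. *)
Lemma twist_lie x y u : u \in Dm ->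
  twist (lie x y) u = twist x (twist y u) - twist y (twist x u).
Proof.
move=> uD; elim/loop_ind: x => [|x x' hx hx'|x n].
- by rewrite lie0l !twist0l twist0r subr0.
- by rewrite lieDl !twistDl twistDr hx hx' opprD addrACA.
elim/loop_ind: y => [|y y' hy hy'|y m].
- by rewrite lie0r !twist0l twist0r subr0.
- by rewrite lieDr !twistDl twistDr hy hy' opprD addrACA.
rewrite lie_tmon !twist_tmon !twist1_comp [X in _ - X]exchange_big -sumrB.
transitivity (\sum_(i < N.+1) \sum_(j < N.+1)
   (binz F n i * binz F m j) *: rho (am (lie x y) (i + j)%N) u).
  rewrite (@truncated_cauchy F V (binz F n) (binz F m) (fun k => rho (am (lie x y) k) u)).
    by rewrite binzD.
  by move=> k Nk; apply: Dvan.
apply: eq_bigr => i _; rewrite -sumrB; apply: eq_bigr => j _.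
by rewrite [X in _ - X *: _]mulrC -scalerBr -rep_lie lie_am_nonneg.
Qed.

Lemma usub_valDZ c (u w : Usubmod rho Ab v) :
  usub_val (c *: u + w) = c *: usub_val u + usub_val w.
Proof. exact: (linearP (val : Usubmod rho Ab v -> V)). Qed.

Lemma usub_valB (u w : Usubmod rho Ab v) : usub_val (u - w) = usub_val u - usub_val w.
Proof. exact: (linearB (val : Usubmod rho Ab v -> V)). Qed.

Definition twist_usub (f : loop g) (u : Usubmod rho Ab v) : Usubmod rho Ab v :=
  USubmod (twist_stable f (usub_mem u)).

Lemma usub_val_inj : injective (@usub_val F (affine B) V rho Ab v).
Proof. exact: val_inj. Qed.

Lemma twist_usub_linl c x y u :
  twist_usub (c *: x + y) u = c *: twist_usub x u + twist_usub y u.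
Proof. by apply: usub_val_inj; rewrite usub_valDZ /= twist_linl. Qed.

Lemma twist_usub_linr c x u w :
  twist_usub x (c *: u + w) = c *: twist_usub x u + twist_usub x w.
Proof.
apply: usub_val_inj; rewrite [RHS]usub_valDZ -[LHS]/(twist x (usub_val (c *: u + w))).
by rewrite usub_valDZ twist_linr.
Qed.

Lemma twist_usub_lie x y u : twist_usub (lie x y) u =
  twist_usub x (twist_usub y u) - twist_usub y (twist_usub x u).
Proof.
apply: usub_val_inj; apply: etrans (esym (usub_valB _ _)).
by apply: twist_lie; apply: usub_mem.
Qed.

Definition twist_rep : lieRep (loop g) (Usubmod rho Ab v) :=
  LieRep twist_usub_linl twist_usub_linr twist_usub_lie.

Lemma twist_rep_const x u : usub_val (twist_rep (tmon x 0) u) = rho (am x 0) (usub_val u).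
Proof.
rewrite /= twist_tmon /twist1 big_ord_recl scale1r big1 ?addr0 // => k _.
by rewrite /binz /= scale0r.
Qed.

(* t^k is a linear combination of powers of 1 + t, so that the g[t]-span of v is
   contained in its cyclic span under the twisted action. *)
Lemma twist_rep_cyclic (Cr : affine B -> Prop) :
  (forall q, Cr q -> exists x (n : nat), q = am x n) ->
  (forall u, u \in Dm -> u \in Uspan rho Cr v) -> cyclic_rep twist_rep.
Proof.
move=> CrE DC; pose v1 : Usubmod rho Ab v := USubmod (Uspan_refl rho Ab v).
exists v1 => w; pose S u := exists2 u', usub_val u' = u & u' \in Uspan twist_rep (fun=> True) v1.
have Ssub : submod_closed (fun u => `[< S u >] : bool).
  apply: asbool_submod => [|c _ _ [u1 <- u1S] [u2 <- u2S]].
    exists 0; last exact: submod0 (Uspan_closed _ _ _).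
    exact: (linear0 (val : Usubmod rho Ab v -> V)).
  exists (c *: u1 + u2); first exact: usub_valDZ.
  exact: (submodZD (Uspan_closed _ _ _)).
suff /asboolP[w' /usub_val_inj -> //] : usub_val w \in (fun u => `[< S u >] : bool).
apply: (Uspan_min Ssub _ _ (DC _ (usub_mem w))).
  by apply/asboolP; exists v1 => //; apply: Uspan_refl.
move=> q _ /CrE[x [k ->]] /asboolP[u <- uS]; apply/asboolP.
have [s sE] := binz_expand F k.
exists (twist_rep (\sum_(p <- s) p.1 *: tmon x p.2) u); last exact: Uspan_act.
have tw_sum : twist (\sum_(p <- s) p.1 *: tmon x p.2) (usub_val u) =
    \sum_(p <- s) p.1 *: twist1 x p.2 (usub_val u).
  elim: (s) => [|p s' ih]; first by rewrite !big_nil twist0l.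
  by rewrite !big_cons twist_linl ih twist_tmon.
rewrite /= tw_sum; under eq_bigr => p _ do rewrite scaler_sumr.
rewrite exchange_big /=.
under eq_bigr => i _.
  under eq_bigr => p _ do rewrite scalerA.
  rewrite -scaler_suml sE; over.
have [kN|Nk] := ltnP k N.+1.
  rewrite (bigD1 (Ordinal kN)) //= eqxx scale1r big1 ?addr0 // => i.
  by rewrite -val_eqE => /= /negPf ->; rewrite scale0r.
(* For k > N the truncated sum has no term t^k, and x t^k kills D. *)
rewrite Dvan ?usub_mem // big1 // => i _.
by rewrite ltn_eqF ?scale0r // (leq_trans (ltn_ord i)).
Qed.

End Twist.

(** * Dominance and integrality of sigma(m Lambda_0) *)

Section SigmaWeight.
Variables (F : numFieldType) (g : fdLieAlgType F) (T : triangular g) (B : inv_form g).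
Local Notation H := (subvs_of (cartan T)).
Local Notation dual := 'Hom(H, F^o).
Local Notation alpha := (tnth (simple_roots T)).
Hypothesis simp : simple_lie g.
Hypothesis norm : normalized T B.
Hypothesis SL : simply_laced T.

(** Affine coroots have no component along d, so the affine Weyl group acts on weights modulo
    delta. *)
Lemma affwt_eval_coroot_mod (L L' : affwt T) i : L.1 = L'.1 ->
  affwt_eval L (affine_coroot i) = affwt_eval L' (affine_coroot i).
Proof.
by rewrite /affwt_eval => ->; case: i => [j|] /=; rewrite !(mulr0 L.2) !(mulr0 L'.2).
Qed.

Lemma affine_weyl_mod w (L L' : affwt T) : L.1 = L'.1 ->
  (affine_weyl w L).1 = (affine_weyl w L').1.
Proof.
move=> e; have subE (X Y : affwt T) : (X - Y).1 = X.1 - Y.1 by [].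
elim: w => [|i w ih]; first exact: e.
have step X : affine_weyl (i :: w) X = affine_weyl w X -
    (affwt_eval (affine_weyl w X) (affine_coroot i) : F^o) *: affine_root i by [].
by rewrite !step !subE ih (affwt_eval_coroot_mod i ih).
Qed.

Lemma sigma_weight_dominant (sigma : dual * F^o -> dual * F^o) (m : nat) (L : affwt T) :
  in_Sigma B sigma -> L.1 = sigma (0, m%:R) ->
  forall i, exists k : nat, affwt_eval L (affine_coroot i) = k%:R.
Proof.
move=> [[c [w [cc sE]]] dom] LE i.
have w0 : weyl_dual w (0 : dual) = 0.
  by elim: w {sE} => //= j w ->; rewrite zero_lfunE scale0r subr0.
have L1 : L.1 = (m%:R *: nu B c, m%:R) by rewrite LE sE /translation /= w0 add0r.
have ge0 : 0 <= affwt_eval L (affine_coroot i).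
  have /dom/(_ i) : dominant_chamber (T := T) (0, m%:R).
    by case=> [j|]; rewrite /affwt_eval /= zero_lfunE ?mulr0 ?mulr1 !add0r ?addr0.
  rewrite -LE; case: L {LE L1} => l d; rewrite /affwt_eval /=.
  by case: i => [j|] /=; rewrite !mulr0.
suff [z zE] : exists z : int, affwt_eval L (affine_coroot i) = z%:~R.
  have : 0 <= z by rewrite -(ler0z F) -zE.
  by case: z zE => // k -> _; exists k.
have /choice[r rE] := cc.
rewrite /affwt_eval L1; case: i {ge0} => [j|] /=.
  rewrite !mulr0 !addr0 scale_lfunE nu_sym (nu_coroot_simple simp norm j SL) rE.
  by exists (m%:Z * r j); rewrite intrM.
(* At index 0 the value is m - m Theta(c), and Theta(c) is an integer because Theta is a sum of
   simple roots. *)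
rewrite mulr1 mulr0 addr0 scale_lfunE nu_sym nuN norm opp_lfunE.
have [n nE] := Qp_highest_root simp norm.
have -> : highest_root T c = (\sum_j (r j *+ n j))%:~R.
  rewrite nE sum_lfunE rmorph_sum /=; apply: eq_bigr => j _.
  by rewrite -scaler_nat scale_lfunE rE rmorphMn /= scaler_nat.
exists (m%:Z - m%:Z * \sum_j (r j *+ n j)).
by rewrite addrC intrD mulrNz intrM -[_ *: _]/(_ * _) mulrN.
Qed.

End SigmaWeight.

Theorem corollaryC (R : realType) (g : fdLieAlgType R[i])
    (T : triangular g) (B : inv_form g) (m : nat)
    (lam : 'Hom(subvs_of (cartan T), R[i]^o)) (lamv : subvs_of (cartan T))
    (D : demazure B m lamv) :
  simple_lie g -> simply_laced T -> normalized T B ->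
  (1 <= m)%N -> dominant_integral lam ->
  dominant_coweight lamv -> nu B lamv = lam ->
  exists phi : lieRep (loop g) (demazure_module D),
    cyclic_rep phi /\
    forall (x : g) (u : demazure_module D),
      demazure_val (phi (tmon x 0) u) = dm_rho D (tmon x 0, 0, 0) (demazure_val u).
Proof.
move=> simp SL norm _ _ dom _.
have [irr [vL [vL0 wvL] nvL]] := dm_VP D; have [v0 wv] := dm_vP D.
have Lint := sigma_weight_dominant simp norm SL (dm_sigmaP D) (dm_LP D).
(* Modulo delta, w(L) = t_{-nu(c')}(m Lambda_0) with - c' = w_0(lambda^v). *)
have E : (affine_weyl (dm_w D) (dm_L D)).1 = (m%:R *: nu B (weyl (dm_w0 D) lamv), m%:R).
  rewrite (@affine_weyl_mod _ _ _ _ _ (dm_sigma D (0, m%:R), 0)) ?(dm_LP D) // -dm_factor.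
  by rewrite /translation /= add0r nuN opprK.
have lowv j y : root_space (- tnth (simple_roots T) j) y -> dm_rho D (am B y 0) (dm_v D) = 0.
  have [k kE] := longest_antidominant simp norm SL j (dm_w0P D) dom.
  apply: (extremal_lowering simp norm irr vL0 wvL nvL Lint (k := m * k) v0 wv).
  rewrite /affwt_eval E /= !mulr0 !addr0 scale_lfunE kE.
  by rewrite -[_ *: _]/(_ * _) mulrN natrM.
have stab := demazure_current_stable simp norm lowv.
have wle nu' w : w != 0 -> wvec (fun t => dm_rho D (tor B t)) (@affwt_eval _ _ T) nu' w ->
    Qa (dm_L D - nu').
  by move=> w0 ww; apply: (highest_weights simp norm irr vL0 wvL nvL w0 ww).
have [N van] := demazure_degree_bound wv v0 wle.
exists (twist_rep stab van); split; last exact: twist_rep_const.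
apply: (@twist_rep_cyclic _ _ _ _ _ _ _ _ stab van (@current_root _ _ T B)).
  by move=> q [b [x [n [-> _]]]]; exists x, n.
by move=> u uD; apply: (demazure_current_span wv).
Qed.
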